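(* Let $n\ge 1$, $0<s<1$, let $\Omega\subset\mathbb{R}^n$ be a bounded open set with Lipschitz continuous boundary, and let $\beta\in L^1(\mathbb{R}^n\setminus\Omega)$ be non-negative. Let $T_D$, $T_R$ and $T_N$ be the semigroups on $L^2(\Omega)$ associated with the forms $\mathfrak a_D$, $\mathfrak a_R$ and $\mathfrak a_N$, respectively. Then $$0\le T_D\le T_R\le T_N$$ in the sense of domination of semigroups.
   Context: Functions are real-valued and identified when equal almost everywhere. $C_{n,s}:=\frac{s2^{2s}\Gamma(\frac{2s+n}{2})}{\pi^{n/2}\Gamma(1-s)}$. $W^{s,2}_{\beta,\Omega}$ is the space of all measurable $u:\mathbb{R}^n\to\mathbb{R}$ with $\int_\Omega|u|^2dx+\int_{\mathbb{R}^n\setminus\Omega}|u|^2|\beta|dx+\iint_{\mathbb{R}^{2n}\setminus(\mathbb{R}^n\setminus\Omega)^2}\frac{|u(x)-u(y)|^2}{|x-y|^{n+2s}}dxdy<\infty$; $W^{s,2}_\Omega:=W^{s,2}_{0,\Omega}$ (the case $\beta=0$). For $u,v\in W^{s,2}_{\Omega}$, $$\mathcal E(u,v):=\frac{C_{n,s}}{2}\int_\Omega\int_\Omega\frac{(u(x)-u(y))(v(x)-v(y))}{|x-y|^{n+2s}}dydx+C_{n,s}\int_\Omega\int_{\mathbb{R}^n\setminus\Omega}\frac{(u(x)-u(y))(v(x)-v(y))}{|x-y|^{n+2s}}dydx.$$ Extensions: let $\rho(x):=\int_\Omega\frac{dy}{|x-y|^{n+2s}}$ for $x\in\mathbb{R}^n\setminus\overline\Omega$.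 For $u\in L^2(\Omega)$ let $u_D=u_N=u_R=u$ in $\Omega$, and $u_D=0$ in $\mathbb{R}^n\setminus\Omega$; for $x\in\mathbb{R}^n\setminus\overline\Omega$ let $u_N(x):=\frac1{\rho(x)}\int_\Omega\frac{u(y)}{|x-y|^{n+2s}}dy$ and $u_R(x):=\frac{C_{n,s}}{C_{n,s}\rho(x)+\beta(x)}\int_\Omega\frac{u(y)}{|x-y|^{n+2s}}dy$. Forms on $L^2(\Omega)$: $D(\mathfrak a_D)=\{u\in L^2(\Omega):u_D\in W^{s,2}_\Omega\}$, $\mathfrak a_D(u,v)=\mathcal E(u_D,v_D)$; $D(\mathfrak a_N)=\{u\in L^2(\Omega):u_N\in W^{s,2}_\Omega\}$, $\mathfrak a_N(u,v)=\mathcal E(u_N,v_N)$; $D(\mathfrak a_R)=\{u\in L^2(\Omega):u_R\in W^{s,2}_{\beta,\Omega}\}$, $\mathfrak a_R(u,v)=\mathcal E(u_R,v_R)+\int_{\mathbb{R}^n\setminus\Omega}\beta u_Rv_Rdx$. These are densely defined, symmetric, closed non-negative forms; for $\bullet\in\{D,N,R\}$, $A_\bullet$ is the non-negative selfadjoint operator with $D(A_\bullet)=\{u\in D(\mathfrak a_\bullet):\exists f\in L^2(\Omega)\ \mathfrak a_\bullet(u,v)=(f,v)_{L^2(\Omega)}\ \forall v\in D(\mathfrak a_\bullet)\}$, $A_\bullet u=f$, and $T_\bullet=(e^{-tA_\bullet})_{t\ge0}$. Domination: a semigroup $T$ on $L^2(\Omega)$ is positivity-preserving (written $0\le T$) if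 $u\ge0$ implies $T(t)u\ge0$ for all $t\ge 0$. For semigroups $S,T$ with $T$ positivity-preserving, $S\le T$ means $|S(t)f|\le T(t)|f|$ a.e. for all $t\ge0$ and $f\in L^2(\Omega)$. *)

(* Defs.v *)
From HB Require Import structures.
From mathcomp Require Import all_boot all_order all_algebra.
From mathcomp Require Import all_classical all_reals all_analysis.

Set Implicit Arguments.
Unset Strict Implicit.
Unset Printing Implicit Defensive.

Import Order.TTheory GRing.Theory Num.Theory.
Import numFieldNormedType.Exports.

Local Open Scope classical_set_scope.
Local Open Scope ring_scope.

Definition measure_rV_display : measure_display.
Proof. exact. Qed.

Section measurable_rV.
Context {R : realType} {n : nat}.

Let coord : 'I_n -> 'rV[R]_n -> R := fun i x => x ord0 i.

Let rV_set0 : g_sigma_preimage coord set0.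
Proof. exact: sigma_algebra0. Qed.

Let rV_setC A : g_sigma_preimage coord A -> g_sigma_preimage coord (~` A).
Proof. exact: sigma_algebraC. Qed.

Let rV_bigcup (F : _^nat) : (forall i, g_sigma_preimage coord (F i)) ->
  g_sigma_preimage coord (\bigcup_i (F i)).
Proof. exact: sigma_algebra_bigcup. Qed.

(* The sigma-algebra generated by the coordinates, that is, the Borel
   sigma-algebra of R^n. *)
HB.instance Definition _ := @isMeasurable.Build measure_rV_display
  'rV[R]_n (g_sigma_preimage coord) rV_set0 rV_setC rV_bigcup.

End measurable_rV.

Lemma measurable_coord (R : realType) n (i : 'I_n) :
  measurable_fun [set: 'rV[R]_n] (fun x : 'rV[R]_n => x ord0 i).
Proof.
move=> _ Y mY; rewrite setTI; apply: sub_sigma_algebra => /=.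
rewrite -bigcup_seq/=; exists i => /=; first by rewrite mem_index_enum.
by exists Y => //; rewrite setTI.
Qed.

Lemma measurable_fun_coordP (R : realType) n d (T : measurableType d)
    (f : T -> 'rV[R]_n) :
  (forall i, measurable_fun [set: T] (fun x => f x ord0 i)) ->
  measurable_fun [set: T] f.
Proof.
move=> mf _ Y mY; rewrite setTI.
move: Y mY; apply: smallest_sub.
  split.
  - by rewrite /= preimage_set0.
  - by move=> A mA; rewrite setTD preimage_setC; exact: measurableC.
  - by move=> F mF; rewrite preimage_bigcup; exact: bigcup_measurable.
rewrite -bigcup_seq; apply: bigcup_sub => i _ A [B mB <-].
rewrite setTI.
have := mf i measurableT B mB.
by rewrite setTI.
Qed.

Definition rV_cons (R : realType) n (p : R * 'rV[R]_n) : 'rV[R]_n.+1 :=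
  row_mx (p.1)%:M p.2 :> 'rV[R]_(1 + n).

Lemma rV_cons0 (R : realType) n (p : R * 'rV[R]_n) :
  rV_cons p ord0 ord0 = p.1.
Proof.
rewrite (_ : ord0 = lshift n (ord0 : 'I_1) :> 'I_n.+1); last exact/val_inj.
by apply: etrans (row_mxEl _ _ _ _) _; rewrite mxE eqxx mulr1n.
Qed.

Lemma rV_consS (R : realType) n (p : R * 'rV[R]_n) (j : 'I_n) :
  rV_cons p ord0 (lift ord0 j) = p.2 ord0 j.
Proof.
rewrite (_ : lift ord0 j = rshift 1 j); last exact/val_inj.
exact: row_mxEr.
Qed.

Lemma measurable_rV_cons (R : realType) n :
  measurable_fun setT (@rV_cons R n).
Proof.
apply: measurable_fun_coordP => i.
have [j ->|->] := unliftP ord0 i.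
- under eq_fun do rewrite rV_consS.
  apply: (@measurableT_comp _ _ _ _ _ _ (fun x : 'rV[R]_n => x ord0 j)) => //.
  exact: measurable_coord.
- by under eq_fun do rewrite rV_cons0; exact: measurable_fst.
Qed.

Fixpoint lebesgue_rV (R : realType) n : set 'rV[R]_n -> \bar R :=
  match n return set 'rV[R]_n -> \bar R with
  | 0%N => \d_ (0 : 'rV[R]_0)
  | m.+1 => pushforward (@lebesgue_measure R \x
              @lebesgue_rV R m)%E (@rV_cons R m)
  end.

Lemma sigma_finite_measure_of d (T : measurableType d) (R : realType)
    (f : set T -> \bar R) :
  f set0 = 0%E -> (forall A, (0 <= f A)%E) -> semi_sigma_additive f ->
  sigma_finite setT f ->
  exists m : {sigma_finite_measure set T -> \bar R},
    m = f :> (set T -> \bar R).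
Proof.
move=> f0 f_ge0 f_sigma f_sfin.
pose q1 := isMeasure.Build _ _ _ f f0 f_ge0 f_sigma.
pose Q1 : {measure set T -> \bar R} := HB.pack f q1.
pose q2 := Measure_isSigmaFinite.Build _ _ _ Q1 f_sfin.
pose Q2 : {sigma_finite_measure set T -> \bar R} := HB.pack f q1 q2.
by exists Q2.
Qed.

Lemma lebesgue_rV_subproof (R : realType) n :
  exists m : {sigma_finite_measure set 'rV[R]_n -> \bar R},
    m = @lebesgue_rV R n :> (set 'rV[R]_n -> \bar R).
Proof.
elim: n => [|n [m mE]] /=; first by exists \d_ (0 : 'rV[R]_0).
rewrite -mE.
pose p : {measure set _ -> \bar R} :=
  (@lebesgue_measure R \x m)%E.
have mcons A : measurable A -> measurable (@rV_cons R n @^-1` A).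
  by move=> mA; rewrite -[X in measurable X]setTI; exact: measurable_rV_cons.
have p0 : pushforward p (@rV_cons R n) set0 = 0%E.
  by rewrite /pushforward preimage_set0 measure0.
have p_ge0 A : (0 <= pushforward p (@rV_cons R n) A)%E.
  exact: (measure_ge0 p).
have p_sigma : semi_sigma_additive (pushforward p (@rV_cons R n)).
  move=> F mF tF mUF; rewrite /pushforward preimage_bigcup.
  apply: measure_semi_sigma_additive.
  - by move=> k; exact: mcons.
  - apply/trivIsetP => i j _ _ ij; rewrite -preimage_setI.
    by move/trivIsetP : tF => /(_ _ _ _ _ ij) ->//; rewrite preimage_set0.
  - by rewrite -preimage_bigcup; exact: mcons.
have p_sfin : sigma_finite setT (pushforward p (@rV_cons R n)).
  have [F TF Foo] : sigma_finite setT p.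
    have /sigma_finiteP[F [TF ndF Foo]] := sigma_finiteT (@lebesgue_measure R).
    have /sigma_finiteP[G [TG ndG Goo]] := sigma_finiteT m.
    exists (fun k => F k `*` G k).
      rewrite -setXTT TF TG predeqE => -[x y]; split.
        move=> [/= [k _ Fkx] [l _ Gly]]; exists (maxn k l) => //; split.
        - by move: x Fkx; exact/subsetPset/ndF/leq_maxl.
        - by move: y Gly; exact/subsetPset/ndG/leq_maxr.
      by move=> [k _ []/= ? ?]; split; exists k.
    move=> k; have [? ?] := Foo k; have [? ?] := Goo k.
    split; first exact: measurableX.
    by rewrite /p /= product_measure1E// lte_mul_pinfty// ge0_fin_numE.
  pose uncons (x : 'rV[R]_n.+1) : R * 'rV[R]_n :=
    ((lsubmx (x : 'rV[R]_(1 + n))) ord0 ord0, rsubmx (x : 'rV[R]_(1 + n))).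
  have consK : cancel uncons (@rV_cons R n).
    move=> x; rewrite /uncons /rV_cons /= -mx11_scalar.
    exact: (@hsubmxK _ 1 1 n x).
  have unconsK : cancel (@rV_cons R n) uncons.
    move=> [a x]; rewrite /uncons /rV_cons /= row_mxKl row_mxKr.
    by rewrite mxE eqxx mulr1n.
  have muncons : measurable_fun setT uncons.
    apply/measurable_fun_pairP; split.
    - rewrite (_ : _ \o _ = fun x : 'rV[R]_n.+1 => x ord0 ord0).
        exact: measurable_coord.
      by apply/funext => x /=; rewrite mxE; congr (x _ _); apply/val_inj.
    - apply: measurable_fun_coordP => i /=.
      rewrite (_ : (fun _ => _) =
          fun x : 'rV[R]_n.+1 => x ord0 (rshift 1 i : 'I_n.+1)).
        exact: measurable_coord.
      by apply/funext => x /=; rewrite mxE.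
  exists (fun k => uncons @^-1` F k).
    by rewrite -preimage_bigcup -TF preimage_setT.
  move=> k; have [mF Fk] := Foo k; split.
    by rewrite -[X in measurable X]setTI; exact: muncons.
  rewrite /pushforward -comp_preimage.
  by rewrite (_ : uncons \o _ = id)//; apply/funext => x; exact: unconsK.
exact: sigma_finite_measure_of p0 p_ge0 p_sigma p_sfin.
Qed.

Section lebesgue_rV_measure.
Context (R : realType) (n : nat).

Let lebesgue0 : @lebesgue_rV R n set0 = 0%E.
Proof. by have [m <-] := lebesgue_rV_subproof R n. Qed.

Let lebesgue_ge0 A : (0 <= @lebesgue_rV R n A)%E.
Proof. by have [m <-] := lebesgue_rV_subproof R n. Qed.

Let lebesgue_semi_sigma_additive : semi_sigma_additive (@lebesgue_rV R n).
Proof.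
have [m <-] := lebesgue_rV_subproof R n.
exact: measure_semi_sigma_additive.
Qed.

HB.instance Definition _ := isMeasure.Build _ _ _ (@lebesgue_rV R n)
  lebesgue0 lebesgue_ge0 lebesgue_semi_sigma_additive.

Let lebesgue_sigma_finite : sigma_finite setT (@lebesgue_rV R n).
Proof.
by have [m <-] := lebesgue_rV_subproof R n; exact: sigma_finiteT.
Qed.

HB.instance Definition _ := Measure_isSigmaFinite.Build _ _ _
  (@lebesgue_rV R n) lebesgue_sigma_finite.

End lebesgue_rV_measure.

Lemma lebesgue_rV_box (R : realType) n (a b : 'rV[R]_n) :
  (forall i, a ord0 i <= b ord0 i) ->
  lebesgue_rV [set x | forall i, x ord0 i \in `[a ord0 i, b ord0 i]] =
  (\prod_(i < n) (b ord0 i - a ord0 i))%:E.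
Proof.
elim: n => [|n IHn] in a b *.
  by move=> _; rewrite big_ord0 /= diracE mem_set// => -[].
move=> ab.
pose a' : 'rV[R]_n := \row_i a ord0 (lift ord0 i).
pose b' : 'rV[R]_n := \row_i b ord0 (lift ord0 i).
set B := [set x | _]; rewrite /= /pushforward.
pose B' := [set x : 'rV[R]_n | forall i, x ord0 i \in `[a' ord0 i, b' ord0 i]].
have -> : @rV_cons R n @^-1` B = `[a ord0 ord0, b ord0 ord0] `*` B'.
  rewrite predeqE => -[c x]; rewrite /B /B' /=; split.
    move=> cx; split.
      by have := cx ord0; rewrite rV_cons0.
    by move=> i; have := cx (lift ord0 i); rewrite rV_consS !mxE.
  move=> [hc hx] i; have [j ->|->] := unliftP ord0 i.
    by rewrite rV_consS; have := hx j; rewrite !mxE.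
  by rewrite rV_cons0.
have mB' : measurable B'.
  rewrite (_ : B' = \bigcap_(i in [set: 'I_n])
    ((fun x : 'rV[R]_n => x ord0 i) @^-1` `[a' ord0 i, b' ord0 i])).
    apply: fin_bigcap_measurable => // i _; rewrite -[X in measurable X]setTI.
    by apply: measurable_coord => //; exact: measurable_itv.
  by rewrite predeqE => x; split => [hx i _|hx i]; [exact: hx|exact: (hx i)].
have EB' : lebesgue_rV B' = (\prod_(i < n) (b' ord0 i - a' ord0 i))%:E.
  by apply: IHn => i; rewrite !mxE.
rewrite product_measure1E// big_ord_recl EFinM; congr (_ * _)%E.
  apply: etrans (lebesgue_measure_itv `[a ord0 ord0, b ord0 ord0]) _.
  rewrite /= lte_fin.
  by case: ltgtP (ab ord0) => // ->; rewrite subrr.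
rewrite [LHS]EB'; congr EFin.
by apply: eq_bigr => i _; rewrite !mxE.
Qed.

(* The norm [`|x|] of the library on ['rV[R]_n] is the maximum norm; it gives
   the same topology and the same bounded sets. *)
Definition enorm (R : realType) n (x : 'rV[R]_n) : R :=
  Num.sqrt (\sum_(i < n) x ord0 i ^+ 2).

(* Near each boundary point, after a rigid motion [y |-> (y - x) *m Q],
   Omega is the part above the graph of a Lipschitz function [g] of the n - 1
   coordinates other than the i-th one. *)
Definition lipschitz_boundary (R : realType) n (Omega : set 'rV[R]_n) :=
  forall x, (closure Omega `\` interior Omega) x ->
  exists (r : R) (Q : 'M[R]_n) (i : 'I_n) (L : R) (g : 'rV[R]_n.-1 -> R),
    [/\ 0 < r,
        Q *m Q^T = 1%:M,
        forall a b, `|g a - g b| <= L * enorm (a - b) &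
        forall y, enorm (y - x) < r ->
          (Omega y <->
           g (col' i ((y - x) *m Q)) < ((y - x) *m Q) ord0 i)].

Definition Gamma (R : realType) (z : R) : R :=
  \int[lebesgue_measure]_(t in `]0, +oo[) (t `^ (z - 1) * expR (- t)).

Definition Cns (R : realType) (n : nat) (s : R) : R :=
  s * 2 `^ (2 * s) * Gamma ((2 * s + n%:R) / 2) /
  (pi `^ (n%:R / 2) * Gamma (1 - s)).

Section forms.
Context (R : realType) (n : nat).
Variables (s : R) (Omega : set 'rV[R]_n).
Implicit Types (u v w f beta : 'rV[R]_n -> R).

Local Notation mu := (@lebesgue_rV R n).
Local Notation C := (Cns n s).

Definition hkernel (x y : 'rV[R]_n) : R := (enorm (x - y) `^ (n%:R + 2 * s))^-1.

(* An element of L^2(Omega) is represented by a function on R^n of which only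
   the values on Omega matter, up to equality almost everywhere in Omega. *)

Definition L2 : set ('rV[R]_n -> R) := [set u | u \_ Omega \in Lfun mu 2%:E].

Definition L2norm u : \bar R := 'N[mu]_2%:E[EFin \o (u \_ Omega)].

Definition L2dot u v : R := \int[mu]_(x in Omega) (u x * v x).

Definition ae_in (P : 'rV[R]_n -> Prop) := \forall x \ae mu, Omega x -> P x.

Definition Wspace beta : set ('rV[R]_n -> R) :=
  [set u : 'rV[R]_n -> R | measurable_fun [set: 'rV[R]_n] u /\
    (\int[mu]_(x in Omega) (`|u x| ^+ 2)%:E
     + \int[mu]_(x in ~` Omega) (`|u x| ^+ 2 * `|beta x|)%:E
     + \int[mu \x mu]_(z in ~` (~` Omega `*` ~` Omega))
         (`|u z.1 - u z.2| ^+ 2 * hkernel z.1 z.2)%:E < +oo)%E].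

Definition energy u v : R :=
  C / 2 * \int[mu]_(x in Omega) \int[mu]_(y in Omega)
            ((u x - u y) * (v x - v y) * hkernel x y)
  + C * \int[mu]_(x in Omega) \int[mu]_(y in ~` Omega)
            ((u x - u y) * (v x - v y) * hkernel x y).

Definition rho (x : 'rV[R]_n) : R := \int[mu]_(y in Omega) hkernel x y.

Definition ext_D u : 'rV[R]_n -> R := u \_ Omega.

(* The boundary of Omega is Lebesgue-negligible; the extensions are set to 0
   there. *)
Definition ext_with w u : 'rV[R]_n -> R := fun x =>
  if x \in Omega then u x else if x \in closure Omega then 0 else w x.

Definition ext_N u : 'rV[R]_n -> R :=
  ext_with (fun x => (rho x)^-1 * \int[mu]_(y in Omega) (u y * hkernel x y)) u.

Definition ext_R beta u : 'rV[R]_n -> R :=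
  ext_with (fun x => C / (C * rho x + beta x) *
                     \int[mu]_(y in Omega) (u y * hkernel x y)) u.

Definition dom_D : set ('rV[R]_n -> R) :=
  [set u | L2 u /\ Wspace (cst 0) (ext_D u)].
Definition form_D u v : R := energy (ext_D u) (ext_D v).

Definition dom_N : set ('rV[R]_n -> R) :=
  [set u | L2 u /\ Wspace (cst 0) (ext_N u)].
Definition form_N u v : R := energy (ext_N u) (ext_N v).

Definition dom_R beta : set ('rV[R]_n -> R) :=
  [set u | L2 u /\ Wspace beta (ext_R beta u)].
Definition form_R beta u v : R :=
  energy (ext_R beta u) (ext_R beta v)
  + \int[mu]_(x in ~` Omega) (beta x * ext_R beta u x * ext_R beta v x).

(* The graph of the operator A of the form [a] with domain [D]: u is in D(A)
   and A u = f. *)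
Definition form_operator (D : set ('rV[R]_n -> R))
    (a : ('rV[R]_n -> R) -> ('rV[R]_n -> R) -> R) u f :=
  [/\ D u, L2 f & forall v, D v -> a u v = L2dot f v].

(* A family of operators on L^2(Omega); being linear and bounded almost
   everywhere, each of them is compatible with almost everywhere equality. *)
Definition L2_operators := R -> ('rV[R]_n -> R) -> 'rV[R]_n -> R.

Definition C0_semigroup (T : L2_operators) :=
  [/\ forall t u, 0 <= t -> L2 u -> L2 (T t u),
      forall t (c : R) u v, 0 <= t -> L2 u -> L2 v ->
        ae_in (fun x => T t (fun y => c * u y + v y) x = c * T t u x + T t v x),
      forall t, 0 <= t -> exists M : R,
        forall u, L2 u -> (L2norm (T t u) <= M%:E * L2norm u)%E,
      (forall u, L2 u -> ae_in (fun x => T 0 u x = u x)) /\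
      (forall t1 t2 u, 0 <= t1 -> 0 <= t2 -> L2 u ->
        ae_in (fun x => T (t1 + t2) u x = T t1 (T t2 u) x)) &
      forall u, L2 u ->
        L2norm (fun x => T h u x - u x) @[h --> 0^'+] --> 0%E].

(* T = (e^{-tA})_t: T is the C_0-semigroup whose generator is - A. *)
Definition generated_by (A : ('rV[R]_n -> R) -> ('rV[R]_n -> R) -> Prop)
    (T : L2_operators) :=
  C0_semigroup T /\
  forall u f, L2 u -> L2 f ->
    (A u f <->
     L2norm (fun x => (T h u x - u x) / h - - f x) @[h --> 0^'+] --> 0%E).

Definition form_semigroup (D : set ('rV[R]_n -> R))
    (a : ('rV[R]_n -> R) -> ('rV[R]_n -> R) -> R) (T : L2_operators) :=
  generated_by (form_operator D a) T.

Definition positivity_preserving (T : L2_operators) :=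
  forall t u, 0 <= t -> L2 u ->
    ae_in (fun x => 0 <= u x) -> ae_in (fun x => 0 <= T t u x).

Definition semigroup_dominated (S T : L2_operators) :=
  positivity_preserving T /\
  forall t f, 0 <= t -> L2 f ->
    ae_in (fun x => `|S t f x| <= T t (fun y => `|f y|) x).

End forms.

(* Main.v *)
(* A C_0-semigroup is locally bounded, and averages of an orbit lie in the
   domain of its generator, so data in the domain that remain in a given closed
   invariant cone are dense.  For such data the squared L2 norm of the negative
   part of T(t) g, or of the positive part of S(t) g - T(t) h, is nonincreasing:
   its derivative is a value of the forms whose sign is that of the first
   Beurling-Deny criterion, respectively of Ouhabaz' domination criterion.

   To check these signs, extend u outside Omega by kappa(y) U(y) where
   U(y) = int_Omega u(x) k(x, y) dx, with kappa = 0, C / (C rho + beta) and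
   1 / rho in the three cases.  After expansion the exterior part of each form
   is the integral over y of
     C (int_Omega u v k(., y) - kappa(y) U(y) V(y)),
   which decreases with kappa when u and v are nonnegative, and
   0 <= kappa_R <= kappa_N. *)
Require Import Defs.
From HB Require Import structures.
From mathcomp Require Import all_boot all_order all_algebra.
From mathcomp Require Import all_classical all_reals all_analysis.
From mathcomp Require Import measurable_realfun.
From mathcomp Require Import ring lra.

Set Implicit Arguments.
Unset Strict Implicit.
Unset Printing Implicit Defensive.

Import Order.TTheory GRing.Theory Num.Theory.
Import numFieldNormedType.Exports.

Local Open Scope classical_set_scope.
Local Open Scope ring_scope.

(** * Seminormed spaces and strongly continuous semigroups *)

(** Functions are kept as they are, without a quotient, so the semigroup laws hold only up to
    [N (u - v) = 0] and the abstract part works in a complete seminorm. A semigroup comes with one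
    bound per time and with continuity at 0 from the right; the bound on [0, b] therefore needs a
    Baire type argument, and time evolution is followed by Euler steps with uniform errors instead
    of differentiating a norm. Positivity is proved with approximating data of arbitrary sign. Only
    afterwards is the cone of nonnegative functions known to be invariant, and the domination
    criterion is then tested on nonnegative orbits only. The two generators have different domains,
    so a single f is approximated by two different data. The delicate point of the criterion is that
    (u - w)^+ must lie in the domain of the smaller semigroup although w is only in the domain of
    the larger one. Since w >= 0, it lies below u, and this controls the only term in which the two
    exterior forms differ. *)

Lemma half_expn_small (R : realType) (e : R) : 0 < e -> exists k : nat, 2 ^- k <= e.
Proof.
move=> e_gt0; exists (Num.truncn e^-1).
rewrite invf_ple ?posrE ?exprn_gt0//.
have /truncn_itv /andP[_ /ltW le1] : 0 <= e^-1 by rewrite invr_ge0 ltW.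
by rewrite (le_trans le1)// -natrX ler_nat; exact: ltn_expl.
Qed.

(** [N] lives on a subset [X] of the space of all functions and may vanish off 0: functions equal
    almost everywhere stay distinct, and [N (u - v) = 0] replaces equality. *)
Record seminorm (R : realType) (V : lmodType R) (X : set V) (N : V -> R) := {
  sn_mem0 : X 0 ;
  sn_memL : forall (c : R) u v, X u -> X v -> X (c *: u + v) ;
  sn_ge0 : forall u, 0 <= N u ;
  sn_triangle : forall u v, X u -> X v -> N (u + v) <= N u + N v ;
  snZ : forall c u, X u -> N (c *: u) = `|c| * N u ;
  sn_complete : forall u : nat -> V, (forall k, X (u k)) ->
    (forall e, 0 < e -> exists K, forall i j,
      (K <= i)%N -> (K <= j)%N -> N (u i - u j) <= e) ->
    exists2 l, X l & forall e, 0 < e -> exists K, forall i,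
      (K <= i)%N -> N (u i - l) <= e }.

(** The bound [sg_bd] is for one time t and [sg_cont] concerns t = 0 from the right; uniform
    statements on [0, b] are derived from them below. *)
Record semigroup (R : realType) (V : lmodType R) (X : set V) (N : V -> R)
    (T : R -> V -> V) := {
  sg_mem : forall t u, 0 <= t -> X u -> X (T t u) ;
  sg_lin : forall t c u v, 0 <= t -> X u -> X v ->
    N (T t (c *: u + v) - (c *: T t u + T t v)) = 0 ;
  sg_bd : forall t, 0 <= t -> exists2 M, 0 <= M &
    forall u, X u -> N (T t u) <= M * N u ;
  sg_0 : forall u, X u -> N (T 0 u - u) = 0 ;
  sg_D : forall t1 t2 u, 0 <= t1 -> 0 <= t2 -> X u ->
    N (T (t1 + t2) u - T t1 (T t2 u)) = 0 ;
  sg_cont : forall u e, X u -> 0 < e -> exists2 d, 0 < d &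
    forall h, 0 < h < d -> N (T h u - u) <= e }.

Section seminorm_theory.
Context (R : realType) (V : lmodType R) (X : set V) (N : V -> R).
Hypothesis NX : seminorm X N.
Implicit Types (u v w : V) (c : R).

Lemma sn_memD u v : X u -> X v -> X (u + v).
Proof. by move=> Xu Xv; rewrite -[u]scale1r; exact: (sn_memL NX). Qed.

Lemma sn_memZ c u : X u -> X (c *: u).
Proof. by move=> Xu; rewrite -[_ *: _]addr0; apply: (sn_memL NX) => //; exact: (sn_mem0 NX). Qed.

Lemma sn_memN u : X u -> X (- u).
Proof. by rewrite -scaleN1r; exact: sn_memZ. Qed.

Lemma sn_memB u v : X u -> X v -> X (u - v).
Proof. by move=> Xu Xv; apply: sn_memD => //; exact: sn_memN. Qed.

Lemma sn_memS (I : Type) (r : seq I) (F : I -> V) :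
  (forall i, X (F i)) -> X (\sum_(i <- r) F i).
Proof.
move=> XF; elim/big_ind: _ => //; [exact: (sn_mem0 NX)|exact: sn_memD].
Qed.

Lemma snN u : X u -> N (- u) = N u.
Proof. by move=> Xu; rewrite -scaleN1r (snZ NX)// normrN1 mul1r. Qed.

Lemma snBC u v : X u -> X v -> N (u - v) = N (v - u).
Proof. by move=> Xu Xv; rewrite -opprB snN//; exact: sn_memB. Qed.

Lemma sn_tri w u v : X u -> X v -> X w -> N (u - v) <= N (u - w) + N (w - v).
Proof.
move=> Xu Xv Xw; rewrite -[u - v](subrKA w); apply: (sn_triangle NX); exact: sn_memB.
Qed.

Lemma sn_le u v : X u -> X v -> N u <= N (u - v) + N v.
Proof.
by move=> Xu Xv; rewrite -{1}[u](subrK v); apply: (sn_triangle NX) => //; exact: sn_memB.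
Qed.

Lemma sn0 : N 0 = 0.
Proof. by rewrite -(scale0r 0) (snZ NX) ?normr0 ?mul0r//; exact: (sn_mem0 NX). Qed.

Lemma sn_eq u v : X u -> X v -> N (u - v) = 0 -> N u = N v.
Proof.
move=> Xu Xv uv; apply/eqP; rewrite eq_le; apply/andP; split.
  by rewrite (le_trans (sn_le Xu Xv))// uv add0r.
by rewrite (le_trans (sn_le Xv Xu))// snBC// uv add0r.
Qed.

Lemma sn_sum (I : Type) (r : seq I) (F : I -> V) :
  (forall i, X (F i)) -> N (\sum_(i <- r) F i) <= \sum_(i <- r) N (F i).
Proof.
move=> XF; elim: r => [|i r ih]; first by rewrite !big_nil sn0.
rewrite !big_cons (le_trans (sn_triangle NX _ _))//; last by rewrite lerD2l.
exact: sn_memS.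
Qed.

Lemma sn_tri4 (a b c d : V) : X a -> X b -> X c -> X d ->
  N (a - d) <= N (a - b) + N (b - c) + N (c - d).
Proof.
move=> Xa Xb Xc Xd; rewrite (le_trans (sn_tri Xa Xd Xc))// lerD2r.
exact: sn_tri.
Qed.

End seminorm_theory.

(** * Local boundedness of strongly continuous semigroups *)

Section semigroup_theory.
Context (R : realType) (V : lmodType R) (X : set V) (N : V -> R).
Context (T : R -> V -> V).
Hypotheses (NX : seminorm X N) (TX : semigroup X N T).
Implicit Types (u v w : V) (c t h : R).

Let XT t u : 0 <= t -> X u -> X (T t u). Proof. exact: (sg_mem TX). Qed.
Let ge0 u : 0 <= N u. Proof. exact: (sn_ge0 NX). Qed.

Lemma sg_D_eq t1 t2 u : 0 <= t1 -> 0 <= t2 -> X u ->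
  N (T (t1 + t2) u) = N (T t1 (T t2 u)).
Proof.
move=> t1_ge0 t2_ge0 Xu.
apply: (sn_eq NX); [|by do 2 apply: XT => //|exact: (sg_D TX)].
by apply: XT => //; exact: addr_ge0.
Qed.

Lemma sg_B t u v : 0 <= t -> X u -> X v ->
  N (T t (u - v) - (T t u - T t v)) = 0.
Proof.
move=> t_ge0 Xu Xv; have := sg_lin TX (-1) t_ge0 Xv Xu.
by rewrite !scaleN1r ![- _ + _]addrC.
Qed.

Lemma sg_addE t u v : 0 <= t -> X u -> X v ->
  N (T t (u + v) - (T t u + T t v)) = 0.
Proof.
move=> t_ge0 Xu Xv; have := sg_lin TX 1 t_ge0 Xu Xv.
by rewrite !scale1r.
Qed.

Lemma sg_B_eq t u v : 0 <= t -> X u -> X v ->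
  N (T t (u - v)) = N (T t u - T t v).
Proof.
move=> t_ge0 Xu Xv.
apply: (sn_eq NX); [|apply: (sn_memB NX); exact: XT|exact: sg_B].
by apply: XT => //; exact: (sn_memB NX).
Qed.

Lemma sg_T0 t : 0 <= t -> N (T t 0) = 0.
Proof.
move=> t_ge0; have [M M_ge0 TM] := sg_bd TX t_ge0.
apply/eqP; rewrite eq_le ge0 (le_trans (TM _ (sn_mem0 NX)))//.
by rewrite (sn0 NX) mulr0.
Qed.

Lemma sg_Z t c u : 0 <= t -> X u -> N (T t (c *: u) - c *: T t u) = 0.
Proof.
move=> t_ge0 Xu; have X0 := sn_mem0 NX.
have := sg_lin TX c t_ge0 Xu X0; rewrite addr0 => H.
apply/eqP; rewrite eq_le ge0 andbT.
have XcT : X (c *: T t u) by exact/(sn_memZ NX)/XT.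
have := sn_tri NX (XT t_ge0 (sn_memZ NX c Xu)) XcT
  (sn_memD NX XcT (XT t_ge0 X0)).
by rewrite H (addrAC (c *: T t u)) subrr !add0r sg_T0.
Qed.

Lemma sg_Z_eq t c u : 0 <= t -> X u -> N (T t (c *: u)) = N (c *: T t u).
Proof.
move=> t_ge0 Xu; apply: (sn_eq NX); [|exact/(sn_memZ NX)/XT|exact: sg_Z].
by apply: XT => //; exact: (sn_memZ NX).
Qed.

(* If T were not locally bounded, there would be nested balls on which T t is
   large at times t tending to 0, and their common point would contradict the
   strong continuity at 0. *)
Let nested_ball :
  (forall M d : R, 0 <= M -> 0 < d -> exists t u,
     [/\ 0 <= t <= d, X u & M * N u < N (T t u)]) ->
  forall k x (r : R), X x -> 0 < r -> exists t x' r',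
    [/\ X x', 0 < r' <= r / 2, N (x' - x) <= r / 2, 0 <= t <= k.+1%:R^-1 &
      forall y, X y -> N (y - x') <= r' -> k%:R <= N (T t y)].
Proof.
move=> H k x r Xx r_gt0.
have k1_gt0 : 0 < k.+1%:R :> R by rewrite ltr0n.
have [||t [u [/andP[t_ge0 tk] Xu MTu]]] := H (2 * k.+1%:R / r) k.+1%:R^-1.
- by rewrite divr_ge0 ?mulr_ge0// ltW.
- by rewrite invr_gt0.
have [M M_ge0 TM] := sg_bd TX t_ge0.
(* A bounded [T t] cannot be large at a vector of seminorm 0, so [u] can be rescaled to seminorm r /
   2. *)
have u_gt0 : 0 < N u.
  rewrite lt_neqAle ge0 andbT; apply/eqP => u0.
  by have := TM _ Xu; rewrite leNgt -u0 mulr0; move: MTu; rewrite -u0 mulr0 => ->.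
pose w := (r / 2 / N u) *: u.
have Xw : X w by exact: (sn_memZ NX).
have Nw : N w = r / 2.
  by rewrite /w (snZ NX)// ger0_norm ?divfK ?gt_eqF// !divr_ge0// ltW.
have NTw : k.+1%:R <= N (T t w).
  have -> : N (T t w) = r / 2 / N u * N (T t u).
    rewrite sg_Z_eq// (snZ NX); last exact: XT.
    by rewrite ger0_norm// !divr_ge0// ltW.
  rewrite -ler_pdivrMl; last by rewrite !divr_gt0.
  rewrite (le_trans _ (ltW MTu))// le_eqVlt; apply/orP; left; apply/eqP.
  by field; rewrite !gt_eqF.
(* Up to seminorm 0, T t (x + w) - T t (x - w) is 2 T t w, so [T t] reaches k + 1 at one of these
   two points. *)
have [x' [Xx' x'x NTx']] : exists x', [/\ X x', N (x' - x) <= r / 2 & k.+1%:R <= N (T t x')].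
  have : k.+1%:R + k.+1%:R <= N (T t (x + w)) + N (T t (x - w)).
    rewrite (le_trans (lerD NTw NTw))//.
    have -> : N (T t (x + w)) = N (T t x + T t w).
      apply: (sn_eq NX); [| |exact: sg_addE].
      - by apply: XT => //; exact: (sn_memD NX).
      - by apply: (sn_memD NX); exact: XT.
    rewrite sg_B_eq//.
    have Xx' := XT t_ge0 Xx; have Xw' := XT t_ge0 Xw.
    have -> : N (T t w) + N (T t w) = N ((T t x + T t w) - (T t x - T t w)).
      rewrite opprB [X in _ = N X]addrC addrA subrK -[T t w + T t w]mulr2n -scaler_nat (snZ NX)//.
      by rewrite normr_nat mulr_natl mulr2n.
    rewrite (le_trans (sn_triangle NX _ _))//; first exact: (sn_memD NX).
      by apply/(sn_memN NX)/(sn_memB NX).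
    by rewrite (snN NX)//; exact: (sn_memB NX).
  have [le1 _|/ltW le1] := leP k.+1%:R (N (T t (x + w))).
    exists (x + w); split => //; first exact: (sn_memD NX).
    by rewrite addrAC subrr add0r Nw.
  move=> le2; exists (x - w); split => //; first exact: (sn_memB NX).
    by rewrite addrAC subrr add0r (snN NX)// Nw.
  lra.
(* Within distance 1 / (M + 1) of the centre the values of [T t] differ from the one there by at
   most 1, so k + 1 at the centre leaves k on the ball. *)
exists t, x', (Num.min (r / 2) (M + 1)^-1); split => //.
- by rewrite ge_min lexx /= lt_min divr_gt0// invr_gt0; lra.
- by rewrite t_ge0.
move=> y Xy yx'.
have := sn_le NX (XT t_ge0 Xx') (XT t_ge0 Xy).
rewrite -sg_B_eq// => le1.
have le2 := TM _ (sn_memB NX Xx' Xy).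
have : M * N (x' - y) <= 1.
  rewrite (snBC NX)// (le_trans (ler_wpM2l M_ge0 yx'))//.
  rewrite (@le_trans _ _ (M * (M + 1)^-1))//.
    by rewrite ler_wpM2l// ge_min lexx orbT.
  by rewrite ler_pdivrMr; lra.
have -> : k%:R = k.+1%:R - 1 :> R by rewrite -natr1 addrK.
lra.
Qed.

Lemma sg_locally_bounded : exists2 d, 0 < d & exists2 M, 0 <= M &
  forall t u, 0 <= t <= d -> X u -> N (T t u) <= M * N u.
Proof.
apply: contrapT => H.
have {}H : forall M d : R, 0 <= M -> 0 < d -> exists t u,
     [/\ 0 <= t <= d, X u & M * N u < N (T t u)].
  move=> M d M_ge0 d_gt0; apply: contrapT => H'; apply: H; exists d => //; exists M => //.
  move=> t u td Xu; rewrite leNgt; apply/negP => lt1; apply: H'.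
  by exists t, u.
(* Triples of a time, a centre and a radius. *)
pose S := (R * V * R)%type.
pose P (k : nat) (p q : S) := X p.1.2 -> 0 < p.2 ->
   [/\ X q.1.2, 0 < q.2 <= p.2 / 2, N (q.1.2 - p.1.2) <= p.2 / 2,
      0 <= q.1.1 <= k.+1%:R^-1 &
      forall y, X y -> N (y - q.1.2) <= q.2 -> k%:R <= N (T q.1.1 y)].
have /choice[f fP] : forall kp : nat * S, exists q, P kp.1 kp.2 q.
  move=> [k p]; rewrite /P /=.
  have [Xp|] := pselect (X p.1.2); last by move=> nX; exists p.
  have [p_gt0|] := pselect (0 < p.2); last by move=> nX; exists p.
  have [t [x [r ?]]] := nested_ball H k Xp p_gt0.
  by exists (t, x, r).
pose s := fix s n : S := if n is m.+1 then f (m, s m) else (0, 0, 1).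
have sP k : X (s k).1.2 /\ 0 < (s k).2.
  elim: k => [|k [Xk k_gt0]]; first by split => //; exact: (sn_mem0 NX).
  by have [? /andP[]] := fP (k, s k) Xk k_gt0.
have sX k := (sP k).1; have s_gt0 k := (sP k).2.
have sS k := fP (k, s k) (sX k) (s_gt0 k).
have s_small k : (s k).2 <= 2 ^- k.
  elim: k => [|k ih]; first by rewrite expr0 invr1.
  have [_ /andP[_ le1] _ _ _] := sS k.
  rewrite (le_trans le1)//= ler_pdivrMr// (le_trans ih)//.
  by rewrite exprSr invfM divfK ?pnatr_eq0.
have nest k i : N ((s (k + i)%N).1.2 - (s k).1.2) + (s (k + i)%N).2 <= (s k).2.
  elim: i => [|i ih]; first by rewrite addn0 subrr (sn0 NX) add0r.
  have [_ /andP[_ le1] le2 _ _] := sS (k + i)%N.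
  rewrite addnS /=.
  have := sn_tri NX (sX (k + i).+1%N) (sX k) (sX (k + i)%N).
  rewrite /= in le1 le2 *; lra.
have nest' k i : N ((s (k + i)%N).1.2 - (s k).1.2) <= (s k).2.
  by have := nest k i; have := s_gt0 (k + i)%N; lra.
have [l Xl ul] : exists2 l, X l & forall e, 0 < e -> exists K, forall i,
      (K <= i)%N -> N ((s i).1.2 - l) <= e.
  apply: (sn_complete NX) => // e e_gt0.
  have [|K Ke] := @half_expn_small _ (e / 2); first by rewrite divr_gt0.
  exists K => i j Ki Kj.
  have := sn_tri NX (sX i) (sX j) (sX K).
  have := nest' K (i - K)%N; have := nest' K (j - K)%N; rewrite !subnKC//.
  rewrite [in X in _ <= _ + X -> _](snBC NX)//.
  have := s_small K; lra.
have lk k : N (l - (s k).1.2) <= (s k).2.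
  apply/ler_addgt0Pr => e e_gt0.
  have [K Ke] := ul _ e_gt0.
  have := sn_tri NX Xl (sX k) (sX (k + K)%N).
  have := nest' k K; have := Ke (k + K)%N (leq_addl _ _).
  rewrite (snBC NX)//; lra.
have [d d_gt0 dl] := sg_cont TX Xl ltr01.
have Tl t : 0 <= t < d -> N (T t l) <= 1 + N l.
  move=> /andP[]; rewrite le_eqVlt => /orP[/eqP <- _|t_gt0 td].
    rewrite (sn_eq NX (XT (lexx 0) Xl) Xl (sg_0 TX Xl)); lra.
  have t_ge0 := ltW t_gt0.
  have := dl t; rewrite t_gt0 td => /(_ isT).
  have := sn_le NX (XT t_ge0 Xl) Xl; lra.
(* From this index on the times are below [d], where [T t l] has seminorm at most 1 + N l, while the
   lower bound valid on the balls exceeds 1 + N l. *)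
pose k := Num.truncn (Num.max (1 + N l) d^-1).
have /truncn_itv /andP[_] : 0 <= Num.max (1 + N l) d^-1.
  by rewrite le_max invr_ge0 (ltW d_gt0) orbT.
rewrite -/k gt_max => /andP[k1 k2].
have [_ _ _ /andP[t_ge0 tk] HT] := sS k.+1.
have := HT l Xl (lk k.+2).
have /Tl : 0 <= (f (k.+1, s k.+1)).1.1 < d.
  rewrite t_ge0 /= (le_lt_trans tk)// invf_plt ?posrE// (lt_le_trans k2)//.
  by rewrite ler_nat.
rewrite /= in k1 *; lra.
Qed.

(** The interval is cut into blocks of the length [d] on which T is bounded, and each further block
    costs one factor [M1]. *)
Lemma sg_bounded b : 0 <= b -> exists2 M, 1 <= M &
  forall t u, 0 <= t <= b -> X u -> N (T t u) <= M * N u.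
Proof.
move=> b_ge0.
have [d d_gt0 [M M_ge0 TM]] := sg_locally_bounded.
have {TM} [M1 M1_ge1 TM] : exists2 M, 1 <= M &
  forall t u, 0 <= t <= d -> X u -> N (T t u) <= M * N u.
  exists (M + 1) => [|t u td Xu]; first lra.
  by rewrite (le_trans (TM _ _ td Xu))// ler_wpM2r//; lra.
have H n : exists2 M, 1 <= M &
  forall t u, 0 <= t <= d * n.+1%:R -> X u -> N (T t u) <= M * N u.
  elim: n => [|n [M2 M2_ge1 TM2]]; first by exists M1 => //; rewrite mulr1.
  exists (M1 * M2) => [|t u /andP[t_ge0 td] Xu].
    by rewrite (le_trans M1_ge1)// ler_peMr//; lra.
  have [td'|td'] := leP t d.
    rewrite (@le_trans _ _ (M1 * N u))//; first by apply: TM => //; rewrite t_ge0.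
    by rewrite ler_wpM2r// ler_peMr//; lra.
  have td_ge0 : 0 <= t - d by lra.
  rewrite -[t](subrKC d) sg_D_eq//; last exact: ltW.
  rewrite (le_trans (TM d _ _ _))//; first by rewrite lexx (ltW d_gt0).
    exact: XT.
  rewrite -mulrA ler_wpM2l//; first lra.
  apply: TM2 => //; rewrite td_ge0 /= lerBlDr (le_trans td)//.
  by rewrite -[in leLHS]natr1 mulrDr mulr1.
have [M2 M2_ge1 TM2] := H (Num.truncn (b / d)).
exists M2 => // t u /andP[t_ge0 tb] Xu; apply: TM2 => //; rewrite t_ge0/= (le_trans tb)//.
have /truncn_itv /andP[_ /ltW] : 0 <= b / d by rewrite divr_ge0// ltW.
by rewrite ler_pdivrMr// mulrC.
Qed.

End semigroup_theory.

(** [g] is in the domain of the generator with value [g'], up to seminorm 0: the right derivative of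
    the orbit at 0, with the division by h cleared. *)
Definition generates (R : realType) (V : lmodType R) (N : V -> R)
    (T : R -> V -> V) (g g' : V) :=
  forall e, 0 < e -> exists2 d, 0 < d &
    forall h, 0 < h < d -> N (T h g - g - h *: g') <= e * h.

Section generator.
Context (R : realType) (V : lmodType R) (X : set V) (N : V -> R).
Context (T : R -> V -> V).
Hypotheses (NX : seminorm X N) (TX : semigroup X N T).
Implicit Types (u v w f g : V) (c t h : R).

Let XT t u : 0 <= t -> X u -> X (T t u). Proof. exact: (sg_mem TX). Qed.
Let ge0 u : 0 <= N u. Proof. exact: (sn_ge0 NX). Qed.

Local Ltac inX := repeat first [assumption | apply: (sn_memB NX) |
  apply: (sn_memD NX) | apply: (sn_memZ NX) | apply: XT].

(** The remainder at time t is [T t] applied to the remainder at time 0, so a bound of T on [0, b]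
    makes the expansion uniform in t. *)
Lemma sg_expand b g g' e : 0 <= b -> X g -> X g' -> generates N T g g' -> 0 < e ->
  exists2 d, 0 < d & forall t h, 0 <= t <= b -> 0 < h < d ->
    N (T (t + h) g - (T t g + h *: T t g')) <= e * h.
Proof.
move=> b_ge0 Xg Xg' gg' e_gt0.
have [M M_ge1 TM] := sg_bounded NX TX b_ge0.
have M_gt0 : 0 < M by lra.
have [d d_gt0 gd] := gg' _ (divr_gt0 e_gt0 M_gt0).
exists d => // t h tb hd; have /andP[t_ge0 _] := tb; have /andP[h_gt0 _] := hd.
have h_ge0 := ltW h_gt0.
have XTh := XT h_ge0 Xg.
pose w := T h g - g - h *: g'.
have Xw : X w by inX.
have XTt u : X u -> X (T t u) by exact: XT.
have le1 : N (T t w) <= e * h.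
  rewrite (le_trans (TM _ _ tb Xw))//.
  rewrite (le_trans (ler_wpM2l (ltW M_gt0) (gd _ hd)))//.
  by rewrite mulrA mulrCA mulfV ?mulr1 ?gt_eqF.
have e1 := sg_D TX t_ge0 h_ge0 Xg.
have Xhg : X (h *: g' + g) by inX.
have e2 := sg_addE TX t_ge0 Xw Xhg.
have e3 := sg_lin TX h t_ge0 Xg' Xg.
have wE : w + (h *: g' + g) = T h g by rewrite /w addrA !subrK.
rewrite wE in e2.
have := sn_tri4 NX (a := T (t + h) g) (b := T t (T h g)) (c := T t w + T t (h *: g' + g))
  (d := T t g + h *: T t g').
rewrite e1 e2 !add0r => /(_ _ _ _ _)/le_trans; apply; inX => //.
  exact: addr_ge0.
rewrite [T t g + _]addrC -addrA (le_trans (sn_triangle NX _ _))//; inX.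
by rewrite e3 addr0.
Qed.

Lemma sg_sum m t (F : nat -> V) : 0 <= t -> (forall i, X (F i)) ->
  N (T t (\sum_(i < m) F i) - \sum_(i < m) T t (F i)) = 0.
Proof.
move=> t_ge0 XF; elim: m => [|m ih].
  by rewrite !big_ord0 subr0 (sg_T0 NX TX).
have XS : X (\sum_(i < m) F i) by exact: (sn_memS NX).
have XTS : X (\sum_(i < m) T t (F i)) by apply: (sn_memS NX) => i; exact: XT.
apply/eqP; rewrite eq_le ge0 andbT !big_ord_recr /=.
have XFm := XF m; have XTFm := XT t_ge0 XFm; have XTS' := XT t_ge0 XS.
have := sn_tri NX (u := T t (\sum_(i < m) F i + F m))
  (v := \sum_(i < m) T t (F i) + T t (F m)) (w := T t (\sum_(i < m) F i) + T t (F m)).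
rewrite (sg_addE TX t_ge0 XS XFm) add0r => /(_ _ _ _)/le_trans; apply; inX.
by rewrite opprD addrACA subrr addr0 ih.
Qed.

(** By the semigroup law the increment is T t (T (t' - t) f - f), and T is bounded on [0, b]. *)
Lemma sg_unif b f e : 0 <= b -> X f -> 0 < e -> exists2 d, 0 < d &
  forall t t', 0 <= t <= t' -> t' <= b -> t' - t < d -> N (T t' f - T t f) <= e.
Proof.
move=> b_ge0 Xf e_gt0.
have [M M_ge1 TM] := sg_bounded NX TX b_ge0.
have M_gt0 : 0 < M by lra.
have [d d_gt0 fd] := sg_cont TX Xf (divr_gt0 e_gt0 M_gt0).
exists d => // t t' /andP[t_ge0]; rewrite le_eqVlt => /orP[/eqP <- _ _|tt' t'b t'd].
  by rewrite subrr (sn0 NX) ltW.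
have h_gt0 : 0 < t' - t by lra.
have h_ge0 := ltW h_gt0.
have := sg_D TX t_ge0 h_ge0 Xf; rewrite subrKC => H.
have XTt : X (T t f) by exact: XT.
have XTt' : X (T t' f) by apply: XT => //; lra.
have XTh : X (T (t' - t) f) by exact: XT.
have XTth : X (T t (T (t' - t) f)) by exact: XT.
have := sn_tri NX XTt' XTt XTth; rewrite H add0r => /le_trans; apply.
rewrite -(sg_B_eq NX TX)//.
have tb : 0 <= t <= b by rewrite t_ge0; lra.
rewrite (le_trans (TM t _ tb (sn_memB NX XTh Xf)))//.
rewrite mulrC -ler_pdivlMr//; apply: fd; lra.
Qed.

Lemma sn_avg m (F G : nat -> V) e : (forall i, X (F i)) -> (forall i, X (G i)) ->
  (0 < m)%N -> (forall i, (i < m)%N -> N (F i - G i) <= e) ->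
  N (m%:R^-1 *: \sum_(i < m) F i - m%:R^-1 *: \sum_(i < m) G i) <= e.
Proof.
move=> XF XG m_gt0 FG; rewrite -scalerBr -sumrB (snZ NX); last first.
  by apply: (sn_memS NX) => i; exact: (sn_memB NX).
rewrite ger0_norm ?invr_ge0// ler_pdivrMl ?ltr0n// (le_trans (sn_sum NX _ _))//.
  by move=> i; exact: (sn_memB NX).
rewrite (@le_trans _ _ (\sum_(i < m) e))//; first by apply: ler_sum => i _; exact: FG.
by rewrite sumr_const card_ord mulr_natl.
Qed.

End generator.

(** * Riemann sums of an orbit and the domain of the generator *)

Lemma sum_quotient (V : nmodType) (G : nat -> V) m n : (0 < n)%N ->
  \sum_(i < m * n) G (i %/ n)%N = (\sum_(i < m) G i) *+ n.
Proof.
move=> n_gt0; elim: m => [|m ih]; first by rewrite mul0n !big_ord0 mul0rn.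
rewrite mulSn addnC big_split_ord /= ih big_ord_recr /= mulrnDl; congr (_ + _).
rewrite -[in RHS](card_ord n) -sumr_const; apply: eq_bigr => i _.
by rewrite divnMDl// divn_small// addn0.
Qed.

(** After cancellation of common terms, the windows [j, j + m) and [0, m) differ exactly as the
    windows [m, m + j) and [0, j) do. *)
Lemma sum_shift (V : zmodType) (F : nat -> V) m j :
  \sum_(i < m) F (j + i)%N - \sum_(i < m) F i = \sum_(i < j) (F (m + i)%N - F i).
Proof.
elim: j => [|j ih]; first by rewrite big_ord0 subrr.
rewrite big_ord_recr /= -ih.
have H : \sum_(i < m) F (j.+1 + i)%N + F j = \sum_(i < m) F (j + i)%N + F (m + j)%N.
  transitivity (\sum_(i < m.+1) F (j + i)%N).
    by rewrite big_ord_recl /= addn0 addrC; congr (_ + _); apply: eq_bigr => i _; rewrite addSnnS.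
  by rewrite big_ord_recr /= addnC.
by apply: (addIr (F j)); rewrite addrAC H -[RHS]addrA subrK addrAC.
Qed.

Section average.
Context (R : realType) (V : lmodType R) (X : set V) (N : V -> R).
Context (T : R -> V -> V).
Hypotheses (NX : seminorm X N) (TX : semigroup X N T).
Context (f : V) (b : R).
Hypotheses (Xf : X f) (b_gt0 : 0 < b).
Implicit Types (u v w g : V) (c t h : R).

Let XT t u : 0 <= t -> X u -> X (T t u). Proof. exact: (sg_mem TX). Qed.
Let ge0 u : 0 <= N u. Proof. exact: (sn_ge0 NX). Qed.
Let b_ge0 : 0 <= b. Proof. exact: ltW. Qed.

Let node (m i : nat) : R := b * (i%:R / m%:R).
Let F (m i : nat) : V := T (node m i) f.
(** Left Riemann sum, with m equal pieces, of the mean of T t f over [0, b]. *)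
Definition orbit_avg (m : nat) : V := m%:R^-1 *: \sum_(i < m) F m i.
Local Notation A := orbit_avg.

Let node_ge0 m i : 0 <= node m i.
Proof. by rewrite /node mulr_ge0// divr_ge0. Qed.

Let node_le m i : (i <= m)%N -> node m i <= b.
Proof.
case: m => [|m] im; first by rewrite /node invr0 !mulr0.
by rewrite /node ger_pMr// ler_pdivrMr ?ltr0n// mul1r ler_nat.
Qed.

Let XF m i : X (F m i). Proof. exact: XT. Qed.

Let XA m : X (A m).
Proof. by apply: (sn_memZ NX); apply: (sn_memS NX). Qed.

(** The fine node i comes after the coarse node i / n by at most b / m. Two Riemann sums are later
    compared through their common refinement. The horizon 2 b leaves room for the shifts by h <= b
    below. *)
Let avg_refine m n (e d : R) : (0 < m)%N -> (0 < n)%N ->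
  (forall t t', 0 <= t <= t' -> t' <= 2 * b -> t' - t < d -> N (T t' f - T t f) <= e) ->
  b / m%:R < d -> N (A m - A (m * n)%N) <= e.
Proof.
have b0 : 0 < b := b_gt0.
move=> m_gt0 n_gt0 Hd md.
have mR : 0 < m%:R :> R by rewrite ltr0n.
have nR : 0 < n%:R :> R by rewrite ltr0n.
have -> : A m = (m * n)%:R^-1 *: \sum_(i < m * n) F m (i %/ n)%N.
  rewrite (sum_quotient (F m))// -(scaler_nat n (\sum_(i < m) F m i)) scalerA natrM invfM -mulrA mulVf ?mulr1//.
  by rewrite gt_eqF.
apply: (sn_avg NX (F := fun i => F m (i %/ n)%N) (G := F (m * n)%N)) => // [|i imn]; first by rewrite muln_gt0 m_gt0.
rewrite (snBC NX)//.
have E : node (m * n) i - node m (i %/ n) = b / m%:R * ((i %% n)%:R / n%:R).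
  rewrite /node {1}(divn_eq i n) natrD !natrM.
  by field; rewrite !gt_eqF.
have E0 : 0 <= (i %% n)%:R / n%:R :> R by rewrite divr_ge0.
have E1 : (i %% n)%:R / n%:R <= 1 :> R.
  by rewrite ler_pdivrMr// mul1r ler_nat ltnW// ltn_mod.
have bm : 0 < b / m%:R by rewrite divr_gt0.
apply: (Hd (node m (i %/ n)%N) (node (m * n)%N i)).
- rewrite node_ge0 /= -subr_ge0 E mulr_ge0//; exact: ltW.
- by rewrite (le_trans (node_le (ltnW imn)))// ler_peMl//; lra.
- by rewrite E (le_lt_trans _ md)// ger_pMr.
Qed.

Let natr_large (d : R) : 0 < d -> exists K : nat, forall m : nat, (K < m)%N -> b / m%:R < d.
Proof.
have b0 : 0 < b := b_gt0.
move=> d_gt0; exists (Num.truncn (b / d)) => m.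
have bd : 0 <= b / d by rewrite divr_ge0// ltW.
case: m => // m Km.
rewrite ltr_pdivrMr ?ltr0n// mulrC -ltr_pdivrMr//.
have /truncn_itv /andP[_ lt1] := bd.
by rewrite (lt_le_trans lt1)// ler_nat.
Qed.

Lemma orbit_avg_cvg : exists2 g, X g & forall e, 0 < e -> exists K, forall i,
      (K <= i)%N -> N (A i.+1 - g) <= e.
Proof.
have b0 : 0 < b := b_gt0.
apply: (sn_complete NX) => // e e_gt0.
have [||d d_gt0 fd] := sg_unif NX TX (b := 2 * b) (e := e / 2) _ Xf; [lra|lra|].
have [K Kd] := natr_large d_gt0.
exists K => i j Ki Kj.
have := avg_refine (ltn0Sn i) (ltn0Sn j) fd (Kd i.+1 Ki).
have := avg_refine (ltn0Sn j) (ltn0Sn i) fd (Kd j.+1 Kj).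
rewrite mulnC (snBC NX)//.
have := sn_tri NX (XA i.+1) (XA j.+1) (XA (i.+1 * j.+1)%N); lra.
Qed.

Lemma orbit_avg_close m (e : R) : (0 < m)%N ->
  (forall t, 0 <= t <= b -> N (T t f - f) <= e) -> N (A m - f) <= e.
Proof.
have b0 : 0 < b := b_gt0.
move=> m_gt0 fe.
have -> : f = m%:R^-1 *: \sum_(i < m) f.
  by rewrite sumr_const card_ord -(scaler_nat m f) scalerA mulVf ?scale1r// pnatr_eq0 -lt0n.
apply: (sn_avg NX) => // i im; apply: fe.
by rewrite node_ge0 node_le// ltnW.
Qed.

(** [T h] moves the i-th node to h + node i, and [h] is approximated from below by the j-th node, so
    the outcome is the sum shifted by j indices. *)
Let avg_shift m j h (e d : R) : (0 < m)%N -> 0 <= h <= b -> (j <= m)%N ->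
  (forall t t', 0 <= t <= t' -> t' <= 2 * b -> t' - t < d -> N (T t' f - T t f) <= e) ->
  0 <= h - node m j < d ->
  N (T h (A m) - m%:R^-1 *: \sum_(i < m) F m (j + i)%N) <= e.
Proof.
have b0 : 0 < b := b_gt0.
move=> m_gt0 /andP[h_ge0 hb] jm Hd /andP[hj hd].
have X1 : X (\sum_(i < m) F m i) by exact: (sn_memS NX).
have X2 : X (\sum_(i < m) T h (F m i)) by apply: (sn_memS NX) => i; exact: XT.
have X3 : X (\sum_(i < m) F m (j + i)%N) by exact: (sn_memS NX).
have XTX1 : X (T h (\sum_(i < m) F m i)) by exact: XT.
have := sn_tri4 NX (a := T h (A m)) (b := m%:R^-1 *: T h (\sum_(i < m) F m i))
  (c := m%:R^-1 *: \sum_(i < m) T h (F m i)) (d := m%:R^-1 *: \sum_(i < m) F m (j + i)%N).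
rewrite (sg_Z NX TX)// add0r -scalerBr (snZ NX); last exact: (sn_memB NX).
rewrite (sg_sum NX TX)// mulr0 add0r => /(_ _ _ _ _)/le_trans; apply; rewrite ?scalerBr; try exact: (sn_memZ NX).
- exact: XT.
- apply: (sn_avg NX (F := fun i => T h (F m i)) (G := fun i => F m (j + i)%N)) => // [i|i im]; first exact: XT.
  have XThF : X (T h (F m i)) by exact: XT.
  have hn : 0 <= h + node m i by rewrite addr_ge0.
  have := sn_tri NX (u := T h (F m i)) (v := F m (j + i)%N) (w := T (h + node m i) f).
  rewrite (snBC NX XThF (v := T (h + node m i) f)); last exact: XT.
  rewrite (sg_D TX)// add0r => /(_ _ _ _)/le_trans; apply => //; first exact: XT.
  have E : node m (j + i) = node m j + node m i by rewrite /node natrD mulrDl mulrDr.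
  have := node_le (ltnW im).
  rewrite /F => nb; apply: Hd; rewrite ?node_ge0 /= ?E; lra.
Qed.

(** By [sum_shift] only j differences F (m + i) - F i remain. Node m + i is b later than node i, so
    each of them is T (node i) p up to seminorm 0, hence close to [p]. *)
Let avg_increment m j p (e : R) : (0 < m)%N -> p = T b f - f -> 0 <= e ->
  (forall i, (i < j)%N -> N (T (node m i) p - p) <= e) ->
  N (m%:R^-1 *: \sum_(i < m) F m (j + i)%N - A m - (j%:R / m%:R) *: p) <= j%:R / m%:R * e.
Proof.
have b0 : 0 < b := b_gt0.
move=> m_gt0 pE e_ge0 pe.
have Xp : X p by rewrite pE; apply: (sn_memB NX) => //; exact: XT.
have mR : 0 < m%:R :> R by rewrite ltr0n.
have jp : j%:R *: p = \sum_(i < j) p by rewrite sumr_const card_ord scaler_nat.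
rewrite /A -scalerBr sum_shift mulrC -scalerA -scalerBr jp -sumrB.
have XX i : X (F m (m + i) - F m i - p) by do 2 apply: (sn_memB NX) => //.
rewrite (snZ NX); last exact: (sn_memS NX).
rewrite ger0_norm ?invr_ge0// -mulrA ler_wpM2l ?invr_ge0//.
have -> : j%:R * e = \sum_(i < j) e by rewrite sumr_const card_ord mulr_natl.
rewrite (le_trans (sn_sum NX _ (fun i : 'I_j => XX i)))//.
apply: ler_sum => i _.
have XTp : X (T (node m i) p) by exact: XT.
have XTb : X (T b f) by exact: XT.
have := sn_tri NX (u := F m (m + i) - F m i) (v := p) (w := T (node m i) p).
have -> : N (F m (m + i) - F m i - T (node m i) p) = 0.
  apply/eqP; rewrite eq_le ge0 andbT.
  have XTTb : X (T (node m i) (T b f)) by exact: XT.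
  have := sn_tri NX (u := F m (m + i) - F m i) (v := T (node m i) p)
    (w := T (node m i) (T b f) - F m i).
  have E : node m (m + i) = node m i + b.
    by rewrite /node natrD mulrDl mulfV ?gt_eqF// mulrDr mulr1 addrC.
  have -> : N (F m (m + i) - F m i - (T (node m i) (T b f) - F m i)) = 0.
    by rewrite opprB addrA subrK /F E (sg_D TX).
  have -> : N (T (node m i) (T b f) - F m i - T (node m i) p) = 0.
    rewrite (snBC NX)//; last exact: (sn_memB NX).
    by rewrite pE (sg_B TX).
  by rewrite addr0; apply => //; exact: (sn_memB NX).
rewrite add0r => /(_ _ _ _)/le_trans; apply => //; [exact: (sn_memB NX)|exact: pe].
Qed.

(** Discrete form of (T h - 1) int_0^b T t f dt = int_0^h T t (T b f - f) dt, whose leading term is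
    h (T b f - f). *)
Lemma orbit_avg_generates g : X g ->
  (forall e, 0 < e -> exists K, forall i, (K <= i)%N -> N (A i.+1 - g) <= e) ->
  generates N T g (b^-1 *: (T b f - f)).
Proof.
have b0 : 0 < b := b_gt0.
move=> Xg Ag e e_gt0; set p := T b f - f.
have Xp : X p by apply: (sn_memB NX) => //; exact: XT.
have [d1 d1_gt0 pd1] := sg_cont TX Xp (mulr_gt0 e_gt0 b_gt0).
exists (Num.min d1 b); first by rewrite lt_min d1_gt0.
move=> h; rewrite lt_min => /andP[h_gt0 /andP[hd1 hb]].
have h_ge0 := ltW h_gt0.
have [M M_ge1 TM] := sg_bounded NX TX b_ge0.
apply/ler_addgt0Pr => eta eta_gt0.
have Np := ge0 p.
(* For fixed h the mesh is refined until the discretization errors sum to [eta]: M e1 and e1 for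
   replacing g by [A m] inside and outside [T h], e1 for the shift, e1 N p / b for rounding h to a
   node. Only e h is left. *)
pose e1 := eta / (M + 2 + N p / b).
have D_gt0 : 0 < M + 2 + N p / b.
  by have : 0 <= N p / b by [exact: divr_ge0]; lra.
have e1_gt0 : 0 < e1 by rewrite divr_gt0.
have [||d d_gt0 fd] := sg_unif NX TX (b := 2 * b) (e := e1) _ Xf; [lra|lra|].
have [K1 AK1] := Ag _ e1_gt0.
have [K2 K2d] := natr_large d_gt0.
have [K3 K3d] := natr_large e1_gt0.
pose m := (maxn K1 (maxn K2 K3)).+1.
have m_gt0 : (0 < m)%N by [].
have mR : 0 < m%:R :> R by rewrite ltr0n.
have Am : N (A m - g) <= e1 by apply: AK1; rewrite leq_maxl.
have md : b / m%:R < d by apply: K2d; rewrite ltnS !leq_max leqnn orbT.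
have me1 : b / m%:R < e1 by apply: K3d; rewrite ltnS !leq_max leqnn !orbT.
pose j := Num.truncn (h * m%:R / b).
have /truncn_itv : 0 <= h * m%:R / b by rewrite divr_ge0// mulr_ge0// ltW.
rewrite -/j => /andP[jh hj].
have jh' : node m j <= h.
  by rewrite /node mulrC -ler_pdivlMr// ler_pdivrMr// mulrAC.
have hj' : h - node m j < b / m%:R.
  have E : b / m%:R + node m j = j.+1%:R * b / m%:R.
    by rewrite /node -natr1; field; rewrite gt_eqF.
  by rewrite ltrBlDr E ltr_pdivlMr// -ltr_pdivrMr.
have jm : (j <= m)%N.
  rewrite -(ler_nat R) (le_trans jh)// ler_pdivrMr// mulrC ler_pM2l//; exact: ltW.
have h0b : 0 <= h <= b by lra.
have jd : 0 <= h - node m j < d by lra.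
have le1 := avg_shift m_gt0 h0b jm fd jd.
have le2 : N (m%:R^-1 *: \sum_(i < m) F m (j + i)%N - A m - (j%:R / m%:R) *: p) <= e * h.
  apply: (le_trans (avg_increment (e := e * b) m_gt0 erefl _ _)).
  - exact/ltW/mulr_gt0.
  - move=> i ij.
    have := node_ge0 m i; rewrite le_eqVlt => /orP[/eqP <-|n_gt0].
      by rewrite (sg_0 TX)//; exact/ltW/mulr_gt0.
    apply: pd1; rewrite n_gt0 /= (le_lt_trans _ hd1)// (le_trans _ jh')//.
    by rewrite /node ler_pM2l// ler_pM2r ?invr_gt0// ler_nat ltnW.
  - rewrite mulrCA ler_pM2l//; rewrite /node in jh'; lra.
set B := m%:R^-1 *: \sum_(i < m) F m (j + i)%N in le1 le2.
have XB : X B by apply: (sn_memZ NX); exact: (sn_memS NX).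
have XThA : X (T h (A m)) by exact: XT.
have XThg : X (T h g) by exact: XT.
have le3 : N (T h g - T h (A m)) <= M * e1.
  rewrite -(sg_B_eq NX TX)// (le_trans (TM _ _ h0b _))//; first exact: (sn_memB NX).
  by rewrite (snBC NX)// ler_wpM2l//; lra.
have le4 : N ((j%:R / m%:R) *: p - h *: (b^-1 *: p)) <= e1 * (N p / b).
  rewrite scalerA -scalerBl (snZ NX)// distrC ger0_norm; last first.
    by rewrite subr_ge0 ler_pdivlMr//; rewrite /node in jh'; lra.
  have -> : e1 * (N p / b) = e1 / b * N p by rewrite mulrA mulrAC.
  rewrite ler_wpM2r//.
  rewrite ler_pdivlMr// mulrBl divfK ?gt_eqF//.
  by apply/ltW/(lt_trans _ me1); rewrite /node in hj'; lra.
have X1 : X ((j%:R / m%:R) *: p) by exact: (sn_memZ NX).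
have X2 : X (h *: (b^-1 *: p)) by do 2 apply: (sn_memZ NX).
have E : T h g - g - h *: (b^-1 *: p) =
  (T h g - T h (A m)) + (T h (A m) - B) + (B - A m - (j%:R / m%:R) *: p)
   + ((j%:R / m%:R) *: p - h *: (b^-1 *: p)) + (A m - g).
  rewrite subrKA; set q := h *: _; set r := _ *: p.
  have -> : T h g - B + (B - A m - r) = T h g - A m - r.
    by rewrite -[B - A m - r]addrA [LHS]addrA subrK addrA.
  by rewrite (subrKA r) [RHS]addrAC (subrKA (A m)).
have XAm := XA m.
have XAg : X (A m - g) by exact: (sn_memB NX).
have X3 : X (T h g - T h (A m)) by exact: (sn_memB NX).
have X4 : X (T h (A m) - B) by exact: (sn_memB NX).
have X5 : X (B - A m - (j%:R / m%:R) *: p) by do 2 apply: (sn_memB NX) => //.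
have X6 : X ((j%:R / m%:R) *: p - h *: (b^-1 *: p)) by exact: (sn_memB NX).
have XX := sn_memD NX.
rewrite E.
have l1 := sn_triangle NX (XX _ _ (XX _ _ (XX _ _ X3 X4) X5) X6) XAg.
have l2 := sn_triangle NX (XX _ _ (XX _ _ X3 X4) X5) X6.
have l3 := sn_triangle NX (XX _ _ X3 X4) X5.
have l4 := sn_triangle NX X3 X4.
have l5 : M * e1 + e1 + e1 * (N p / b) + e1 = eta.
  have <- : e1 * (M + 2 + N p / b) = eta by rewrite divfK// gt_eqF.
  by ring.
lra.
Qed.

End average.

Section domain.
Context (R : realType) (V : lmodType R) (X : set V) (N : V -> R).
Context (T : R -> V -> V).
Hypotheses (NX : seminorm X N) (TX : semigroup X N T).

Lemma generator_dense (K : set V) f e : X f -> 0 < e ->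
  K 0 -> (forall u v, K u -> K v -> K (u + v)) ->
  (forall c u, 0 <= c -> K u -> K (c *: u)) ->
  (forall u l, (forall i : nat, X (u i) /\ K (u i)) -> X l ->
     (forall e, 0 < e -> exists k, forall i, (k <= i)%N -> N (u i - l) <= e) -> K l) ->
  (forall t, 0 <= t -> K (T t f)) ->
  exists g g', [/\ X g, X g', K g, generates N T g g' & N (g - f) <= e].
Proof.
move=> Xf e_gt0 K0 KD KZ Kcl KT.
have [d d_gt0 fd] := sg_cont TX Xf (divr_gt0 e_gt0 (ltr0Sn _ 1)).
pose b := d / 2; have b_gt0 : 0 < b by rewrite /b; lra.
have [g Xg Ag] := orbit_avg_cvg NX TX Xf b_gt0.
have XT t : 0 <= t -> X (T t f) by move=> ?; exact: (sg_mem TX).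
have XA m : X (orbit_avg T f b m).
  apply: (sn_memZ NX); apply: (sn_memS NX) => i; apply: XT.
  by rewrite !mulr_ge0// ?invr_ge0//; lra.
exists g, (b^-1 *: (T b f - f)); split => //.
- by apply: (sn_memZ NX); apply: (sn_memB NX) => //; apply: XT; lra.
- apply: Kcl Xg Ag => i; split; first exact: XA.
  apply: KZ; first by rewrite invr_ge0.
  elim/big_ind: _ => // j _; apply: KT.
  by rewrite !mulr_ge0// ?invr_ge0//; lra.
- exact: (orbit_avg_generates NX TX).
have [k /(_ k (leqnn _)) gk] := Ag _ (divr_gt0 e_gt0 (ltr0Sn _ 1)).
have := sn_tri NX Xg Xf (XA k.+1).
rewrite (snBC NX Xg (XA k.+1)).
have : N (orbit_avg T f b k.+1 - f) <= e / 2.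
  apply: (orbit_avg_close NX TX) => // t /andP[t_ge0 tb].
  move: t_ge0; rewrite le_eqVlt => /orP[/eqP <-|t_gt0].
    by rewrite (sg_0 TX)//; lra.
  by apply: fd; rewrite t_gt0 (le_lt_trans tb)// /b; lra.
lra.
Qed.

Lemma generates_orbit g g' t : X g -> X g' -> 0 <= t ->
  generates N T g g' -> generates N T (T t g) (T t g').
Proof.
move=> Xg Xg' t_ge0 gg' e e_gt0.
have [d d_gt0 H] := sg_expand NX TX t_ge0 Xg Xg' gg' e_gt0.
exists d => // h hd; have /andP[h_gt0 _] := hd.
have XT s u : 0 <= s -> X u -> X (T s u) by exact: (sg_mem TX).
have := H t h; rewrite lexx t_ge0 hd => /(_ isT isT); apply: le_trans.
have h_ge0 := ltW h_gt0.
have X1 : X (T h (T t g)) by apply: (XT) => //; exact: XT.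
have X2 : X (T t g + h *: T t g').
  by apply: (sn_memD NX); [|apply: (sn_memZ NX)]; exact: XT.
have X3 : X (T (t + h) g) by apply: XT => //; exact: addr_ge0.
rewrite -addrA -opprD (le_trans (sn_tri NX X1 X2 X3))//.
rewrite (snBC NX X1 X3) {1}[t + h]addrC (sg_D TX)// add0r //.
Qed.

End domain.

(* [J] plays the role of the squared norm of the positive part and [B v] of
   half its gradient at [v]: [J] decreases along curves whose velocity [a]
   satisfies [B v a <= 0].  Only uniform one-sided expansions are used, so no
   continuity of the curve from the left is required. *)
Lemma descent (R : realType) (V : lmodType R) (X : set V) (N : V -> R)
    (J : V -> R) (B : V -> V -> R) (v a : R -> V) (b K : R) :
  seminorm X N -> 0 <= b ->
  (forall u w z (h : R), X u -> X w -> X z -> 0 <= h ->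
     J (u + (h *: w + z)) <=
       J u + 2 * (h * B u w + N u * N z) + N (h *: w + z) ^+ 2) ->
  (forall t, 0 <= t <= b -> [/\ X (v t), X (a t), N (v t) <= K & N (a t) <= K]) ->
  (forall t, 0 <= t <= b -> B (v t) (a t) <= 0) ->
  (forall e, 0 < e -> exists2 d, 0 < d & forall t h, 0 <= t -> 0 < h < d ->
     t + h <= b -> N (v (t + h) - (v t + h *: a t)) <= e * h) ->
  J (v b) <= J (v 0).
Proof.
move=> NX b_ge0 JB va Bva vexp.
move: (b_ge0); rewrite le_eqVlt => /orP[/eqP <- //|b_gt0].
have K_ge0 : 0 <= K.
  have [_ _ Nv _] := va 0 (introT andP (conj (lexx 0) b_ge0)).
  exact: le_trans (sn_ge0 NX _) Nv.
apply/ler_addgt0Pr => eta eta_gt0.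
(* Over all steps the errors add up to 2 K e b + b (K + e)^2 h. This [e] makes the first term at
   most eta / 2, and a step h < eta / c does the same for the second. *)
pose e := eta / (4 * (K + 1) * b).
have D_gt0 : 0 < 4 * (K + 1) * b by rewrite mulr_gt0//; lra.
have e_gt0 : 0 < e by rewrite divr_gt0.
have [d d_gt0 Hd] := vexp _ e_gt0.
pose c := 2 * b * (K + e) ^+ 2.
have c_gt0 : 0 < c by rewrite !mulr_gt0 ?exprn_gt0//; lra.
pose m := (Num.truncn (b / Num.min d (eta / c))).+1.
have dc_gt0 : 0 < Num.min d (eta / c) by rewrite lt_min d_gt0 divr_gt0.
have mR : 0 < m%:R :> R by rewrite ltr0n.
pose h := b / m%:R.
have h_gt0 : 0 < h by rewrite divr_gt0.
have : h < Num.min d (eta / c).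
  rewrite ltr_pdivrMr// mulrC -ltr_pdivrMr//.
  have : 0 <= b / Num.min d (eta / c) by rewrite divr_ge0// ltW.
  by move=> /truncn_itv /andP[].
rewrite lt_min => /andP[hd hc].
have step i : (i < m)%N ->
  J (v (i.+1%:R * h)) <= J (v (i%:R * h)) + (2 * (K * (e * h)) + (h * K + e * h) ^+ 2).
  move=> im.
  have ih_ge0 : 0 <= i%:R * h by rewrite mulr_ge0// ltW.
  have E : i%:R * h + h = i.+1%:R * h by rewrite -natr1 mulrDl mul1r.
  have mh : m%:R * h = b by rewrite /h mulrC divfK// gt_eqF.
  have ihb : i%:R * h + h <= b by rewrite E -mh ler_wpM2r ?ler_nat// ltW.
  have tb : 0 <= i%:R * h <= b by lra.
  have hdd : 0 < h < d by rewrite h_gt0.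
  have := Hd _ _ ih_ge0 hdd ihb.
  have := Bva _ tb.
  have [Xv Xa Nv Na] := va _ tb.
  have [Xv' _ _ _] : [/\ X (v (i%:R * h + h)), X (a (i%:R * h + h)),
     N (v (i%:R * h + h)) <= K & N (a (i%:R * h + h)) <= K] by apply: va; lra.
  rewrite -E; set t := i%:R * h in tb Xv Xa Nv Na Xv' *.
  set z := v (t + h) - (v t + h *: a t) => B0 Nz.
  have Xz : X z by apply: (sn_memB NX) => //; apply: (sn_memD NX) => //; exact: (sn_memZ NX).
  have -> : v (t + h) = v t + (h *: a t + z) by rewrite addrA addrC subrK.
  rewrite (le_trans (JB _ _ _ _ Xv Xa Xz (ltW h_gt0)))//.
  have Nh : N (h *: a t + z) <= h * K + e * h.
    rewrite (le_trans (sn_triangle NX (sn_memZ NX _ Xa) Xz))// lerD//.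
    by rewrite (snZ NX)// gtr0_norm// ler_wpM2l// ltW.
  rewrite -addrA lerD2l lerD//.
    rewrite ler_wpM2l// -[leRHS]add0r lerD//; first by rewrite pmulr_rle0.
    by rewrite ler_pM// ?(sn_ge0 NX).
  by rewrite lerXn2r// nnegrE ?(sn_ge0 NX)// addr_ge0// mulr_ge0// ltW.
have tele i : (i <= m)%N ->
  J (v (i%:R * h)) <= J (v 0) + i%:R * (2 * (K * (e * h)) + (h * K + e * h) ^+ 2).
  elim: i => [|i ih] im; first by rewrite !mul0r addr0.
  rewrite (le_trans (step _ im))//.
  have := ih (ltnW im); move: (2 * _ + _) => c'; rewrite -[i.+1%:R]natr1; lra.
have := tele m (leqnn _).
have mh : m%:R * h = b by rewrite /h mulrC divfK// gt_eqF.
rewrite mh => /le_trans; apply; rewrite lerD2l.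
have -> : m%:R * (2 * (K * (e * h)) + (h * K + e * h) ^+ 2) =
   2 * K * e * (m%:R * h) + (m%:R * h) * (K + e) ^+ 2 * h by ring.
rewrite mh.
have : b * (K + e) ^+ 2 * h <= eta / 2.
  move: hc; rewrite ltr_pdivlMr// /c => /ltW; lra.
have : 2 * K * e * b <= eta / 2.
  have : e * (4 * (K + 1) * b) = eta by rewrite divfK// gt_eqF.
  have : 0 < e * b by exact: mulr_gt0.
  lra.
lra.
Qed.

(** * Square-integrable functions *)

(** Cauchy-Schwarz in discriminant form: the quadratic is evaluated at its minimizer c / a. *)
Lemma le_sqrt_discriminant (R : realType) (a b c : R) : 0 <= a -> 0 <= b ->
  (forall t, 0 <= t ^+ 2 * a - 2 * t * c + b) -> c <= Num.sqrt a * Num.sqrt b.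
Proof.
move=> a_ge0 b_ge0 H; rewrite -sqrtrM//.
have [c_le0|c_gt0] := leP c 0; first by rewrite (le_trans c_le0)// sqrtr_ge0.
rewrite -[c]ger0_norm ?(ltW c_gt0)// -sqrtr_sqr; apply: ler_wsqrtr.
move: a_ge0; rewrite le_eqVlt => /orP[/eqP a0|a_gt0].
  (* For a = 0 the expression is affine in t, and at this t it equals -1. *)
  have := H ((b + 1) / (2 * c)); rewrite -a0 mulr0 add0r.
  have -> : 2 * ((b + 1) / (2 * c)) * c = b + 1 by field; rewrite gt_eqF.
  lra.
have := H (c / a).
have -> : (c / a) ^+ 2 * a - 2 * (c / a) * c + b = (a * b - c ^+ 2) / a.
  by field; rewrite gt_eqF.
by rewrite pmulr_lge0 ?invr_gt0// subr_ge0.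
Qed.

Lemma EFin_Rintegral d (T : measurableType d) (R : realType)
    (mu : {measure set T -> \bar R}) (D : set T) (f : T -> R) :
  measurable D -> mu.-integrable D (EFin \o f) ->
  (\int[mu]_(x in D) f x)%:E = (\int[mu]_(x in D) (f x)%:E)%E.
Proof. by move=> mD fi; rewrite fineK//; exact: integrable_fin_num. Qed.

(** Measure and set are arbitrary because the same calculus serves on Omega, on its complement and
    on rectangles of the product space. *)
Definition sqint d (T : measurableType d) (R : realType)
    (mu : {measure set T -> \bar R}) (D : set T) : set (T -> R) :=
  [set u : T -> R | measurable_fun D u /\ mu.-integrable D (EFin \o (fun x => u x ^+ 2))].

Definition rdot d (T : measurableType d) (R : realType)
    (mu : {measure set T -> \bar R}) (D : set T) (u v : T -> R) : R :=
  \int[mu]_(x in D) (u x * v x).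

Definition rnorm d (T : measurableType d) (R : realType)
    (mu : {measure set T -> \bar R}) (D : set T) (u : T -> R) : R :=
  Num.sqrt (rdot mu D u u).

Section square_integrable.
Context d (T : measurableType d) (R : realType).
Context (mu : {measure set T -> \bar R}) (D : set T).
Hypothesis mD : measurable D.
Implicit Types (u v w : T -> R) (c : R).

Local Notation X := (sqint mu D).
Local Notation N := (rnorm mu D).
Local Notation dot := (rdot mu D).

Lemma sqint_le u v : measurable_fun D u -> X v ->
  (forall x, D x -> `|u x| <= `|v x|) -> X u.
Proof.
move=> mu_ [mv iv] uv; split => //; apply: le_integrable iv => //=.
  by apply/measurable_EFinP; exact: measurable_funX.
by move=> x Dx; rewrite lee_fin !normrX lerXn2r ?nnegrE//; exact: uv.
Qed.

Lemma sqint_mul u v : X u -> X v -> mu.-integrable D (EFin \o (fun x => u x * v x)).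
Proof.
move=> [mu_ iu] [mv iv]; have := integrableD mD iu iv; apply: le_integrable => //=.
  by apply/measurable_EFinP; exact: measurable_funM.
move=> x Dx; rewrite lee_fin [leRHS]ger0_norm ?addr_ge0 ?sqr_ge0// ler_norml.
have := sqr_ge0 (u x + v x); have := sqr_ge0 (u x - v x).
have := sqr_ge0 (u x); have := sqr_ge0 (v x).
rewrite !sqrrD sqrrN mulrN !mulr2n; lra.
Qed.

Lemma sqintL c u v : X u -> X v -> X (c *: u + v).
Proof.
move=> [mu_ iu] [mv iv]; have mL : measurable_fun D (c *: u + v : T -> R).
  by apply: measurable_funD => //; exact: measurable_funM.
split => //.
have iu2 := integrableZl mD (2 * c ^+ 2) iu.
have iv2 := integrableZl mD 2 iv.
apply: le_integrable (integrableD mD iu2 iv2) => //=.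
  by apply/measurable_EFinP; exact: measurable_funX.
move=> x Dx; rewrite lee_fin !ger0_norm ?sqr_ge0//; last first.
  by apply: addr_ge0; apply: mulr_ge0; rewrite ?sqr_ge0// mulr_ge0 ?sqr_ge0.
rewrite [(c *: u + v) x]/(c * u x + v x).
have := sqr_ge0 (c * u x - v x); rewrite !sqrrD sqrrN exprMn mulrN !mulr2n; lra.
Qed.

Lemma sqint0 : X 0.
Proof.
split; first exact: measurable_cst.
by rewrite (_ : _ \o _ = cst 0%E); [exact: integrable0|apply/funext => x /=; rewrite expr0n].
Qed.

Lemma sqintD u v : X u -> X v -> X (u + v).
Proof. by move=> Xu Xv; have := sqintL 1 Xu Xv; rewrite scale1r. Qed.

Lemma sqintZ c u : X u -> X (c *: u).
Proof. by move=> Xu; have := sqintL c Xu sqint0; rewrite addr0. Qed.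

Lemma sqintN u : X u -> X (- u).
Proof. by move=> Xu; rewrite -scaleN1r; exact: sqintZ. Qed.

Lemma sqintB u v : X u -> X v -> X (u - v).
Proof. by move=> Xu Xv; apply: sqintD => //; exact: sqintN. Qed.

Lemma rdotC u v : dot u v = dot v u.
Proof. by apply: eq_Rintegral => x _; rewrite mulrC. Qed.

Lemma rdotL c u v w : X u -> X v -> X w -> dot w (c *: u + v) = c * dot w u + dot w v.
Proof.
move=> Xu Xv Xw; rewrite /rdot -RintegralZl//; last exact: sqint_mul.
rewrite -RintegralD//; [|have := integrableZl mD c (sqint_mul Xw Xu)|exact: sqint_mul].
  by apply: eq_Rintegral => x _; rewrite [(c *: u + v) x]/(c * u x + v x); rewrite mulrDr mulrCA.
by apply: eq_integrable => // x _ /=; rewrite EFinM.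
Qed.

Lemma rdot0r w : dot w 0 = 0.
Proof.
rewrite /rdot (@eq_Rintegral _ _ _ _ _ (cst 0)); last by move=> x _; exact: mulr0.
by rewrite Rintegral_cst// mul0r.
Qed.

Lemma rdotNr u w : X u -> X w -> dot w (- u) = - dot w u.
Proof.
move=> Xu Xw; have := rdotL (-1) Xu sqint0 Xw.
by rewrite addr0 scaleN1r rdot0r addr0 mulN1r.
Qed.

Lemma rdot_ge0 u : 0 <= dot u u.
Proof. by apply: Rintegral_ge0 => x _; rewrite -expr2 sqr_ge0. Qed.

Lemma sqr_rnorm u : N u ^+ 2 = dot u u.
Proof. by rewrite sqr_sqrtr// rdot_ge0. Qed.

Lemma rdot_sqrD c u v : X u -> X v ->
  dot (c *: u + v) (c *: u + v) = c ^+ 2 * dot u u + 2 * c * dot u v + dot v v.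
Proof.
move=> Xu Xv; rewrite rdotL//; last exact: sqintL.
by rewrite !(rdotC (c *: u + v)) !rdotL// (rdotC v u); ring.
Qed.

Lemma rdot_le u v : X u -> X v -> dot u v <= N u * N v.
Proof.
move=> Xu Xv; apply: le_sqrt_discriminant; rewrite ?rdot_ge0// => t.
have := rdot_ge0 ((- t) *: u + v); rewrite rdot_sqrD//.
by rewrite sqrrN mulrN mulNr.
Qed.

Lemma rnorm_le u v : X u -> X v ->
  (forall x, D x -> `|u x| <= `|v x|) -> N u <= N v.
Proof.
move=> Xu Xv uv; apply: ler_wsqrtr; apply: le_Rintegral => //; try exact: sqint_mul.
move=> x Dx; rewrite -!expr2 -(real_normK (num_real (u x))) -(real_normK (num_real (v x))).
by rewrite lerXn2r ?nnegrE//; exact: uv.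
Qed.

Lemma rnorm_ae u v : X u -> X v -> N (u - v) = 0 ->
  {ae mu, forall x, D x -> u x = v x}.
Proof.
move=> Xu Xv uv0.
have [mw iw] := sqintB Xu Xv.
have /integrableP[miw _] := iw.
have : (\int[mu]_(x in D) `|((u - v) x ^+ 2)%:E| = 0)%E.
  transitivity (dot (u - v) (u - v))%:E; last by rewrite -sqr_rnorm uv0 expr0n.
  rewrite EFin_Rintegral//.
  by apply: eq_integral => x _; rewrite abse_EFin ger0_norm ?sqr_ge0.
move=> /(ae_eq_integral_abs mu mD miw); apply: filterS => x /= H Dx.
have [/eqP] := H Dx.
by rewrite sqrf_eq0 subr_eq0 => /eqP.
Qed.

End square_integrable.

(** The steps telescope to at most 2 c (2^-k - 2^-(k + i)), which gives both the convergence and its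
    rate. *)
Lemma geometric_steps_cvg (R : realType) (a : R^nat) (c : R) :
  (forall k, `|a k.+1 - a k| <= c * 2 ^- k) ->
  cvgn a /\ forall k, `|limn a - a k| <= 2 * c * 2 ^- k.
Proof.
move=> ac.
have c_ge0 : 0 <= c by have := le_trans (normr_ge0 _) (ac 0%N); rewrite expr0 invr1 mulr1.
have tele k i : `|a (k + i)%N - a k| <= 2 * c * (2 ^- k - 2 ^- (k + i)).
  elim: i => [|i ih]; first by rewrite addn0 !subrr normr0 mulr0.
  rewrite addnS (le_trans (ler_distD (a (k + i)%N) _ _))//.
  rewrite (le_trans (lerD (ac _) ih))// (exprS 2 (k + i)%N) invfM.
  lra.
have near k i : `|a (k + i)%N - a k| <= 2 * c * 2 ^- k.
  rewrite (le_trans (tele k i))// ler_wpM2l ?mulr_ge0// gerBl invr_ge0.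
  exact: exprn_ge0.
have cva : cvgn a.
  apply/cauchy_cvgP/cauchy_exP => e e_gt0.
  have ce_gt0 : 0 < e / (2 * c + 1) by rewrite divr_gt0//; lra.
  have [k ke] := half_expn_small ce_gt0.
  exists (a k); exists k => //= j kj; rewrite /ball /= distrC.
  rewrite -(subnKC kj) (le_lt_trans (near _ _))//.
  have : 0 < 2 ^- k :> R by rewrite invr_gt0 exprn_gt0.
  move: ke; rewrite ler_pdivlMr; lra.
split => // k.
rewrite distrC ler_distlC.
have cvk : \forall j \near \oo, `|a j - a k| <= 2 * c * 2 ^- k.
  by exists k => //= j kj; rewrite -(subnKC kj).
apply/andP; split; [apply: limr_ge => //|apply: limr_le => //];
  apply: filterS cvk => j; rewrite ler_distl => /andP[]; lra.
Qed.

(** * Completeness of L2 *)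

Section completeness.
Context d (T : measurableType d) (R : realType).
Context (mu : {measure set T -> \bar R}) (D : set T).
Hypothesis mD : measurable D.
Implicit Types (u v w : T -> R) (c : R).

Local Notation X := (sqint mu D).
Local Notation N := (rnorm mu D).
Local Notation dot := (rdot mu D).

Lemma rnorm_triangle u v : X u -> X v -> N (u + v) <= N u + N v.
Proof.
move=> Xu Xv.
rewrite -ler_sqr ?nnegrE ?addr_ge0 ?sqrtr_ge0//.
have := rdot_sqrD mD 1 Xu Xv; rewrite scale1r sqr_rnorm// => ->.
rewrite sqrrD !sqr_rnorm//.
have := rdot_le mD Xu Xv; rewrite mulr2n; lra.
Qed.

Lemma rnormZ c u : X u -> N (c *: u) = `|c| * N u.
Proof.
move=> Xu; have := rdot_sqrD mD c Xu (sqint0 mu D); rewrite addr0 /rnorm => ->.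
by rewrite !rdot0r// mulr0 !addr0 sqrtrM ?sqr_ge0// sqrtr_sqr.
Qed.

Lemma integral_sqr u : X u -> (\int[mu]_(x in D) (u x ^+ 2)%:E = (N u ^+ 2)%:E)%E.
Proof.
move=> Xu; rewrite sqr_rnorm /rdot EFin_Rintegral; [|by []|exact: sqint_mul].
by apply: eq_integral => x _; rewrite expr2.
Qed.

(* S = sum_k 4^k |w_(k+1) - w_k|^2 is integrable, and pointwise
   |w_(k+1) - w_k| <= sqrt S * 2^-k. *)
Let cauchy_subseq_cvg (w : nat -> T -> R) : (forall k, X (w k)) ->
  (forall k, N (w k.+1 - w k) <= 4 ^- k) ->
  exists2 l, X l & forall k, N (l - w k) <= 4 * 2 ^- k.
Proof.
move=> Xw wN.
pose f k x := (4 ^+ k * (w k.+1 x - w k x) ^+ 2)%:E.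
have f_ge0 k x : (0 <= f k x)%E by rewrite lee_fin mulr_ge0 ?sqr_ge0// exprn_ge0.
have Xd k : X (w k.+1 - w k) by exact: sqintB.
have mdf k : measurable_fun D (EFin \o (fun x => (w k.+1 x - w k x) ^+ 2)).
  apply/measurable_EFinP; apply: measurable_funX; exact: (Xd k).1.
have mf k : measurable_fun D (f k).
  by apply/measurable_EFinP; apply: measurable_funM => //; apply/measurable_EFinP.
pose S x := (\sum_(0 <= k <oo) f k x)%E.
have S_ge0 x : (0 <= S x)%E by exact: nneseries_ge0.
have mS : measurable_fun D S.
  by apply: ge0_emeasurable_sum.
have intS : (\int[mu]_(x in D) S x <= 2%:E)%E.
  rewrite integral_nneseries//.
  apply: lime_le; first by apply: is_cvg_nneseries => k _ _; exact: integral_ge0.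
  apply: nearW => n.
  rewrite (@le_trans _ _ (\sum_(0 <= k < n) (4 ^- k)%:E)%E)//.
    apply: lee_sum => k _; rewrite /f.
    under eq_integral do rewrite EFinM.
    rewrite (ge0_integralZl _ mD (mdf k)); [|
      by move=> x _; rewrite lee_fin sqr_ge0|by rewrite lee_fin exprn_ge0].
    have := integral_sqr (Xd k); rewrite /= => ->.
    rewrite -EFinM lee_fin.
    have q0 : 0 < 4 ^+ k :> R by rewrite exprn_gt0.
    by rewrite -ler_pdivlMl// -invfM -expr2 -exprVn lerXn2r ?wN// nnegrE ?sqrtr_ge0// invr_ge0 ltW.
  rewrite sumEFin lee_fin.
  (* The strengthened bound is the one that passes through the induction: the subtracted term
     absorbs the next summand. *)
  suff : \sum_(0 <= k < n) 4 ^- k <= 2 - 2 * 4 ^- n :> R.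
    have : 0 <= 4 ^- n :> R by rewrite invr_ge0 exprn_ge0.
    lra.
  elim: n => [|n ih]; first by rewrite big_nil expr0 invr1; lra.
  rewrite big_nat_recr//= exprS invfM.
  have : 0 <= 4 ^- n :> R by rewrite invr_ge0 exprn_ge0.
  lra.
pose E := D `&` [set x | (S x < +oo)%E].
have mE : measurable E by exact: emeasurable_fun_infty_o.
have steps x : E x -> forall k, `|w k.+1 x - w k x| <= Num.sqrt (fine (S x)) * 2 ^- k.
  move=> [Dx Sx] k.
  have Sfin : S x \is a fin_num by rewrite ge0_fin_numE.
  have : (f k x <= S x)%E.
    rewrite /S; apply: le_trans (nneseries_lim_ge k.+1 _) => //.
    by rewrite big_nat_recr//= leeDr// sume_ge0.
  rewrite -[S x]fineK// lee_fin => fS.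
  rewrite -(ler_pM2r (_ : 0 < 2 ^+ k)) ?exprn_gt0// mulfVK ?gt_eqF ?exprn_gt0//.
  rewrite -[leLHS]ger0_norm ?mulr_ge0 ?exprn_ge0// -sqrtr_sqr.
  apply: ler_wsqrtr; apply: le_trans fS.
  rewrite exprMn real_normK ?num_real// mulrC -exprM mulnC exprM.
  by rewrite (_ : 2 ^+ 2 = 4) ?lexx// expr2; ring.
pose l x := if x \in E then limn (w ^~ x) else 0.
have lE x : E x -> cvgn (w ^~ x) /\ forall k, `|l x - w k x| <= 2 * Num.sqrt (fine (S x)) * 2 ^- k.
  by move=> Ex; rewrite /l mem_set//; exact: geometric_steps_cvg (steps x Ex).
have ml : measurable_fun D l.
  apply: (@measurable_fun_cvg _ _ _ _ (fun k x => (w k \_ E) x)).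
    move=> k; apply/(measurable_restrict _ mE mD).
    by apply: measurable_funS (Xw k).1 => // x [].
  move=> x Dx; rewrite /l /patch; case: ifPn => [/set_mem Ex|_]; last exact: cvg_cst.
  exact: (lE x Ex).1.
have Xlw k : X (l - w k) /\ N (l - w k) <= 4 * 2 ^- k.
  have mlw : measurable_fun D (EFin \o (fun x => (l - w k) x ^+ 2)).
    apply/measurable_EFinP; apply: measurable_funX; apply: measurable_funB => //.
    exact: (Xw k).1.
  have c_gt0 : 0 < 4 * 4 ^- k :> R by rewrite mulr_gt0// invr_gt0 exprn_gt0.
  have le1 : (\int[mu]_(x in D) ((l - w k) x ^+ 2)%:E <= (8 * 4 ^- k)%:E)%E.
    apply: (@le_trans _ _ (\int[mu]_(x in D) ((4 * 4 ^- k)%:E * S x)))%E.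
      apply: ge0_le_integral => //.
      - by move=> x _; rewrite lee_fin sqr_ge0.
      - exact: measurable_funeM.
      move=> x Dx.
      (* Off [E] the right-hand side is +oo, so the default value 0 of [l] there is harmless. *)
      have [Sx|] := ltP (S x) +oo%E; last first.
        by rewrite leye_eq => /eqP ->; rewrite gt0_muley ?lte_fin// leey.
      have Sfin : S x \is a fin_num by rewrite ge0_fin_numE.
      rewrite -[S x]fineK// -EFinM lee_fin.
      have [_ /(_ k)] := lE x (conj Dx Sx).
      rewrite -[l x - w k x]/((l - w k) x) => H.
      have H0 := le_trans (normr_ge0 _) H.
      have H2 := lerXn2r 2 (normr_ge0 _ : _ \in Num.nneg) (H0 : _ \in Num.nneg) H.
      rewrite -real_normK ?num_real// (le_trans H2)//.
      rewrite !exprMn sqr_sqrtr ?fine_ge0// exprVn -exprM mulnC exprM.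
      rewrite (_ : 2 ^+ 2 = 4); last by rewrite expr2; ring.
      by rewrite mulrAC.
    rewrite ge0_integralZl// ?lee_fin ?(ltW c_gt0)//.
    apply: (@le_trans _ _ ((4 * 4 ^- k)%:E * 2%:E)%E).
      by apply: lee_wpmul2l => //; rewrite lee_fin ltW.
    by rewrite -EFinM lee_fin; lra.
  have Xlw : X (l - w k).
    split; first by apply: measurable_funB => //; exact: (Xw k).1.
    apply/integrableP; split => //.
    rewrite (le_lt_trans _ (ltry (8 * 4 ^- k)))//; apply: le_trans le1.
    by under eq_integral do rewrite abse_EFin ger0_norm ?sqr_ge0//.
  split => //.
  rewrite integral_sqr// lee_fin in le1.
  rewrite -ler_sqr ?nnegrE ?sqrtr_ge0 ?mulr_ge0 ?invr_ge0 ?exprn_ge0//.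
  rewrite (le_trans le1)// exprMn exprVn -exprM mulnC exprM.
  rewrite (_ : 2 ^+ 2 = 4); last by rewrite expr2; ring.
  have : 0 < 4 ^- k :> R by rewrite invr_gt0 exprn_gt0.
  lra.
exists l => [|k]; last by have [] := Xlw k.
rewrite -[l](subrK (w 0%N)); apply: sqintD => //; exact: (Xlw 0%N).1.
Qed.

Lemma sqint_seminorm : seminorm X N.
Proof.
split.
- exact: sqint0.
- exact: sqintL.
- by move=> u; exact: sqrtr_ge0.
- exact: rnorm_triangle.
- exact: rnormZ.
move=> u Xu uC.
have /choice[K KP] : forall k, exists K, forall i j,
    (K <= i)%N -> (K <= j)%N -> N (u i - u j) <= 4 ^- k.
  by move=> k; apply: uC; rewrite invr_gt0 exprn_gt0.
(* Summing the thresholds makes [psi] nondecreasing while keeping it above [K]. *)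
pose psi k := (\sum_(i < k.+1) K i)%N.
have Kpsi k : (K k <= psi k)%N by rewrite /psi big_ord_recr leq_addl.
have psiS k : (psi k <= psi k.+1)%N by rewrite /psi [leqRHS]big_ord_recr leq_addr.
have [||l Xl lP] := @cauchy_subseq_cvg (u \o psi).
- by move=> k; exact: Xu.
- by move=> k; apply: KP => //; exact: leq_trans (psiS k).
exists l => // e e_gt0.
(* 5 = 1 + 4: the Cauchy property contributes 4^-k <= 2^-k and the limit along the subsequence 4 *
   2^-k. *)
have [|k ke] := @half_expn_small _ (e / 5); first by rewrite divr_gt0.
exists (psi k) => i ki.
have := KP k i (psi k) (leq_trans (Kpsi k) ki) (Kpsi k).
have := lP k; rewrite /comp.
have := rnorm_triangle (sqintB mD (Xu i) (Xu (psi k))) (sqintB mD (Xu (psi k)) Xl).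
rewrite subrKA -(opprB l (u (psi k))) -[- (l - _)]scaleN1r (rnormZ (-1)) ?normrN1 ?mul1r; last exact: sqintB.
have : 4 ^- k <= 2 ^- k :> R.
  by rewrite lef_pV2 ?posrE ?exprn_gt0// lerXn2r ?nnegrE//; lra.
lra.
Qed.

End completeness.

(** * Positive parts in L2 *)

Section positive_part.
Context d (T : measurableType d) (R : realType).
Context (mu : {measure set T -> \bar R}) (D : set T).
Hypothesis mD : measurable D.
Implicit Types (u v w : T -> R) (c : R).

Local Notation X := (sqint mu D).
Local Notation N := (rnorm mu D).
Local Notation dot := (rdot mu D).

Definition pos_part (u : T -> R) : T -> R := fun x => Num.max (u x) 0.
Local Notation pos := pos_part.

Lemma pos_part_ge0 u x : 0 <= pos u x.
Proof. by rewrite /pos le_max lexx orbT. Qed.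

Lemma pos_part_le_norm u x : `|pos u x| <= `|u x|.
Proof.
rewrite /pos; have [u0|u0] := leP (u x) 0; first by rewrite normr0.
by rewrite lexx.
Qed.

Lemma measurable_pos_part (A : set T) u : measurable_fun A u -> measurable_fun A (pos u).
Proof. by move=> mu_; apply: measurable_maxr. Qed.

Lemma sqint_pos_part u : X u -> X (pos u).
Proof.
move=> Xu; apply: (sqint_le mD _ Xu); first exact: measurable_pos_part Xu.1.
by move=> x _; exact: pos_part_le_norm.
Qed.

Lemma sqint_abs u : X u -> X (fun x => `|u x|).
Proof.
move=> Xu; apply: (sqint_le mD _ Xu); first exact: measurableT_comp Xu.1.
by move=> x _; rewrite normr_id.
Qed.

(** The square of the positive part has derivative 2 max(a, 0), which is 2-Lipschitz, so it lies
    below its tangent plus b^2. *)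
Lemma pos_part_sqr_le (a b : R) :
  Num.max (a + b) 0 ^+ 2 <= Num.max a 0 ^+ 2 + 2 * (Num.max a 0 * b) + b ^+ 2.
Proof.
have [a0|a0] := leP a 0; have [b0|b0] := leP (a + b) 0.
- by rewrite !mul0r mulr0 expr0n /= !add0r sqr_ge0.
- rewrite mul0r mulr0 expr0n /= !add0r lerXn2r ?nnegrE//; lra.
- rewrite expr0n /=; have := sqr_ge0 (a + b); rewrite sqrrD -mulr_natl; lra.
- by rewrite sqrrD -mulr_natl mulr_natl.
Qed.

(** The difference of the two integrands agrees almost everywhere with its absolute value, whose
    integral is nonnegative. *)
Lemma le_rdot u v u' v' : X u -> X v -> X u' -> X v' ->
  {ae mu, forall x, D x -> u x * v x <= u' x * v' x} -> dot u v <= dot u' v'.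
Proof.
move=> Xu Xv Xu' Xv' uv.
have i1 := sqint_mul mD Xu Xv; have i2 := sqint_mul mD Xu' Xv'.
rewrite -subr_ge0 /rdot -RintegralB// /Rintegral fine_ge0//.
have iB : mu.-integrable D (EFin \o (fun x => u' x * v' x - u x * v x)).
  by apply: eq_integrable (integrableB mD i2 i1) => // x _ /=; rewrite EFinB.
rewrite (_ : integral _ _ _ = \int[mu]_(x in D) `|u' x * v' x - u x * v x|%:E)%E.
  by apply: integral_ge0 => x _; rewrite lee_fin.
apply: ae_eq_integral => //.
- by have /integrableP[] := iB.
- apply/measurable_EFinP; apply: measurableT_comp => //.
  by have /integrableP[/measurable_EFinP] := iB.
apply: filterS uv => x H Dx; rewrite ger0_norm//.
by rewrite subr_ge0 H.
Qed.

Lemma ae_nonneg_of_pos_part u : X u -> N (pos (- u)) = 0 ->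
  {ae mu, forall x, D x -> 0 <= u x}.
Proof.
move=> Xu N0.
have Xp : X (pos (- u)) by apply: sqint_pos_part; exact: sqintN.
have /(rnorm_ae mD Xp (sqint0 mu D)) : N (pos (- u) - 0) = 0 by rewrite subr0.
apply: filterS => x H Dx; have := H Dx.
rewrite /pos /= => H0; rewrite -oppr_le0 -[X in _ <= X]H0.
by rewrite le_max lexx.
Qed.

(** Where v <= 0, one has u^+ <= |u - v|: the positive part is no longer than the distance to any
    nonpositive function. *)
Lemma rnorm_pos_part_le u v : X u -> X v ->
  {ae mu, forall x, D x -> v x <= 0} -> N (pos u) <= N (u - v).
Proof.
move=> Xu Xv v0; apply: ler_wsqrtr.
have Xp := sqint_pos_part Xu; have Xw := sqintB mD Xu Xv.
apply: le_rdot => //; apply: filterS v0 => x H Dx; have {H}v0 := H Dx.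
rewrite -!expr2 -[leRHS]real_normK ?num_real// lerXn2r ?nnegrE ?pos_part_ge0//.
rewrite [(u - v) x]/(u x - v x) /pos ge_max normr_ge0 andbT.
by apply: (@le_trans _ _ (u x - v x)); [lra|exact: ler_norm].
Qed.

Lemma ae_nonneg_closed (u : nat -> T -> R) l :
  (forall i, X (u i) /\ {ae mu, forall x, D x -> 0 <= u i x}) -> X l ->
  (forall e, 0 < e -> exists k, forall i, (k <= i)%N -> N (u i - l) <= e) ->
  {ae mu, forall x, D x -> 0 <= l x}.
Proof.
move=> Xu Xl ul; apply: ae_nonneg_of_pos_part => //.
apply/eqP; rewrite eq_le sqrtr_ge0 andbT; apply/ler_addgt0Pr => e e_gt0.
have [k /(_ k (leqnn _)) uke] := ul _ e_gt0.
have [Xk uk0] := Xu k.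
rewrite add0r (le_trans _ uke)//.
have := rnorm_pos_part_le (sqintN mD Xl) (sqintN mD Xk).
rewrite opprK [- l + _]addrC; apply.
by apply: filterS uk0 => x H Dx; rewrite [(- u k) x]/(- u k x) oppr_le0 H.
Qed.

(** [pos_part_sqr_le] integrated, with Cauchy-Schwarz for the term in [z]. This is the one-sided
    expansion that [descent] asks for. *)
Lemma rdot_pos_part_expand u w z h : X u -> X w -> X z -> 0 <= h ->
  N (pos (u + (h *: w + z))) ^+ 2 <=
  N (pos u) ^+ 2 + 2 * (h * dot (pos u) w + N u * N z) + N (h *: w + z) ^+ 2.
Proof.
move=> Xu Xw Xz h_ge0.
have Xp := sqint_pos_part Xu; have XL := sqintL mD h Xw Xz.
have XpL := sqint_pos_part (sqintD mD Xu XL).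
apply: (@le_trans _ _ (N (pos u) ^+ 2 + 2 * dot (pos u) (h *: w + z) + N (h *: w + z) ^+ 2)).
  rewrite !sqr_rnorm.
  have X2 := sqintZ mD 2 Xp.
  have i1 := sqint_mul mD Xp Xp; have i2 := sqint_mul mD X2 XL.
  have i3 := sqint_mul mD XL XL.
  have -> : 2 * dot (pos u) (h *: w + z) = dot (2 *: pos u) (h *: w + z).
    have := rdotL mD 2 Xp (sqint0 mu D) XL; rewrite addr0 rdotC => ->.
    by rewrite (rdot0r mu mD) addr0 rdotC.
  rewrite /rdot -RintegralD// -RintegralD//; last first.
    by apply: eq_integrable (integrableD mD i1 i2) => // x _ /=; rewrite EFinD.
  apply: le_Rintegral => //.
  - exact: sqint_mul.
  - exact: (integrableD mD (integrableD mD i1 i2) i3).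
  move=> x Dx; have := pos_part_sqr_le (u x) ((h *: w + z) x).
  rewrite -!expr2 [(2 *: pos u) x]/(2 * pos u x) /pos -mulrA.
  exact: le_trans.
rewrite lerD2r lerD2l ler_wpM2l// rdotL// lerD2l (le_trans (rdot_le mD Xp Xz))//.
rewrite ler_wpM2r ?sqrtr_ge0// rnorm_le// => x _; exact: pos_part_le_norm.
Qed.

End positive_part.

(** * The semigroups of the statement *)

Lemma cvge0_right (R : realType) (f : R -> \bar R) (e : R) :
  f h @[h --> 0^'+] --> 0%E -> 0 < e ->
  exists2 d, 0 < d & forall h, 0 < h < d -> (f h < e%:E)%E.
Proof.
move=> f0 e_gt0.
have /f0 [d /= d_gt0 Hd] : nbhs (0%E : \bar R) [set y | (y < e%:E)%E].
  by apply: open_nbhs_nbhs; split => /=; [exact: open_ereal_lt_ereal|rewrite lte_fin].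
exists d => // h /andP[h_gt0 hd].
by apply: Hd => //; rewrite /ball /= sub0r normrN gtr0_norm.
Qed.

Section L2_bridge.
Context (R : realType) (n : nat) (Omega : set 'rV[R]_n).
Hypothesis mO : measurable Omega.
Implicit Types (u v w f : 'rV[R]_n -> R).

Local Notation mu := (@lebesgue_rV R n).
Local Notation X := (sqint mu Omega).
Local Notation N := (rnorm mu Omega).

Lemma L2norm_sqr u : (L2norm Omega u `^ 2 = \int[mu]_(x in Omega) (u x ^+ 2)%:E)%E.
Proof.
rewrite /L2norm powR_Lnorm ?pnatr_eq0// [RHS]integral_mkcond; apply: eq_integral => x _ /=.
rewrite ?poweR_EFin powR_mulrn// real_normK ?num_real//.
by rewrite /patch; case: ifPn => // _; rewrite expr0n.
Qed.

Lemma L2P u : L2 Omega u <-> X u.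
Proof.
split.
  rewrite /L2 /= => Lu; have /andP[+ _] : _ && _ := Lu.
  rewrite inE /= => mu_; split; first exact/(measurable_restrictT _ mO).
  have := Lfun2_integrable_sqr Lu; rewrite (integrable_mkcond _ mO).
  apply: eq_integrable => // x _ /=; rewrite /patch; case: ifPn => //= _.
  by rewrite expr0n.
move=> [mu_ iu]; rewrite /L2 /= inE; apply/andP; split; rewrite inE /=.
  exact/(measurable_restrictT _ mO).
rewrite /finite_norm -/(L2norm Omega u).
apply: (@lty_poweRy _ _ 2); first by rewrite pnatr_eq0.
by rewrite L2norm_sqr; exact: integrable_lty.
Qed.

Lemma L2normE u : L2 Omega u -> L2norm Omega u = (N u)%:E.
Proof.
move=> /L2P Xu.
have := L2norm_sqr u; rewrite (integral_sqr mO Xu).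
have L_ge0 : (0 <= L2norm Omega u)%E by exact: Lnorm_ge0.
have : (L2norm Omega u < +oo)%E.
  apply: (@lty_poweRy _ _ 2); first by rewrite pnatr_eq0.
  by rewrite L2norm_sqr; exact: integrable_lty Xu.2.
case: (L2norm Omega u) L_ge0 => // r r_ge0 _.
rewrite poweR_EFin powR_mulrn// => -[/eqP].
by rewrite eqrXn2// ?sqrtr_ge0// => /eqP ->.
Qed.

Lemma C0_semigroup_semigroup (T : L2_operators R n) :
  C0_semigroup Omega T -> semigroup X N T.
Proof.
move=> [TX Tlin Tbd [T0 TD] Tcont].
have ae0 u v : X u -> X v -> ae_in Omega (fun x => u x = v x) -> N (u - v) = 0.
  move=> Xu Xv uv; apply/eqP; rewrite eq_le sqrtr_ge0 andbT.
  have X0 := sqint0 mu Omega; have Xw := sqintB mO Xu Xv.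
  have -> : 0 = N 0 by rewrite (sn0 (sqint_seminorm mu mO)).
  apply: ler_wsqrtr; apply: (le_rdot mO) => //.
  move: uv; rewrite /ae_in; apply: filterS => x H Ox.
  have -> : (u - v) x = 0 by apply/eqP; rewrite subr_eq0 H.
  by rewrite mul0r.
have XT t u : 0 <= t -> X u -> X (T t u).
  by move=> t_ge0 /L2P Xu; apply/L2P; exact: TX.
split => //.
- move=> t c u v t_ge0 Xu Xv; apply: ae0.
  + by apply: (XT) => //; exact: sqintL.
  + by apply: sqintL => //; exact: XT.
  + by apply: Tlin => //; exact/L2P.
- move=> t t_ge0; have [M TM] := Tbd t t_ge0.
  exists (Num.max M 0); first by rewrite le_max lexx orbT.
  move=> u Xu; have Lu : L2 Omega u by exact/L2P.
  have := TM u Lu; rewrite !L2normE//; last exact: TX.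
  rewrite -EFinM lee_fin => /le_trans; apply.
  by rewrite ler_wpM2r ?sqrtr_ge0// le_max lexx.
- by move=> u Xu; apply: ae0 => //; [exact: XT|apply: T0; exact/L2P].
- move=> t1 t2 u t1_ge0 t2_ge0 Xu; apply: ae0.
  + by apply: (XT) => //; exact: addr_ge0.
  + by apply: (XT) => //; exact: XT.
  + by apply: TD => //; exact/L2P.
- move=> u e Xu e_gt0.
  have Lu : L2 Omega u by exact/L2P.
  have [d d_gt0 Hd] := cvge0_right (Tcont u Lu) e_gt0; exists d => // h hd.
  have Xh : L2 Omega (T h u - u).
    apply/L2P; apply: sqintB => //; apply: XT => //.
    by case/andP: hd => /ltW.
  by have := Hd h hd; rewrite (L2normE Xh) lte_fin => /ltW.
Qed.

Lemma generated_by_generates (A : ('rV[R]_n -> R) -> ('rV[R]_n -> R) -> Prop)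
    (T : L2_operators R n) u f :
  generated_by Omega A T -> X u -> X f ->
  A u f <-> generates N T u (- f).
Proof.
move=> [T0 TA] Xu Xf.
have TX := C0_semigroup_semigroup T0.
have Lu : L2 Omega u by exact/L2P.
have Lf : L2 Omega f by exact/L2P.
have XT h : 0 <= h -> X (T h u) by move=> ?; exact: (sg_mem TX).
have E h : 0 < h -> L2norm Omega (fun x => (T h u x - u x) / h - - f x) =
    (h^-1 * N (T h u - u - h *: (- f)))%:E.
  move=> h_gt0; have h_ge0 := ltW h_gt0.
  have Xw : X (T h u - u - h *: (- f)).
    apply: sqintB => //; first by apply: sqintB => //; exact: XT.
    by apply: sqintZ => //; exact: sqintN.
  rewrite (_ : (fun x => _) = h^-1 *: (T h u - u - h *: (- f))); last first.
    apply/funext => x.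
    transitivity (h^-1 * (T h u x - u x - h * (- f x))); last by [].
    by rewrite mulrBr mulKf ?gt_eqF// mulrC.
  rewrite L2normE; last by apply/L2P; exact: sqintZ.
  by rewrite (rnormZ mO)// ger0_norm// invr_ge0.
rewrite TA//; split.
  move=> H e e_gt0.
  have [d d_gt0 Hd] := cvge0_right H e_gt0; exists d => // h hd.
  have /andP[h_gt0 _] := hd.
  by have := Hd h hd; rewrite E// lte_fin ltr_pdivrMl// mulrC => /ltW.
move=> H.
apply: (@cvg_EFin _ _ _ _ _ 0).
  by near=> h; rewrite E.
apply/cvgrPdist_le => e e_gt0.
have [d d_gt0 Hd] := H e e_gt0.
exists d => //= h; rewrite /ball /= sub0r normrN => hd h_gt0.
rewrite gtr0_norm// in hd.
rewrite sub0r normrN E//= ger0_norm; last first.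
  by rewrite mulr_ge0 ?sqrtr_ge0// invr_ge0 ltW.
by rewrite ler_pdivrMl// mulrC Hd// h_gt0.
Unshelve. all: by end_near.
Qed.

End L2_bridge.

(** * Borel sets and the kernel *)

Section borel_rV.
Context (R : realType) (n : nat).
Implicit Types (x y : 'rV[R]_n) (A : set 'rV[R]_n).

Lemma measurable_box (a b : 'I_n -> R) :
  measurable [set x : 'rV[R]_n | forall i, x ord0 i \in `]a i, b i[].
Proof.
rewrite (_ : mkset _ = \bigcap_(i in [set: 'I_n])
    ((fun x : 'rV[R]_n => x ord0 i) @^-1` `]a i, b i[)).
  apply: fin_bigcap_measurable => // i _; rewrite -[X in measurable X]setTI.
  by apply: measurable_coord => //; exact: measurable_itv.
by rewrite predeqE => x; split => [hx i _|hx i]; [exact: hx|exact: (hx i)].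
Qed.

(** An open set is the countable union of the boxes with rational corners that it contains, and
    boxes are finite intersections of coordinate preimages. *)
Lemma open_measurable_rV A : open A -> measurable A.
Proof.
move=> oA.
pose box (q : 'rV[rat]_n * 'rV[rat]_n) := [set x : 'rV[R]_n | forall i,
   x ord0 i \in `]ratr (q.1 ord0 i), ratr (q.2 ord0 i)[].
pose F q := if pselect (box q `<=` A) then box q else set0.
have -> : A = \bigcup_q F q.
  apply/seteqP; split => [x Ax|x [q _]]; last first.
    by rewrite /F; case: pselect => // H /H.
  have [B /= Bx BA] : nbhs x A by exact: open_nbhs_nbhs.
  have H i : exists q : rat * rat, (x ord0 i \in `]ratr q.1, ratr q.2[) /\
      forall t : R, t \in `]ratr q.1, ratr q.2[ -> B ord0 i t.
    have /nbhs_ballP[e /= e_gt0 eB] := Bx ord0 i.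
    have [p] : exists p, ratr p \in `]x ord0 i - e, x ord0 i[.
      by apply: rat_in_itvoo; lra.
    have [q] : exists q, ratr q \in `]x ord0 i, x ord0 i + e[.
      by apply: rat_in_itvoo; lra.
    rewrite !in_itv /= => /andP[xq qe] /andP[pe px].
    exists (p, q); rewrite in_itv /= px xq; split => // t.
    rewrite in_itv /= => /andP[pt tq]; apply: eB; rewrite /ball /= ltr_distlC.
    by apply/andP; split; lra.
  have [q Hq] := fin_all_exists H.
  exists (\row_i (q i).1, \row_i (q i).2) => //.
  rewrite /F; case: pselect => [_ i /=|]; first by rewrite !mxE; exact: (Hq i).1.
  case=> y yq; apply: BA => i j; rewrite (ord1 i); apply: (Hq j).2.
  by have := yq j; rewrite !mxE.
have mF q : measurable (F q).
  by rewrite /F; case: pselect => /= ?; [exact: measurable_box|].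
by apply: (countable_bigcupT_measurable _ mF); exact: countableP.
Qed.

Lemma closed_measurable_rV A : closed A -> measurable A.
Proof.
by move=> cA; rewrite -(setCK A); apply: measurableC; apply: open_measurable_rV; exact: closed_openC.
Qed.

Lemma bounded_lebesgue_rV A : measurable A -> bounded_set A -> (@lebesgue_rV R n A < +oo)%E.
Proof.
move=> mA [M [Mr AM]].
pose c : R := `|M| + 1.
have c_ge0 : 0 <= c by rewrite /c; have := normr_ge0 M; lra.
have Ac x i : A x -> `|x ord0 i| <= c.
  move=> Ax; rewrite (@le_trans _ _ `|x|)//.
    rewrite [leRHS]mx_normrE.
    by apply: (le_trans _ (le_bigmax _ _ (ord0, i))).
  by apply: AM => //; rewrite /c (le_lt_trans (ler_norm M))//; lra.
pose a : 'rV[R]_n := const_mx (- c); pose b : 'rV[R]_n := const_mx c.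
have := @lebesgue_rV_box R n a b.
pose B := [set x : 'rV[R]_n | forall i, x ord0 i \in `[a ord0 i, b ord0 i]].
rewrite -/B => LB.
have mB : measurable B.
  rewrite (_ : B = \bigcap_(i in [set: 'I_n])
    ((fun x : 'rV[R]_n => x ord0 i) @^-1` `[a ord0 i, b ord0 i])).
    apply: fin_bigcap_measurable => // i _; rewrite -[X in measurable X]setTI.
    by apply: measurable_coord => //; exact: measurable_itv.
  by rewrite predeqE => x; split => [hx i _|hx i]; [exact: hx|exact: (hx i)].
apply: (@le_lt_trans _ _ (lebesgue_rV B)).
  apply: le_measure; rewrite ?inE// => x Ax i /=.
  by rewrite !mxE in_itv /= -ler_norml; exact: Ac.
rewrite LB ?ltry// => i; rewrite !mxE; lra.
Qed.

Lemma enorm_ge0 x : 0 <= enorm x. Proof. exact: sqrtr_ge0. Qed.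

Lemma enormC x y : enorm (x - y) = enorm (y - x).
Proof.
by congr Num.sqrt; apply: eq_bigr => i _; rewrite !mxE -sqrrN opprB.
Qed.

Lemma coord_le_enorm x i : `|x ord0 i| <= enorm x.
Proof.
rewrite -sqrtr_sqr; apply: ler_wsqrtr.
by rewrite (bigD1 i)//= lerDl sumr_ge0// => j _; rewrite sqr_ge0.
Qed.

Lemma norm_le_enorm x : `|x| <= enorm x.
Proof.
have [x0|x0] := eqVneq (mx_norm x) 0; first by rewrite [leLHS]x0 enorm_ge0.
have [[i j] xij] := mx_norm_neq0 x0.
by rewrite [leLHS]xij /= (ord1 i); exact: coord_le_enorm.
Qed.

Context (s : R).
Hypothesis s_gt0 : 0 < s.

Lemma hkernelC x y : hkernel s x y = hkernel s y x.
Proof. by rewrite /hkernel enormC. Qed.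

Lemma hkernel_ge0 x y : 0 <= hkernel s x y.
Proof. by rewrite invr_ge0 powR_ge0. Qed.

Lemma measurable_hkernel : measurable_fun [set: 'rV[R]_n * 'rV[R]_n]
  (fun z => hkernel s z.1 z.2).
Proof.
have -> : (fun z : 'rV[R]_n * 'rV[R]_n => hkernel s z.1 z.2) = fun z =>
    ((\sum_(i < n) (z.1 ord0 i - z.2 ord0 i) ^+ 2) `^ 2^-1) `^ (- (n%:R + 2 * s)).
  apply/funext => z; rewrite /hkernel powRN powR12_sqrt; last first.
    by rewrite sumr_ge0// => i _; exact: sqr_ge0.
  by congr ((Num.sqrt _ `^ _)^-1); apply: eq_bigr => i _; rewrite !mxE.
apply: (measurableT_comp (measurable_powR _)).
apply: (measurableT_comp (measurable_powR _)).
apply: measurable_sum => i.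
apply: (@measurable_funX _ _ _ _ (fun x : 'rV[R]_n * 'rV[R]_n => x.1 ord0 i - x.2 ord0 i)).
apply: measurable_funB.
- by apply: (@measurableT_comp _ _ _ _ _ _ (fun x : 'rV[R]_n => x ord0 i) _ fst); [exact: measurable_coord|exact: measurable_fst].
- by apply: (@measurableT_comp _ _ _ _ _ _ (fun x : 'rV[R]_n => x ord0 i) _ snd); [exact: measurable_coord|exact: measurable_snd].
Qed.

(** Some ball of radius e around y in the maximum norm misses A. The Euclidean norm is larger, so it
    is at least e on y - A, and the kernel is at most e^-(n + 2 s). *)
Lemma hkernel_bounded A y : ~ closure A y ->
  exists2 c, 0 <= c & forall x, A x -> hkernel s y x <= c.
Proof.
rewrite /closure /= => /existsNP[B] /not_implyP[/nbhs_ballP[e /= e_gt0 eB] AB].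
have p_ge0 : 0 <= n%:R + 2 * s by rewrite addr_ge0// mulr_ge0// ltW.
exists (e `^ (n%:R + 2 * s))^-1 => [|x Ax]; first by rewrite invr_ge0 powR_ge0.
have ex : e <= enorm (y - x).
  rewrite leNgt; apply/negP => xe; apply: AB; exists x; split => //; apply: eB.
  rewrite -ball_normE /=; exact: le_lt_trans (norm_le_enorm _) xe.
have en_gt0 : 0 < enorm (y - x) by exact: lt_le_trans ex.
rewrite /hkernel lef_pV2 ?posrE ?powR_gt0//.
by apply: ge0_ler_powR => //; rewrite nnegrE ltW.
Qed.

End borel_rV.

(** * Fubini on rectangles *)

(** An integrable function is finite almost everywhere, so [fine] alters it on a null set only. *)
Lemma integrable_fine d (T : measurableType d) (R : realType)
    (mu : {measure set T -> \bar R}) (D : set T) (F : T -> \bar R) :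
  measurable D -> mu.-integrable D F ->
  mu.-integrable D (EFin \o (fun x => fine (F x))) /\
  (\int[mu]_(x in D) (fine (F x))%:E = \int[mu]_(x in D) F x)%E.
Proof.
move=> mD iF; have [mF _] := integrableP _ _ _ iF.
have mfF : measurable_fun D (EFin \o (fun x => fine (F x))).
  by apply/measurable_EFinP; exact: (measurableT_comp (f := fine)).
have FE : ae_eq mu D F (EFin \o (fun x => fine (F x))).
  by apply: filterS (integrable_ae mD iF) => x /= H Dx; rewrite fineK// H.
split.
  apply: (le_integrable mD mfF _ iF) => x Dx /=.
  by case: (F x) => //=; rewrite normr0 leey.
by apply: ae_eq_integral => //; exact: ae_eq_sym.
Qed.

Section fubini_on_rectangles.
Context d (T : measurableType d) (R : realType).
Context (mu : {sigma_finite_measure set T -> \bar R}) (A B : set T).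
Hypotheses (mA : measurable A) (mB : measurable B).

Let mAB : measurable (A `*` B). Proof. exact: measurableX. Qed.

Let patch1 (F : T * T -> \bar R) x :
  (\int[mu]_y (F \_ (A `*` B)) (x, y) = ((fun x => \int[mu]_(y in B) F (x, y)) \_ A) x)%E.
Proof.
rewrite /patch; case: ifPn => [/set_mem Ax|nAx].
  rewrite [RHS]integral_mkcond; apply: eq_integral => y _; rewrite /patch.
  have [By|nBy] := pselect (B y); first by rewrite !mem_set.
  by rewrite !memNset// => -[].
rewrite integral0_eq// => y _; rewrite memNset// => -[Ax _].
by rewrite (mem_set Ax) in nAx.
Qed.

Let patch2 (F : T * T -> \bar R) y :
  (\int[mu]_x (F \_ (A `*` B)) (x, y) = ((fun y => \int[mu]_(x in A) F (x, y)) \_ B) y)%E.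
Proof.
rewrite /patch; case: ifPn => [/set_mem By|nBy].
  rewrite [RHS]integral_mkcond; apply: eq_integral => x _; rewrite /patch.
  have [Ax|nAx] := pselect (A x); first by rewrite !mem_set.
  by rewrite !memNset// => -[].
rewrite integral0_eq// => x _; rewrite memNset// => -[_ By].
by rewrite (mem_set By) in nBy.
Qed.

Lemma tonelli_setX1 (F : T * T -> \bar R) :
  measurable_fun (A `*` B) F -> (forall z, (0 <= F z)%E) ->
  (\int[mu \x mu]_(z in A `*` B) F z =
   \int[mu]_(x in A) \int[mu]_(y in B) F (x, y))%E.
Proof.
move=> mF F_ge0; rewrite integral_mkcond fubini_tonelli1; last 2 first.
- exact/(measurable_restrictT _ mAB).
- by move=> z; rewrite /patch; case: ifPn.
by rewrite [RHS]integral_mkcond; apply: eq_integral => x _; rewrite -patch1.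
Qed.

Lemma tonelli_setX2 (F : T * T -> \bar R) :
  measurable_fun (A `*` B) F -> (forall z, (0 <= F z)%E) ->
  (\int[mu \x mu]_(z in A `*` B) F z =
   \int[mu]_(y in B) \int[mu]_(x in A) F (x, y))%E.
Proof.
move=> mF F_ge0; rewrite integral_mkcond fubini_tonelli2; last 2 first.
- exact/(measurable_restrictT _ mAB).
- by move=> z; rewrite /patch; case: ifPn.
by rewrite [RHS]integral_mkcond; apply: eq_integral => x _; rewrite -patch2.
Qed.

Lemma measurable_tonelli_setX2 (F : T * T -> \bar R) :
  measurable_fun (A `*` B) F -> (forall z, (0 <= F z)%E) ->
  measurable_fun B (fun y => \int[mu]_(x in A) F (x, y))%E.
Proof.
move=> mF F_ge0; apply/(measurable_restrictT _ mB).
rewrite (_ : _ \_ B = fun y => \int[mu]_x (F \_ (A `*` B)) (x, y))%E; last first.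
  by apply/funext => y; rewrite patch2.
apply: measurable_fun_fubini_tonelli_G.
- exact/(measurable_restrictT _ mAB).
- by move=> z; rewrite /patch; case: ifPn.
Qed.

(** Integrability of [G] is not assumed: the integrals of the positive and negative parts are
    measurable by Tonelli, and the integral of a section is their difference even where they are
    infinite. *)
Lemma measurable_Rintegral2 (G : T * T -> R) :
  measurable_fun (A `*` B) G -> measurable_fun B (fun y => \int[mu]_(x in A) G (x, y)).
Proof.
move=> mG; apply: (measurableT_comp (f := fine)) => //.
have mG' : measurable_fun (A `*` B) (EFin \o G) by exact/measurable_EFinP.
have mp : measurable_fun (A `*` B) (EFin \o G)^\+%E by exact: measurable_funepos.
have mn : measurable_fun (A `*` B) (EFin \o G)^\-%E by exact: measurable_funeneg.
have H1 := measurable_tonelli_setX2 mp (fun z => funepos_ge0 _ z).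
have H2 := measurable_tonelli_setX2 mn (fun z => funeneg_ge0 _ z).
apply: eq_measurable_fun (emeasurable_funB H1 H2) => y _.
apply/esym; rewrite [LHS]integralE.
by congr (_ - _)%E; apply: eq_integral => x _; rewrite ?funeposE ?funenegE.
Qed.

Section integrable.
Context (G : T * T -> R).
Hypothesis iG : (mu \x mu)%E.-integrable (A `*` B) (EFin \o G).

Let iP : (mu \x mu)%E.-integrable setT ((EFin \o G) \_ (A `*` B)).
Proof. exact/(integrable_mkcond _ mAB). Qed.

Let integrable_G :
  mu.-integrable setT (fun y => \int[mu]_x ((EFin \o G) \_ (A `*` B)) (x, y))%E.
Proof.
have [mf _] := integrableP _ _ _ iP.
apply/integrableP; split; first exact: measurable_fubini_G iP.
have := (integrable21ltyP mu mu mf).1 iP; apply: le_lt_trans.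
apply: ge0_le_integral => //.
- by apply: measurableT_comp => //; exact: measurable_fubini_G iP.
- apply: (@measurable_fun_fubini_tonelli_G _ _ _ _ _ mu (abse \o ((EFin \o G) \_ (A `*` B)))).
    exact: measurableT_comp.
  by move=> z; exact: abse_ge0.
- move=> y _; apply: le_abse_integral => //.
  exact: (measurableT_comp mf (measurable_pair2 y)).
Qed.

Lemma integrable_section2 :
  {ae mu, forall y, B y -> mu.-integrable A (fun x => (G (x, y))%:E)}.
Proof.
apply: filterS (ae_integrable2 iP) => y H By.
apply/(integrable_mkcond _ mA); apply: eq_integrable H => // x _.
rewrite /patch; have [Ax|nAx] := pselect (A x); first by rewrite !mem_set.
by rewrite !memNset// => -[].
Qed.

Lemma integrable_integral2 :
  mu.-integrable B (fun y => \int[mu]_(x in A) (G (x, y))%:E)%E.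
Proof.
apply/(integrable_mkcond _ mB); apply: eq_integrable integrable_G => // y _.
Qed.

Lemma integrable_integral1 :
  mu.-integrable A (fun x => \int[mu]_(y in B) (G (x, y))%:E)%E.
Proof.
apply/(integrable_mkcond _ mA); apply: eq_integrable (integrable_fubini_F iP) => // y _.
exact: patch1.
Qed.

Lemma integrable_Rintegral2 :
  mu.-integrable B (EFin \o (fun y => \int[mu]_(x in A) G (x, y))).
Proof. exact: (integrable_fine mB integrable_integral2).1. Qed.

Lemma Rintegral_setX1 :
  \int[mu]_(x in A) \int[mu]_(y in B) G (x, y) = \int[(mu \x mu)%E]_(z in A `*` B) G z.
Proof.
rewrite /Rintegral (integrable_fine mA integrable_integral1).2; congr fine.
rewrite [RHS]integral_mkcond -(integral12_prod_meas1 iP) integral_mkcond.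
by apply: eq_integral => x _; rewrite -(patch1 (EFin \o G)) /=.
Qed.

Lemma Rintegral_setX2 :
  \int[mu]_(y in B) \int[mu]_(x in A) G (x, y) = \int[(mu \x mu)%E]_(z in A `*` B) G z.
Proof.
rewrite /Rintegral (integrable_fine mB integrable_integral2).2; congr fine.
rewrite [RHS]integral_mkcond -(integral21_prod_meas1 iP) integral_mkcond.
by apply: eq_integral => x _; rewrite -(patch2 (EFin \o G)) /=.
Qed.

End integrable.

End fubini_on_rectangles.

Lemma le_Rintegral_ae d (T : measurableType d) (R : realType)
    (mu : {measure set T -> \bar R}) (D : set T) (f g : T -> R) :
  measurable D -> mu.-integrable D (EFin \o f) -> mu.-integrable D (EFin \o g) ->
  {ae mu, forall x, D x -> f x <= g x} ->
  \int[mu]_(x in D) f x <= \int[mu]_(x in D) g x.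
Proof.
move=> mD i1 i2 uv.
rewrite -subr_ge0 -RintegralB// /Rintegral fine_ge0//.
have iB : mu.-integrable D (EFin \o (fun x => g x - f x)).
  by apply: eq_integrable (integrableB mD i2 i1) => // x _ /=; rewrite EFinB.
rewrite (_ : integral _ _ _ = \int[mu]_(x in D) `|g x - f x|%:E)%E.
  by apply: integral_ge0 => x _; rewrite lee_fin.
apply: ae_eq_integral => //.
- by have /integrableP[] := iB.
- apply/measurable_EFinP; apply: measurableT_comp => //.
  by have /integrableP[/measurable_EFinP] := iB.
apply: filterS uv => x H Dx; rewrite ger0_norm//.
by rewrite subr_ge0 H.
Qed.

(** * Extensions and the exterior part of the forms *)

Lemma measurable_sqrt_hkernel (R : realType) n (s : R) : measurable_fun setT
  (fun z : 'rV[R]_n * 'rV[R]_n => Num.sqrt (hkernel s z.1 z.2)).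
Proof.
rewrite (_ : (fun z => _) = (fun t : R => t `^ 2^-1) \o
    (fun z : 'rV[R]_n * 'rV[R]_n => hkernel s z.1 z.2)).
  apply: measurableT_comp; [exact: measurable_powR|exact: measurable_hkernel].
by apply/funext => z /=; rewrite powR12_sqrt// hkernel_ge0.
Qed.

Section extension.
Context (R : realType) (n : nat) (s : R) (Omega : set 'rV[R]_n).
Hypotheses (s_gt0 : 0 < s) (oO : open Omega) (bO : bounded_set Omega).
Implicit Types (u v w b kap : 'rV[R]_n -> R) (x y : 'rV[R]_n).

Local Notation mu := (@lebesgue_rV R n).
Local Notation X := (sqint mu Omega).
Local Notation dot := (rdot mu Omega).
Local Notation k := (hkernel s).

Let mO : measurable Omega. Proof. exact: open_measurable_rV. Qed.
Let mOc : measurable (~` Omega). Proof. exact: measurableC. Qed.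
Let mcl : measurable (closure Omega).
Proof. by apply: closed_measurable_rV; exact: closed_closure. Qed.

(* Absorbing the square root of the kernel in the functions turns all the
   integrals against the kernel into L2 products. *)
Definition weighted y u : 'rV[R]_n -> R := fun x => u x * Num.sqrt (k y x).
Local Notation rt := weighted.

(* [kroot] is set to 0 on the closure of Omega because the extensions vanish on
   the boundary; this makes the identities below uniform in y. *)
Definition kroot y : 'rV[R]_n -> R := fun x =>
  if y \in closure Omega then 0 else Num.sqrt (k y x).

(** The function U of the overview off the closure of Omega, and 0 on the closure. *)
Definition kmass u y := dot (rt y u) (kroot y).

Definition extend kap u y := if y \in Omega then u y else kap y * kmass u y.

(* The integral over x in Omega of the exterior part of the form at y, divided
   by C, once the contributions of [extend] and of the weight are combined. *)
Definition exterior_form kap u v y := dot (rt y u) (rt y v) - kap y * kmass u y * kmass v y.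

Lemma weightedL y c u v : rt y (c *: u + v) = c *: rt y u + rt y v.
Proof.
apply/funext => x; rewrite /weighted.
transitivity ((c * u x + v x) * Num.sqrt (k y x)); first by [].
by rewrite mulrDl -mulrA.
Qed.

Lemma weightedB y u v : rt y (u - v) = rt y u - rt y v.
Proof.
apply/funext => x; rewrite /weighted.
transitivity ((u x - v x) * Num.sqrt (k y x)); first by [].
by rewrite mulrBl.
Qed.

Lemma weighted0 y : rt y 0 = 0.
Proof. by apply/funext => x; exact: mul0r. Qed.

Let measurable_sqrt_k2 y : measurable_fun setT (fun x => Num.sqrt (k y x)).
Proof. exact: (measurableT_comp (measurable_sqrt_hkernel s) (measurable_pair1 y)). Qed.

Lemma measurable_weighted y u : measurable_fun Omega u -> measurable_fun Omega (rt y u).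
Proof.
move=> mu_; apply: measurable_funM => //.
by apply: measurable_funS (measurable_sqrt_k2 y).
Qed.

Lemma weighted_le y u v : measurable_fun Omega u -> X (rt y v) ->
  (forall x, Omega x -> `|u x| <= `|v x|) -> X (rt y u).
Proof.
move=> mu_ Xv uv; apply: (sqint_le mO _ Xv); first exact: measurable_weighted.
by move=> x Ox; rewrite !normrM ler_wpM2r//; exact: uv.
Qed.

Lemma sqint_weighted y u : X u -> ~ closure Omega y -> X (rt y u).
Proof.
move=> Xu ncl; have [c c_ge0 kc] := hkernel_bounded s_gt0 ncl.
apply: (sqint_le mO _ (sqintZ mO (Num.sqrt c) Xu)).
  exact: measurable_weighted Xu.1.
move=> x Ox; have -> : (Num.sqrt c *: u) x = Num.sqrt c * u x by [].
rewrite /weighted !normrM [leRHS]mulrC ler_wpM2l// !ger0_norm ?sqrtr_ge0//.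
by rewrite ler_wsqrtr// kc.
Qed.

Lemma sqint_kroot y : X (kroot y).
Proof.
have [cl|ncl] := pselect (closure Omega y).
  rewrite (_ : kroot y = 0); first exact: sqint0.
  by apply/funext => x; rewrite /kroot mem_set.
have Xc : X (cst 1).
  split; first exact: measurable_cst.
  rewrite (_ : _ \o _ = cst 1%E); last by apply/funext => x /=; rewrite expr1n.
  apply/integrableP; split; first exact: measurable_cst.
  rewrite (eq_integral (cst 1%E)); last by move=> x _; rewrite /= normr1.
  by rewrite integral_cst// mul1e bounded_lebesgue_rV.
rewrite (_ : kroot y = rt y (cst 1)); first exact: sqint_weighted.
by apply/funext => x; rewrite /kroot memNset// /weighted mul1r.
Qed.

(** * Sign properties of the exterior form at a fixed point y *)

Section pointwise.
Context (y : 'rV[R]_n).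
Local Notation e := (kroot y).
Local Notation F u := (X (rt y u)).

Lemma kmassL c u v : F u -> F v -> kmass (c *: u + v) y = c * kmass u y + kmass v y.
Proof.
move=> Fu Fv; rewrite /kmass weightedL ![dot _ e]rdotC rdotL//; exact: sqint_kroot.
Qed.

Lemma kmass_ge0 u : F u -> {ae mu, forall x, Omega x -> 0 <= u x} -> 0 <= kmass u y.
Proof.
move=> Fu u0; have X0 := sqint0 mu Omega.
rewrite -(rdot0r mu mO 0).
apply: (le_rdot mO) => //; first exact: sqint_kroot.
apply: filterS u0 => x H Ox; rewrite [leLHS]mul0r /weighted /kroot.
case: ifPn => _; first by rewrite mulr0.
by rewrite !mulr_ge0 ?sqrtr_ge0// H.
Qed.

(** Cauchy-Schwarz for u and for - u. This disposes of boundary points and of points where the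
    kernel mass is 0, at which the coefficients need not be ordered. *)
Lemma kmass0 u : F u -> dot e e = 0 -> kmass u y = 0.
Proof.
move=> Fu e0.
have Ne : rnorm mu Omega e = 0 by rewrite /rnorm e0 sqrtr0.
have H v : F v -> kmass v y <= 0.
  by move=> Fv; have := rdot_le mO Fv (sqint_kroot y); rewrite Ne mulr0.
apply/eqP; rewrite eq_le H//=.
have Fz : F 0 by rewrite weighted0; exact: sqint0.
have sqint_weightedN : F (- u) by rewrite -scaleN1r -[_ *: _]addr0 weightedL; exact: sqintL.
have := H _ sqint_weightedN; rewrite -scaleN1r -[_ *: _]addr0 kmassL//.
have -> : kmass 0 y = 0.
  by have := kmassL (-1) Fz Fz; rewrite scaler0 addr0; lra.
lra.
Qed.

Lemma exterior_formC kap u v : exterior_form kap u v y = exterior_form kap v u y.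
Proof. by rewrite /exterior_form rdotC; ring. Qed.

Lemma exterior_formL kap c u v w : F u -> F v -> F w ->
  exterior_form kap (c *: u + v) w y = c * exterior_form kap u w y + exterior_form kap v w y.
Proof.
by move=> Fu Fv Fw; rewrite /exterior_form kmassL// weightedL rdotC rdotL// !(rdotC _ _ (rt y w)); ring.
Qed.

(** Expanding the squared norm of weighted u - kap U e, where U = [kmass u y], shows that the form
    is at least kap U^2 (1 - kap |e|^2). *)
Lemma exterior_form_ge0 kap u : F u -> 0 <= kap y -> kap y * dot e e <= 1 -> 0 <= exterior_form kap u u y.
Proof.
move=> Fu k_ge0 ke.
have := rdot_ge0 mu Omega ((- (kap y * kmass u y)) *: e + rt y u).
rewrite rdot_sqrD//; last exact: sqint_kroot.
rewrite (rdotC _ _ e) -/(kmass u y) /exterior_form.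
have := mulr_ge0 (mulr_ge0 k_ge0 (sqr_ge0 (kmass u y))) (_ : 0 <= 1 - kap y * dot e e).
rewrite subr_ge0 => /(_ ke).
nra.
Qed.

Lemma exterior_formL2 kap c u v w : F u -> F v -> F w ->
  exterior_form kap w (c *: u + v) y = c * exterior_form kap w u y + exterior_form kap w v y.
Proof. by move=> Fu Fv Fw; rewrite !(exterior_formC kap w) exterior_formL. Qed.

Lemma exterior_form_sqrB kap u v : F u -> F v ->
  exterior_form kap (u - v) (u - v) y = exterior_form kap u u y - 2 * exterior_form kap u v y + exterior_form kap v v y.
Proof.
move=> Fu Fv; rewrite -scaleN1r [u + _]addrC.
have sqint_weightedB : F (-1 *: v + u) by rewrite weightedL; exact: sqintL.
by rewrite exterior_formL// !exterior_formL2// (exterior_formC kap v u); ring.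
Qed.

Lemma sqint_weightedD u v : F u -> F v -> F (u + v).
Proof. by move=> Fu Fv; rewrite -[u]scale1r weightedL; exact: sqintL. Qed.

Lemma exterior_form_sqrD kap u v : F u -> F v ->
  exterior_form kap (u + v) (u + v) y = exterior_form kap u u y + 2 * exterior_form kap u v y + exterior_form kap v v y.
Proof.
move=> Fu Fv.
have := exterior_formL kap 1 Fu Fv (sqint_weightedD Fu Fv); have := exterior_formL2 kap 1 Fu Fv Fu.
have := exterior_formL2 kap 1 Fu Fv Fv; rewrite scale1r (exterior_formC kap v u); lra.
Qed.

Lemma pos_partB u : u = pos_part u - pos_part (- u).
Proof.
apply/funext => x; transitivity (Num.max (u x) 0 - Num.max (- u x) 0); last by [].
by case: (leP (u x) 0) => u0; case: (leP (- u x) 0) => u1; lra.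
Qed.

Lemma sqint_weighted_pos_part u : measurable_fun Omega u -> F u -> F (pos_part u).
Proof.
move=> mu_ Fu; apply: (weighted_le _ Fu); first exact: measurable_pos_part.
by move=> x _; exact: pos_part_le_norm.
Qed.

Lemma sqint_weightedN u : F u -> F (- u).
Proof.
move=> Fu; rewrite -scaleN1r -[_ *: _]addr0 weightedL; apply: sqintL => //.
by rewrite weighted0; exact: sqint0.
Qed.

Lemma sqint_weightedB u v : F u -> F v -> F (u - v).
Proof. by move=> Fu Fv; rewrite weightedB; exact: sqintB. Qed.

Let ae_pos u : {ae mu, forall x, Omega x -> 0 <= pos_part u x}.
Proof. by apply: aeW => x _; exact: pos_part_ge0. Qed.

(** The two parts have disjoint supports, so the local product vanishes and only - kap U^+ U^-
    remains, U^+ and U^- being the [kmass] of the parts. *)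
Lemma exterior_form_pos_neg kap u : measurable_fun Omega u -> F u -> 0 <= kap y ->
  exterior_form kap (pos_part u) (pos_part (- u)) y <= 0.
Proof.
move=> mu_ Fu k_ge0; rewrite /exterior_form.
have mN : measurable_fun Omega (- u) by exact: measurable_funN.
have Fp := sqint_weighted_pos_part mu_ Fu; have Fm := sqint_weighted_pos_part mN (sqint_weightedN Fu).
have -> : dot (rt y (pos_part u)) (rt y (pos_part (- u))) = 0.
  rewrite /rdot (@eq_Rintegral _ _ _ _ _ (cst 0)) ?Rintegral_cst ?mul0r// => x _.
  rewrite /weighted mulrACA /pos_part.
  have -> : Num.max (u x) 0 * Num.max ((- u) x) 0 = 0.
    have -> : (- u) x = - u x by [].
    case: (leP (u x) 0) => u0; first by rewrite mul0r.
    by case: (leP (- u x) 0) => u1; rewrite ?mulr0//; lra.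
  by rewrite mul0r.
by rewrite sub0r oppr_le0 -mulrA !mulr_ge0// kmass_ge0.
Qed.

Lemma exterior_form_pos_part_ge0 kap u : measurable_fun Omega u -> F u ->
  0 <= kap y -> kap y * dot e e <= 1 -> 0 <= exterior_form kap u (pos_part u) y.
Proof.
move=> mu_ Fu k_ge0 ke.
have mN : measurable_fun Omega (- u) by exact: measurable_funN.
have Fp := sqint_weighted_pos_part mu_ Fu; have Fm := sqint_weighted_pos_part mN (sqint_weightedN Fu).
rewrite {1}[u]pos_partB [pos_part u - _]addrC -scaleN1r exterior_formL//.
have := exterior_form_pos_neg mu_ Fu k_ge0; have := exterior_form_ge0 Fp k_ge0 ke.
rewrite (exterior_formC _ (pos_part (- u))); lra.
Qed.

Lemma exterior_formN kap u v : F u -> F v -> exterior_form kap (- u) v y = - exterior_form kap u v y.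
Proof.
move=> Fu Fv; have Fz : F 0 by rewrite weighted0; exact: sqint0.
have := exterior_formL kap (-1) Fz Fz Fv; rewrite scaler0 addr0 => H0.
by have := exterior_formL kap (-1) Fu Fz Fv; rewrite addr0 scaleN1r; lra.
Qed.

(** With u = u^+ - u^-, the form at u exceeds the form at u^+ by its value at u^- minus twice the
    cross term, and the cross term is nonpositive. *)
Lemma exterior_form_pos_part_le kap u : measurable_fun Omega u -> F u ->
  0 <= kap y -> kap y * dot e e <= 1 ->
  exterior_form kap (pos_part u) (pos_part u) y <= exterior_form kap u u y.
Proof.
move=> mu_ Fu k_ge0 ke.
have mN : measurable_fun Omega (- u) by exact: measurable_funN.
have Fp := sqint_weighted_pos_part mu_ Fu; have Fm := sqint_weighted_pos_part mN (sqint_weightedN Fu).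
have -> : exterior_form kap u u y =
    exterior_form kap (pos_part u - pos_part (- u)) (pos_part u - pos_part (- u)) y.
  by rewrite -pos_partB.
rewrite exterior_form_sqrB//.
have := exterior_form_pos_neg mu_ Fu k_ge0; have := exterior_form_ge0 Fm k_ge0 ke; lra.
Qed.

Section comparison.
Context (kS kT : 'rV[R]_n -> R) (u w : 'rV[R]_n -> R).
Hypotheses (kS_ge0 : 0 <= kS y) (kT_ge0 : 0 <= kT y).
Hypotheses (kSe : kS y * dot e e <= 1) (kTe : kT y * dot e e <= 1).
Hypothesis kST : kS y <= kT y \/ dot e e = 0.
Hypotheses (mu_ : measurable_fun Omega u) (mw : measurable_fun Omega w).
Hypotheses (Fu : F u) (Fw : F w).
Hypotheses (u_ge0 : {ae mu, forall x, Omega x -> 0 <= u x}).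
Hypotheses (w_ge0 : {ae mu, forall x, Omega x -> 0 <= w x}).

Local Notation phi := (pos_part (u - w)).

Let Fp : F phi.
Proof. by apply: sqint_weighted_pos_part; [exact: measurable_funB|exact: sqint_weightedB]. Qed.

Let kST_ge0 v1 v2 : F v1 -> F v2 -> {ae mu, forall x, Omega x -> 0 <= v1 x} ->
  {ae mu, forall x, Omega x -> 0 <= v2 x} ->
  0 <= (kT y - kS y) * kmass v1 y * kmass v2 y.
Proof.
move=> F1 F2 v1_ge0 v2_ge0; case: kST => [kle|e0]; last by rewrite (kmass0 F2)// mulr0.
by rewrite !mulr_ge0 ?kmass_ge0// subr_ge0.
Qed.

Let exterior_form_diff v1 v2 : exterior_form kS v1 v2 y = exterior_form kT v1 v2 y + (kT y - kS y) * kmass v1 y * kmass v2 y.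
Proof. by rewrite /exterior_form; ring. Qed.

Let sqrB_le : exterior_form kT phi phi y <= 2 * exterior_form kT u u y + 2 * exterior_form kT w w y.
Proof.
have m1 := measurable_funB mu_ mw.
apply: (le_trans (exterior_form_pos_part_le m1 (sqint_weightedB Fu Fw) kT_ge0 kTe)).
rewrite exterior_form_sqrB//.
by have := exterior_form_ge0 (sqint_weightedD Fu Fw) kT_ge0 kTe; rewrite exterior_form_sqrD//; lra.
Qed.

(** Since u >= 0 and w >= 0, phi = (u - w)^+ satisfies 0 <= phi <= u, hence the same holds for the
    [kmass]. *)
Let kmass_phi_le : (kT y - kS y) * kmass phi y * kmass phi y <= (kT y - kS y) * kmass u y * kmass u y.
Proof.
case: kST => [kle|e0]; last by rewrite !(kmass0 _ e0)// !mulr0.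
have d_ge0 : 0 <= kT y - kS y by rewrite subr_ge0.
have p_ge0 : 0 <= kmass phi y by rewrite kmass_ge0.
suff le1 : kmass phi y <= kmass u y by rewrite -!mulrA ler_wpM2l// ler_pM.
have -> : kmass u y = kmass (u - phi) y + kmass phi y.
  have := kmassL 1 (sqint_weightedB Fu Fp) Fp.
  by rewrite scale1r mul1r subrK.
rewrite lerDr kmass_ge0//; first exact: sqint_weightedB.
apply: filterS2 u_ge0 w_ge0 => x ux wx Ox.
have -> : (u - phi) x = u x - Num.max (u x - w x) 0 by [].
by have := ux Ox; have := wx Ox; case: (leP (u x - w x) 0); lra.
Qed.

(** The value of the S-form at w must not appear on the right. At phi the S-form is the T-form plus
    (kT - kS) kmass(phi)^2; the T-form at phi is bounded through u - w and the parallelogram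
    inequality, the extra term by the one of u. *)
Lemma exterior_form_comparison_S : exterior_form kS phi phi y <= 3 * exterior_form kS u u y + 2 * exterior_form kT w w y.
Proof.
have := exterior_form_diff u u; have := exterior_form_ge0 Fu kT_ge0 kTe.
have := kST_ge0 Fu Fu u_ge0 u_ge0.
have := sqrB_le; have := kmass_phi_le; rewrite (exterior_form_diff phi phi); lra.
Qed.

Lemma exterior_form_comparison_T : exterior_form kT phi phi y <= 3 * exterior_form kS u u y + 2 * exterior_form kT w w y.
Proof.
have := exterior_form_diff u u; have := exterior_form_ge0 Fu kT_ge0 kTe.
have := kST_ge0 Fu Fu u_ge0 u_ge0; have := sqrB_le; lra.
Qed.

(** The right side minus the left is the T-form of u - w against its positive part, plus (kT - kS)
    kmass(u) kmass(phi); both are nonnegative. *)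
Lemma exterior_form_comparison : exterior_form kT w phi y <= exterior_form kS u phi y.
Proof.
have m1 := measurable_funB mu_ mw.
have := exterior_form_pos_part_ge0 m1 (sqint_weightedB Fu Fw) kT_ge0 kTe.
have := exterior_formL kT (-1) Fw Fu Fp; rewrite scaleN1r [- w + u]addrC (exterior_form_diff u phi).
have := kST_ge0 Fu Fp u_ge0 (ae_pos _); lra.
Qed.

End comparison.

End pointwise.

End extension.

Lemma sqint_lty d (T : measurableType d) (R : realType)
    (mu : {measure set T -> \bar R}) (D : set T) (f : T -> R) :
  measurable D -> measurable_fun D f ->
  (\int[mu]_(x in D) (f x ^+ 2)%:E < +oo)%E -> sqint mu D f.
Proof.
move=> mD mf fD; split => //; apply/integrableP; split.
  by apply/measurable_EFinP; exact: measurable_funX.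
by under eq_integral do rewrite /= ger0_norm ?sqr_ge0//.
Qed.

Lemma sqint_eq d (T : measurableType d) (R : realType)
    (mu : {measure set T -> \bar R}) (D : set T) (f g : T -> R) :
  measurable D -> (forall x, D x -> f x = g x) -> sqint mu D f -> sqint mu D g.
Proof.
move=> mD fg [mf fi]; split.
  by apply: eq_measurable_fun mf => x /set_mem /fg.
by apply: eq_integrable fi => // x /set_mem /fg /= ->.
Qed.

(** * Finite energy of an extension in terms of the exterior form *)

Section form.
Context (R : realType) (n : nat) (s : R) (Omega : set 'rV[R]_n).
Hypotheses (s_gt0 : 0 < s) (oO : open Omega) (bO : bounded_set Omega).
Implicit Types (u v w b kap : 'rV[R]_n -> R) (x y : 'rV[R]_n).

Local Notation mu := (@lebesgue_rV R n).
Local Notation mu2 := (mu \x mu)%E.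
Local Notation X := (sqint mu Omega).
Local Notation dot := (rdot mu Omega).
Local Notation k := (hkernel s).
Local Notation C := (Cns n s).
Local Notation rt := (weighted s).
Local Notation kroot := (kroot s Omega).
Local Notation kmass := (kmass s Omega).
Local Notation extend := (extend s Omega).
Local Notation exterior_form := (exterior_form s Omega).

Let mO : measurable Omega. Proof. exact: open_measurable_rV. Qed.
Let mOc : measurable (~` Omega). Proof. exact: measurableC. Qed.
Let mcl : measurable (closure Omega).
Proof. by apply: closed_measurable_rV; exact: closed_closure. Qed.
Let mOO : measurable (Omega `*` Omega). Proof. exact: measurableX. Qed.
Let mOOc : measurable (Omega `*` ~` Omega). Proof. exact: measurableX. Qed.

(** Its square is the integrand of the Gagliardo seminorm, so that energies become L2 products on
    rectangles. *)
Definition wdiff U (z : 'rV[R]_n * 'rV[R]_n) : R :=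
  (U z.1 - U z.2) * Num.sqrt (k z.1 z.2).

Let wdiffZ U z : (wdiff U z ^+ 2)%:E = (`|U z.1 - U z.2| ^+ 2 * k z.1 z.2)%:E.
Proof. by rewrite exprMn sqr_sqrtr ?hkernel_ge0// real_normK ?num_real. Qed.

Let wdiff_sym U x y : wdiff U (x, y) ^+ 2 = wdiff U (y, x) ^+ 2.
Proof.
have -> : wdiff U (x, y) = - wdiff U (y, x); last by rewrite sqrrN.
by rewrite /wdiff [(x, y).1]/= [(x, y).2]/= [(y, x).1]/= [(y, x).2]/= hkernelC -mulNr opprB.
Qed.

Lemma measurable_wdiff U (A : set 'rV[R]_n) : measurable A -> measurable_fun A U ->
  measurable_fun (A `*` A) (wdiff U).
Proof.
move=> mA mU; apply: measurable_funM.
  apply: measurable_funB.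
  - apply: (@measurable_comp _ _ _ _ _ _ A U _ fst) => //.
    + by move=> _ [[x y] [Ax Ay] <-].
    + by apply: measurable_funS measurable_fst.
  - apply: (@measurable_comp _ _ _ _ _ _ A U _ snd) => //.
    + by move=> _ [[x y] [Ax Ay] <-].
    + by apply: measurable_funS measurable_snd.
by apply: measurable_funS (measurable_sqrt_hkernel s).
Qed.

(** The double integral runs over three rectangles; the one over complement x Omega is the mirror
    image of the one over Omega x complement, since the integrand is symmetric. *)
Lemma WspaceP b U : measurable_fun (~` Omega) b ->
  Wspace s Omega b U <-> [/\ measurable_fun setT U, X U,
    sqint mu (~` Omega) (fun x => U x * Num.sqrt `|b x|),
    sqint mu2 (Omega `*` Omega) (wdiff U) & sqint mu2 (Omega `*` ~` Omega) (wdiff U)].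
Proof.
move=> mb; rewrite /Wspace /=.
pose f z := (wdiff U z ^+ 2)%:E.
have f_ge0 z : (0 <= f z)%E by rewrite lee_fin sqr_ge0.
have E1 : (\int[mu]_(x in Omega) (`|U x| ^+ 2)%:E = \int[mu]_(x in Omega) (U x ^+ 2)%:E)%E.
  by apply: eq_integral => x _; rewrite real_normK ?num_real.
have E2 : (\int[mu]_(x in ~` Omega) (`|U x| ^+ 2 * `|b x|)%:E =
    \int[mu]_(x in ~` Omega) ((U x * Num.sqrt `|b x|) ^+ 2)%:E)%E.
  by apply: eq_integral => x _; rewrite exprMn sqr_sqrtr// real_normK ?num_real.
have E3 A : (\int[mu2]_(z in A) (`|U z.1 - U z.2| ^+ 2 * k z.1 z.2)%:E =
    \int[mu2]_(z in A) f z)%E by apply: eq_integral => z _; rewrite -wdiffZ.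
rewrite E1 E2 E3; set D := ~` (~` Omega `*` ~` Omega).
have DE : D = (Omega `*` Omega) `|` (Omega `*` ~` Omega) `|` (~` Omega `*` Omega).
  apply/seteqP; split => [[x y]|[x y]] /=.
    move=> /not_andP[/contrapT Ox|/contrapT Oy].
      by have [Oy|nOy] := pselect (Omega y); left; [left|right].
    by have [Ox|nOx] := pselect (Omega x); [left; left|right].
  by move=> [[[? ?]|[? ?]]|[? ?]] [].
have mD : measurable D by apply: measurableC; exact: measurableX.
have mOcO : measurable (~` Omega `*` Omega) by exact: measurableX.
have I1 : (0 <= \int[mu]_(x in Omega) (U x ^+ 2)%:E)%E.
  by apply: integral_ge0 => x _; rewrite lee_fin sqr_ge0.
have I2 : (0 <= \int[mu]_(x in ~` Omega) ((U x * Num.sqrt `|b x|) ^+ 2)%:E)%E.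
  by apply: integral_ge0 => x _; rewrite lee_fin sqr_ge0.
have I3 : (0 <= \int[mu2]_(z in D) f z)%E by exact: integral_ge0.
have mfU A : measurable A -> measurable_fun setT U -> measurable_fun A U.
  by move=> mA mU; apply: measurable_funS mU.
have mDq A : measurable A -> measurable_fun setT U -> measurable_fun A (wdiff U).
  move=> mA mU; apply: (@measurable_funS _ _ _ _ setT) => //.
  by have := measurable_wdiff measurableT mU; rewrite setXTT.
have mfA A : measurable A -> measurable_fun setT U -> measurable_fun A f.
  move=> mA mU; apply/measurable_EFinP; apply: measurable_funX; exact: mDq.
have mUb : measurable_fun setT U ->
    measurable_fun (~` Omega) (fun x => U x * Num.sqrt `|b x|).
  move=> mU; apply: measurable_funM; first exact: mfU.
  rewrite (_ : (fun x => _) = (fun t : R => t `^ 2^-1) \o (fun x => `|b x|)).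
    apply: measurableT_comp; first exact: measurable_powR.
    exact: measurableT_comp.
  by apply/funext => x /=; rewrite powR12_sqrt.
split=> [[mU]|[mU [_ XU] [_ XUb] [_ XOO] [_ XOOc]]].
  move=> fin3.
  have fin1 : (\int[mu]_(x in Omega) (U x ^+ 2)%:E < +oo)%E.
    by apply: le_lt_trans fin3; rewrite -addeA leeDl// adde_ge0.
  have fin2 : (\int[mu]_(x in ~` Omega) ((U x * Num.sqrt `|b x|) ^+ 2)%:E < +oo)%E.
    by apply: le_lt_trans fin3; rewrite -addeA addeCA leeDl// adde_ge0.
  have finD : (\int[mu2]_(z in D) f z < +oo)%E.
    by apply: le_lt_trans fin3; rewrite leeDr// adde_ge0.
  have finS A : measurable A -> A `<=` D -> (\int[mu2]_(z in A) f z < +oo)%E.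
    move=> mA AD; apply: le_lt_trans finD; apply: ge0_subset_integral => //.
    exact: mfA.
  split => //.
  - by apply: sqint_lty => //; exact: mfU.
  - by apply: sqint_lty => //; exact: mUb.
  - apply: sqint_lty => //; first exact: mDq.
    by apply: finS => //; rewrite DE => z ?; left; left.
  - apply: sqint_lty => //; first exact: mDq.
    by apply: finS => //; rewrite DE => z ?; left; right.
split => //.
have l1 := integrable_lty mO XU; have l2 := integrable_lty mOc XUb.
have l3 := integrable_lty mOO XOO; have l4 := integrable_lty mOOc XOOc.
apply: lte_add_pinfty; first exact: lte_add_pinfty.
rewrite DE ge0_integral_setU//; last 3 first.
- exact: measurableU.
- by rewrite -DE; exact: mfA.
- rewrite disj_set2E; apply/eqP/seteqP; split => // -[x y] /=.
  by move=> [[[? ?]|[? ?]] []].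
rewrite ge0_integral_setU//; last 2 first.
- by apply: mfA => //; exact: measurableU.
- rewrite disj_set2E; apply/eqP/seteqP; split => // -[x y] /=.
  by move=> [[? ?] []].
apply: lte_add_pinfty; first exact: lte_add_pinfty.
have -> : (\int[mu2]_(z in ~` Omega `*` Omega) f z =
    \int[mu2]_(z in Omega `*` ~` Omega) f z)%E; last by [].
have T1 := tonelli_setX1 mu mOc mO (mfA _ mOcO mU) f_ge0.
have T2 := tonelli_setX2 mu mO mOc (mfA _ mOOc mU) f_ge0.
rewrite [LHS]T1 [RHS]T2.
apply: eq_integral => y _; apply: eq_integral => x _.
exact: (congr1 EFin (wdiff_sym U y x)).
Qed.


(** Equal to [rho] off the closure of Omega, and 0 on it. *)
Definition kroot_mass y := dot (kroot y) (kroot y).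

Lemma kmass_closure u y : closure Omega y -> kmass u y = 0.
Proof.
move=> cl; rewrite /kmass (_ : kroot y = 0); last by apply/funext => x; rewrite /kroot mem_set.
exact: (rdot0r mu mO).
Qed.

Lemma wdiff_ext_section kap u x y : Omega x -> ~ Omega y ->
  wdiff (extend kap u) (x, y) = (rt y u - (kap y * kmass u y) *: kroot y) x.
Proof.
move=> Ox nOy.
transitivity (u x * Num.sqrt (k y x) - kap y * kmass u y * kroot y x); last by [].
rewrite /wdiff /extend [(x, y).1]/= [(x, y).2]/= mem_set// memNset// hkernelC mulrBl.
congr (_ - _); have [cl|ncl] := pselect (closure Omega y).
  by rewrite kmass_closure// mulr0 !mul0r.
by rewrite /kroot memNset.
Qed.

(** The remainder is what the weight compensates: by admissibility, C kap (1 - kap kroot_mass)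
    kmass(u) kmass(v) is b times the product of the two extensions at y, off the closure. *)
Lemma dot_ext_section kap u v y : ~ Omega y -> X (rt y u) -> X (rt y v) ->
  \int[mu]_(x in Omega) (wdiff (extend kap u) (x, y) * wdiff (extend kap v) (x, y)) =
  exterior_form kap u v y - kap y * (1 - kap y * kroot_mass y) * kmass u y * kmass v y.
Proof.
move=> nOy Xu Xv; have Xe := sqint_kroot s_gt0 oO bO y.
transitivity (dot (rt y u - (kap y * kmass u y) *: kroot y)
   (rt y v - (kap y * kmass v y) *: kroot y)).
  by apply: eq_Rintegral => x /set_mem Ox; rewrite !wdiff_ext_section.
have E : dot (rt y u - (kap y * kmass u y) *: kroot y) (rt y v - (kap y * kmass v y) *: kroot y) =
    dot (rt y u) (rt y v) - kap y * kmass v y * kmass u y - kap y * kmass u y * kmass v y +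
    (kap y * kmass u y) * (kap y * kmass v y) * kroot_mass y.
  rewrite /kroot_mass.
  move: (kap y * kmass u y) (kap y * kmass v y) => a a'.
  rewrite -[- (a *: _)]scaleNr [rt y u + _]addrC -[- (a' *: _)]scaleNr [rt y v + _]addrC.
  have X1 := sqintL mO (- a) Xe Xu.
  rewrite rdotL// !(rdotC _ _ (_ + _)) !rdotL//.
  rewrite ?(rdotC _ _ (kroot y) (rt y u)) ?(rdotC _ _ (kroot y) (rt y v)) ?(rdotC _ _ (rt y v) (rt y u)).
  by rewrite /kmass; ring.
by rewrite E /exterior_form; ring.
Qed.

Lemma measurable_extend kap u : measurable_fun (~` Omega) kap -> measurable_fun Omega u ->
  measurable_fun setT (extend kap u).
Proof.
move=> mk mu_; rewrite -(setUv Omega); apply/measurable_funU => //; split.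
  by apply: eq_measurable_fun mu_ => y Oy; rewrite /extend Oy.
have mU : measurable_fun (~` Omega) (kmass u).
  rewrite /kmass /rdot.
  apply: (measurable_Rintegral2 mu mO mOc
    (G := fun z => rt z.2 u z.1 * kroot z.2 z.1)).
  have msk : measurable_fun (Omega `*` ~` Omega)
      (fun z : 'rV[R]_n * 'rV[R]_n => Num.sqrt (k z.2 z.1)).
    under eq_fun do rewrite hkernelC.
    by apply: measurable_funS (measurable_sqrt_hkernel s).
  apply: measurable_funM.
    apply: measurable_funM => //.
    apply: (@measurable_comp _ _ _ _ _ _ Omega u _ fst) => //.
    + by move=> _ [[x y] [Ax Ay] <-].
    + by apply: measurable_funS measurable_fst.
  rewrite /kroot; apply: measurable_fun_if => //.
  - apply: (@measurable_comp _ _ _ _ _ _ setT (fun y => y \in closure Omega) _ snd) => //.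
    + apply: (measurable_fun_bool true).
      rewrite setTI (_ : _ @^-1` _ = closure Omega)//.
      by apply/seteqP; split => y /=; [move=> /set_mem|move=> /mem_set].
    + by apply: measurable_funS measurable_snd.
  - by apply: measurable_funS msk => // z [].
apply: eq_measurable_fun (measurable_funM mk mU) => y.
by rewrite in_setC /extend => /negbTE ->.
Qed.

(* The three forms are the cases (kap, b) = (0, 0), (C / (C rho + beta), beta)
   and (1 / rho, 0).  The bound by [c], which is 1 / C in the second case,
   recovers the seminorm of [Wspace] from the form; if C = 0 then [kap = 0] there,
   so that the junk value 1 / 0 = 0 is harmless. *)
Record admissible (c : R) kap b : Prop := {
  adm_mkap : measurable_fun (~` Omega) kap ;
  adm_mb : measurable_fun (~` Omega) b ;
  adm_c : 0 <= c ;
  adm_ae : {ae mu, forall y, ~ Omega y ->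
    [/\ 0 <= kap y, kap y * kroot_mass y <= 1, 0 <= b y &
      ~ closure Omega y ->
        C * (kap y * (1 - kap y * kroot_mass y)) = b y * kap y ^+ 2 /\
        kap y * (1 - kap y * kroot_mass y) <= c * (b y * kap y ^+ 2)]} }.

(** The extension itself is eliminated. An integrable majorant [H] stands for integrability of the
    exterior form in y: it passes directly through pointwise inequalities, without a measurability
    argument at each use. *)
Definition form_domain kap u :=
  [/\ X u, sqint mu2 (Omega `*` Omega) (wdiff u) &
    exists2 H : 'rV[R]_n -> R, mu.-integrable (~` Omega) (EFin \o H) &
      {ae mu, forall y, ~ Omega y -> X (rt y u) /\ exterior_form kap u u y <= H y}].

Lemma Wspace_ext_form_domain c kap b u : admissible c kap b -> X u ->
  Wspace s Omega b (extend kap u) -> form_domain kap u.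
Proof.
move=> [mkap mb c_ge0 adm] Xu /(WspaceP _ mb)[mU XU XUb XOO XOOc].
set U := extend kap u in mU XU XUb XOO XOOc.
have iG := XOOc.2.
split => //.
  apply: sqint_eq XOO => // -[x y] [/= Ox Oy].
  by rewrite /wdiff /U /extend [(x, y).1]/= [(x, y).2]/= !mem_set.
(* The exterior form exceeds the section integral by kap (1 - kap kroot_mass) kmass^2, which [c]
   times the weight term dominates. *)
exists (fun y => \int[mu]_(x in Omega) (wdiff U (x, y) ^+ 2) + c * (U y * Num.sqrt `|b y|) ^+ 2).
  have i1 := integrable_Rintegral2 mO mOc iG.
  have i2 := integrableZl mOc c XUb.2.
  by apply: eq_integrable (integrableD mOc i1 i2).
apply: filterS2 adm (integrable_section2 mO mOc iG) => y Hy iy nOy.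
have [k_ge0 ke b_ge0 kb] := Hy nOy.
have Xe := sqint_kroot s_gt0 oO bO y.
(* The section of [wdiff U] is square integrable for almost every y; adding back a multiple of
   [kroot y] recovers the weighted function. *)
have Xru : X (rt y u).
  have : X (rt y u - (kap y * kmass u y) *: kroot y).
    split.
      apply: measurable_funB; first exact: (measurable_weighted s y Xu.1).
      by apply: measurable_funM => //; exact: Xe.1.
    apply: eq_integrable (iy nOy) => // x /set_mem Ox.
    by rewrite /= wdiff_ext_section.
  move=> /(sqintD mO) /(_ (sqintZ mO (kap y * kmass u y) Xe)).
  by rewrite subrK.
split => //.
rewrite (_ : \int[mu]_(x in Omega) (wdiff U (x, y) ^+ 2) =
  \int[mu]_(x in Omega) (wdiff U (x, y) * wdiff U (x, y))); last first.
  by apply: eq_Rintegral => x _; rewrite expr2.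
rewrite dot_ext_section// exprMn sqr_sqrtr// (ger0_norm b_ge0).
have -> : U y = kap y * kmass u y by rewrite /U /extend memNset.
rewrite -mulrA -expr2 exprMn.
have [cl|ncl] := pselect (closure Omega y).
  by rewrite kmass_closure// expr0n /= !(mulr0, mul0r) subr0 addr0.
have [_] := kb ncl; rewrite -subr_ge0 => /mulr_ge0/(_ (sqr_ge0 (kmass u y))).
lra.
Qed.

(** For almost every y the section integral and kap (1 - kap kroot_mass) kmass^2 are nonnegative and
    sum to the exterior form, so [H] dominates each. C times the second is the weight term. *)
Lemma form_domain_Wspace_ext c kap b u : 0 <= C -> admissible c kap b ->
  form_domain kap u -> Wspace s Omega b (extend kap u).
Proof.
move=> C_ge0 [mkap mb c_ge0 adm] [Xu XOO [H iH uH]].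
have mU := measurable_extend mkap Xu.1.
set U := extend kap u in mU *.
apply/(WspaceP _ mb).
have iaH : mu.-integrable (~` Omega) (fun y => `|H y|%:E) by exact: integrable_abse iH.
have laH := integrable_lty mOc iaH.
have mabsH : measurable_fun (~` Omega) (fun y => `|H y|%:E) by have /integrableP[] := iaH.
have mDqU : measurable_fun (Omega `*` ~` Omega) (wdiff U).
  have := measurable_wdiff measurableT mU; rewrite setXTT.
  by apply: measurable_funS.
split => //.
- by apply: sqint_eq Xu => // x Ox; rewrite /U /extend mem_set.
- have mUb : measurable_fun (~` Omega) (fun x => U x * Num.sqrt `|b x|).
    apply: measurable_funM; first by apply: measurable_funS mU.
    rewrite (_ : (fun x => _) = (fun t : R => t `^ 2^-1) \o (fun x => `|b x|)).
      apply: measurableT_comp; first exact: measurable_powR.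
      exact: measurableT_comp.
    by apply/funext => x /=; rewrite powR12_sqrt.
  apply: sqint_lty => //.
  apply: (@le_lt_trans _ _ (\int[mu]_(y in ~` Omega) (C%:E * `|H y|%:E)))%E.
    apply: ae_ge0_le_integral => //.
    + by move=> x _; rewrite lee_fin sqr_ge0.
    + by apply/measurable_EFinP; exact: measurable_funX.
    + by move=> x _; rewrite mule_ge0// lee_fin.
    + exact: measurable_funeM.
    apply: filterS2 adm uH => y Hy uHy nOy.
    have [k_ge0 ke b_ge0 kb] := Hy nOy; have [Xru BH] := uHy nOy.
    rewrite -EFinM lee_fin exprMn sqr_sqrtr// (ger0_norm b_ge0).
    have -> : U y = kap y * kmass u y by rewrite /U /extend memNset.
    apply: (@le_trans _ _ (C * exterior_form kap u u y)); last first.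
      by rewrite ler_wpM2l// (le_trans BH)// ler_norm.
    have [cl|ncl] := pselect (closure Omega y).
      by rewrite kmass_closure// mulr0 expr0n /= mul0r mulr_ge0// (exterior_form_ge0 s_gt0 oO bO).
    have [E _] := kb ncl.
    have -> : (kap y * kmass u y) ^+ 2 * b y = C * (kap y * (1 - kap y * kroot_mass y) * kmass u y ^+ 2).
      by rewrite !mulrA -(mulrA C) E exprMn; ring.
    rewrite ler_wpM2l//.
    have := dot_ext_section kap nOy Xru Xru => /esym/eqP.
    rewrite subr_eq => /eqP ->; rewrite expr2 [leLHS]mulrA lerDr.
    by apply: Rintegral_ge0 => x _; rewrite -expr2 sqr_ge0.
  rewrite ge0_integralZl// ?lee_fin//.
  by apply: lte_mul_pinfty; rewrite ?lee_fin// ?fin_num_fun.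
- by apply: sqint_eq XOO => // -[x y] [/= Ox Oy]; rewrite /wdiff /U /extend [(x, y).1]/= [(x, y).2]/= !mem_set.
- apply: sqint_lty => //.
  have mDq2 : measurable_fun (Omega `*` ~` Omega) (fun z => (wdiff U z ^+ 2)%:E).
    by apply/measurable_EFinP; exact: measurable_funX.
  have wdiff2_ge0 z : (0 <= (wdiff U z ^+ 2)%:E)%E by rewrite lee_fin sqr_ge0.
  rewrite (tonelli_setX2 mu mO mOc mDq2 wdiff2_ge0).
  apply: le_lt_trans laH; apply: ae_ge0_le_integral => //.
  + by move=> y _; apply: integral_ge0.
  + exact: (measurable_tonelli_setX2 mu mO mOc mDq2 wdiff2_ge0).
  apply: filterS2 adm uH => y Hy uHy nOy.
  have [k_ge0 ke b_ge0 kb] := Hy nOy; have [Xru BH] := uHy nOy.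
  have Xe := sqint_kroot s_gt0 oO bO y.
  have Xs : X (rt y u - (kap y * kmass u y) *: kroot y).
    by apply: sqintB => //; exact: sqintZ.
  have -> : (\int[mu]_(x in Omega) (wdiff U (x, y) ^+ 2)%:E =
      (\int[mu]_(x in Omega) (wdiff U (x, y) * wdiff U (x, y)))%:E)%E.
    rewrite EFin_Rintegral//.
    apply: eq_integrable (sqint_mul mO Xs Xs) => // x /set_mem Ox.
    by rewrite /= wdiff_ext_section.
  rewrite dot_ext_section// lee_fin (le_trans _ (ler_norm _))// (le_trans _ BH)//.
  rewrite gerBl -mulrA -expr2 mulr_ge0 ?sqr_ge0// mulr_ge0// subr_ge0//.
Qed.

End form.

(** * Beurling-Deny and domination inequalities for the forms *)

Section form_inequalities.
Context (R : realType) (n : nat) (s : R) (Omega : set 'rV[R]_n).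
Hypotheses (s_gt0 : 0 < s) (oO : open Omega) (bO : bounded_set Omega).
Hypothesis C_ge0 : 0 <= Cns n s.
Implicit Types (u v w b kap : 'rV[R]_n -> R) (x y : 'rV[R]_n).

Local Notation mu := (@lebesgue_rV R n).
Local Notation mu2 := (mu \x mu)%E.
Local Notation X := (sqint mu Omega).
Local Notation dot := (rdot mu Omega).
Local Notation k := (hkernel s).
Local Notation C := (Cns n s).
Local Notation rt := (weighted s).
Local Notation kroot := (kroot s Omega).
Local Notation kmass := (kmass s Omega).
Local Notation extend := (extend s Omega).
Local Notation exterior_form := (exterior_form s Omega).
Local Notation kroot_mass := (kroot_mass s Omega).
Local Notation wdiff := (wdiff s).
Local Notation adm := (admissible s Omega).
Local Notation dom := (form_domain s Omega).

Let mO : measurable Omega. Proof. exact: open_measurable_rV. Qed.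
Let mOc : measurable (~` Omega). Proof. exact: measurableC. Qed.
Let mOO : measurable (Omega `*` Omega). Proof. exact: measurableX. Qed.
Let mOOc : measurable (Omega `*` ~` Omega). Proof. exact: measurableX. Qed.

Definition ext_form kap b u v : R :=
  energy s Omega (extend kap u) (extend kap v) +
  \int[mu]_(x in ~` Omega) (b x * extend kap u x * extend kap v x).

Lemma wdiff_ext_inside kap u z : (Omega `*` Omega) z -> wdiff (extend kap u) z = wdiff u z.
Proof. by move=> [Ox Oy]; rewrite /wdiff /extend !mem_set. Qed.

Lemma wdiff_mul U V x y :
  (U x - U y) * (V x - V y) * k x y = wdiff U (x, y) * wdiff V (x, y).
Proof.
rewrite /wdiff [(x, y).1]/= [(x, y).2]/= mulrACA -expr2 sqr_sqrtr//.
exact: hkernel_ge0.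
Qed.

(** [K] is an integrable representative of C times the exterior form: the section integrals,
    obtained by exchanging the order of integration, plus the weight term. *)
Lemma ext_form_expand c kap b u v : adm c kap b -> dom kap u -> dom kap v ->
  exists K : 'rV[R]_n -> R, [/\ mu.-integrable (~` Omega) (EFin \o K),
    {ae mu, forall y, ~ Omega y -> K y = C * exterior_form kap u v y} &
    ext_form kap b u v =
      C / 2 * rdot mu2 (Omega `*` Omega) (wdiff u) (wdiff v) +
      \int[mu]_(y in ~` Omega) K y].
Proof.
move=> ad du dv.
have Wu := form_domain_Wspace_ext s_gt0 oO bO C_ge0 ad du.
have Wv := form_domain_Wspace_ext s_gt0 oO bO C_ge0 ad dv.
have [mkap mb c_ge0 adae] := ad.
have [mU XU XUb XUOO XUOc] := (WspaceP s oO _ mb).1 Wu.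
have [mV XV XVb XVOO XVOc] := (WspaceP s oO _ mb).1 Wv.
have [Xu uOO [Hu iHu uHu]] := du; have [Xv vOO [Hv iHv vHv]] := dv.
pose U := extend kap u; pose V := extend kap v.
have iOO := sqint_mul mOO XUOO XVOO; have iOc := sqint_mul mOOc XUOc XVOc.
have ib := sqint_mul mOc XUb XVb.
have ibUV : mu.-integrable (~` Omega) (EFin \o (fun x => b x * U x * V x)).
  apply: le_integrable ib => //.
    apply/measurable_EFinP; apply: measurable_funM; last exact: measurable_funS mV.
    by apply: measurable_funM => //; exact: measurable_funS mU.
  move=> x _; rewrite /= lee_fin mulrACA -expr2 sqr_sqrtr//.
  by rewrite !normrM normr_id [leRHS]mulrC mulrA.
pose G y := \int[mu]_(x in Omega) (wdiff U (x, y) * wdiff V (x, y)).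
have iG : mu.-integrable (~` Omega) (EFin \o G) by exact: integrable_Rintegral2 iOc.
have iCG := integrableZl mOc C iG.
exists (fun y => C * G y + b y * U y * V y); split.
- exact: eq_integrable (integrableD mOc iCG ibUV).
- apply: filterS3 adae uHu vHv => y Hy uy vy nOy.
  have [k_ge0 ke b_ge0 kb] := Hy nOy; have [Xru _] := uy nOy; have [Xrv _] := vy nOy.
  rewrite /G dot_ext_section// /U /V /extend memNset//.
  have [cl|ncl] := pselect (closure Omega y).
    by rewrite !kmass_closure//; ring.
  have [E _] := kb ncl.
  have -> : b y * (kap y * kmass u y) * (kap y * kmass v y) =
    b y * kap y ^+ 2 * kmass u y * kmass v y by ring.
  by rewrite -E; ring.
rewrite /ext_form /energy -/U -/V.
have -> : \int[mu]_(x in Omega) \int[mu]_(y in Omega)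
     ((U x - U y) * (V x - V y) * k x y) = rdot mu2 (Omega `*` Omega) (wdiff u) (wdiff v).
  transitivity (\int[mu]_(x in Omega) \int[mu]_(y in Omega) (wdiff U (x, y) * wdiff V (x, y))).
    by apply: eq_Rintegral => x _; apply: eq_Rintegral => y _; rewrite wdiff_mul.
  rewrite (Rintegral_setX1 mO mO iOO); apply: eq_Rintegral => z /set_mem Oz.
  by rewrite !wdiff_ext_inside.
have -> : \int[mu]_(x in Omega) \int[mu]_(y in ~` Omega)
     ((U x - U y) * (V x - V y) * k x y) = \int[mu]_(y in ~` Omega) G y.
  transitivity (\int[mu]_(x in Omega) \int[mu]_(y in ~` Omega) (wdiff U (x, y) * wdiff V (x, y))).
    by apply: eq_Rintegral => x _; apply: eq_Rintegral => y _; rewrite wdiff_mul.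
  by rewrite (Rintegral_setX1 mO mOc iOc) -(Rintegral_setX2 mO mOc iOc).
rewrite -addrA; congr (_ + _).
rewrite -RintegralZl//; rewrite RintegralD//.
Qed.

Lemma sqint_wdiff_pos_part u : X u -> sqint mu2 (Omega `*` Omega) (wdiff u) ->
  sqint mu2 (Omega `*` Omega) (wdiff (pos_part u)).
Proof.
move=> Xu uOO; apply: (sqint_le mOO _ uOO).
  apply: (measurable_wdiff s mO); exact: measurable_pos_part Xu.1.
move=> [x y] _; rewrite /wdiff /pos_part !normrM ler_wpM2r//= ler_norml.
have := ler_norm (u x - u y); have := ler_norm (u y - u x); rewrite (distrC (u y)).
by case: (leP (u x) 0) => ux; case: (leP (u y) 0) => uy; lra.
Qed.

Lemma form_domain_pos_part c kap b u : adm c kap b -> dom kap u ->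
  dom kap (pos_part u).
Proof.
move=> [mkap mb c_ge0 ad] [Xu uOO [H iH uH]].
split; [exact: sqint_pos_part|exact: sqint_wdiff_pos_part|exists H => //].
apply: filterS2 ad uH => y Hy uy nOy.
have [k_ge0 ke b_ge0 kb] := Hy nOy; have [Xru BH] := uy nOy.
split; first exact: (sqint_weighted_pos_part oO Xu.1 Xru).
by apply: le_trans BH; exact: (exterior_form_pos_part_le s_gt0 oO bO Xu.1).
Qed.

Lemma form_domainN kap u : dom kap u -> dom kap (- u).
Proof.
move=> [Xu uOO [H iH uH]]; split; first exact: sqintN.
  rewrite (_ : wdiff (- u) = - wdiff u); first exact: sqintN.
  apply/funext => z; transitivity (- wdiff u z); last by [].
  transitivity ((- u z.1 - - u z.2) * Num.sqrt (k z.1 z.2)); first by [].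
  by rewrite /wdiff -mulNr; congr (_ * _); ring.
exists H => //; apply: filterS uH => y uy nOy; have [Fu BH] := uy nOy.
have FNu := sqint_weightedN oO Fu.
split => //; rewrite (exterior_formN s_gt0 oO bO)// exterior_formC.
by rewrite (exterior_formN s_gt0 oO bO)// opprK.
Qed.

Lemma ext_form_neg_part_le0 c kap b u : adm c kap b -> dom kap u ->
  ext_form kap b u (pos_part (- u)) <= 0.
Proof.
move=> ad du; have dp := form_domain_pos_part ad (form_domainN du).
have [K [iK KE ->]] := ext_form_expand ad du dp.
have [mkap mb c_ge0 adae] := ad; have [Xu uOO [H iH uH]] := du.
have [Xp pOO _] := dp.
have C2_ge0 : 0 <= C / 2 by exact: divr_ge0.
rewrite -[leRHS]addr0; apply: lerD.
  rewrite mulr_ge0_le0// /rdot.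
  have iu := sqint_mul mOO uOO pOO.
  have -> : 0 = \int[mu2]_(z in Omega `*` Omega) (0 : R).
    by rewrite Rintegral_cst// mul0r.
  apply: le_Rintegral => //; first exact: integrable0.
  move=> -[x y] _; rewrite /wdiff mulrACA [(x, y).1]/= [(x, y).2]/=.
  apply: mulr_le0_ge0; last by rewrite mulr_ge0 ?sqrtr_ge0.
  have -> : pos_part (- u) x = Num.max (- u x) 0 by [].
  have -> : pos_part (- u) y = Num.max (- u y) 0 by [].
  (* Since max(- p, 0) is nonincreasing in p, the two differences have opposite signs. *)
  move: (u x) (u y) => p q.
  case: (leP (- p) 0) => ux; case: (leP (- q) 0) => uy.
  - by rewrite subrr mulr0.
  - by rewrite mulr_ge0_le0//; lra.
  - by rewrite mulr_le0_ge0//; lra.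
  - have -> : - p - - q = - (p - q) by ring.
    by rewrite mulrN oppr_le0 -expr2 sqr_ge0.
have -> : 0 = \int[mu]_(y in ~` Omega) (0 : R) by rewrite Rintegral_cst// mul0r.
apply: le_Rintegral_ae => //; first exact: integrable0.
apply: filterS3 adae uH KE => y Hy uy Ky nOy.
have [k_ge0 ke b_ge0 kb] := Hy nOy; have [Fu BH] := uy nOy.
have FNu := sqint_weightedN oO Fu; have mNu := (sqintN mO Xu).1.
have Fp := sqint_weighted_pos_part oO mNu FNu.
have := exterior_form_pos_part_ge0 s_gt0 oO bO mNu FNu k_ge0 ke.
rewrite (exterior_formN s_gt0 oO bO kap Fu Fp) oppr_ge0 (Ky nOy) => B_le0.
exact: mulr_ge0_le0.
Qed.

Section comparison.
Context (cS cT : R) (kS kT bS bT u w : 'rV[R]_n -> R).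
Hypotheses (adS : adm cS kS bS) (adT : adm cT kT bT).
Hypothesis kST : {ae mu, forall y, ~ Omega y -> kS y <= kT y \/ kroot_mass y = 0}.
Hypotheses (du : dom kS u) (dw : dom kT w).
Hypotheses (u_ge0 : {ae mu, forall x, Omega x -> 0 <= u x}).
Hypotheses (w_ge0 : {ae mu, forall x, Omega x -> 0 <= w x}).
Local Notation phi := (pos_part (u - w)).

Let exterior : {ae mu, forall y, ~ Omega y ->
  [/\ 0 <= kT y, kT y * kroot_mass y <= 1, kS y <= kT y \/ kroot_mass y = 0,
      X (rt y u) & X (rt y w)]}.
Proof.
have [_ _ _ aT] := adT.
have [_ _ [Hu _ uH]] := du; have [_ _ [Hw _ wH]] := dw.
apply: filterS2 (filterI kST aT) (filterI uH wH) => y [k1 k2] [u1 w1] nOy.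
have [? ? _ _] := k2 nOy; have [? _] := u1 nOy; have [? _] := w1 nOy.
by split => //; exact: k1.
Qed.

Let wdiff_sub : sqint mu2 (Omega `*` Omega) (wdiff (u - w)).
Proof.
have [Xu uOO _] := du; have [Xw wOO _] := dw.
rewrite (_ : wdiff (u - w) = wdiff u - wdiff w); first exact: sqintB.
apply/funext => z.
transitivity (wdiff u z - wdiff w z); last by [].
transitivity ((u z.1 - w z.1 - (u z.2 - w z.2)) * Num.sqrt (k z.1 z.2)); first by [].
by rewrite /wdiff -mulrBl; congr (_ * _); ring.
Qed.

(** The ideal property of the domination criterion: 3 Hu + 2 Hw is an integrable majorant for both
    exterior forms at phi. *)
Lemma form_domain_comparison : dom kS phi /\ dom kT phi.
Proof.
have [Xu uOO [Hu iHu uH]] := du; have [Xw wOO [Hw iHw wH]] := dw.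
have Xp : X phi by apply: (sqint_pos_part mO); exact: sqintB.
have pOO := sqint_wdiff_pos_part (sqintB mO Xu Xw) wdiff_sub.
pose H y := 3 * Hu y + 2 * Hw y.
have iH : mu.-integrable (~` Omega) (EFin \o H).
  have i1 := integrableZl mOc 3 iHu; have i2 := integrableZl mOc 2 iHw.
  exact: eq_integrable (integrableD mOc i1 i2).
have m1 := measurable_funB Xu.1 Xw.1.
split; split => //; exists H => //;
  apply: filterS3 exterior uH wH => y H1 uy wy nOy;
  have [kT_ge0 kTe kle Fu Fw] := H1 nOy;
  have [_ B1] := uy nOy; have [_ B2] := wy nOy;
  (split; first exact: (sqint_weighted_pos_part oO m1 (sqint_weightedB oO Fu Fw))); rewrite /H.
- have := exterior_form_comparison_S s_gt0 oO bO kT_ge0 kTe kle Xu.1 Xw.1 Fu Fw u_ge0 w_ge0; lra.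
- have := exterior_form_comparison_T s_gt0 oO bO kT_ge0 kTe kle Xu.1 Xw.1 Fu Fw u_ge0; lra.
Qed.

Lemma ext_form_comparison : ext_form kT bT w phi <= ext_form kS bS u phi.
Proof.
have [dS dT] := form_domain_comparison.
have [KT [iKT KTE ->]] := ext_form_expand adT dw dT.
have [KS [iKS KSE ->]] := ext_form_expand adS du dS.
have [Xu uOO [Hu iHu uH]] := du; have [Xw wOO [Hw iHw wH]] := dw.
have [Xp pOO _] := dS.
apply: lerD.
  have C2_ge0 : 0 <= C / 2 by exact: divr_ge0.
  apply: (ler_wpM2l C2_ge0); apply: (le_rdot mOO) => //.
  apply: aeW => -[x y] _.
  rewrite /wdiff [leLHS]mulrACA [leRHS]mulrACA [(x, y).1]/= [(x, y).2]/= ler_wpM2r ?mulr_ge0 ?sqrtr_ge0//.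
  have -> : phi x = Num.max (u x - w x) 0 by [].
  have -> : phi y = Num.max (u y - w y) 0 by [].
  (* With r = u - w the difference of the two sides is (r x - r y) (r^+ x - r^+ y), which is
     nonnegative because the positive part is a nondecreasing function. *)
  rewrite -subr_ge0 -mulrBl.
  have -> : u x - u y - (w x - w y) = (u x - w x) - (u y - w y) by ring.
  case: (leP (u x - w x) 0) => ux; case: (leP (u y - w y) 0) => uy; rewrite ?subrr ?mulr0//.
  - by rewrite mulr_le0//; lra.
  - by rewrite mulr_ge0//; lra.
  - by rewrite -expr2 sqr_ge0.
apply: le_Rintegral_ae => //.
apply: filterS3 exterior KTE KSE => y H1 KTy KSy nOy.
have [kT_ge0 kTe kle Fu Fw] := H1 nOy.
rewrite KTy// KSy// ler_wpM2l//.
exact: (exterior_form_comparison s_gt0 oO bO kT_ge0 kTe kle Xu.1 Xw.1 Fu Fw u_ge0).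
Qed.

End comparison.

End form_inequalities.

(** * Positivity and domination *)

Lemma subrACA (V : zmodType) (a b c d : V) : a - b - (c - d) = a - c - (b - d).
Proof. by rewrite !opprB addrACA [RHS]addrACA [- b + _]addrC. Qed.

Section domination.
Context (R : realType) (n : nat) (Omega : set 'rV[R]_n).
Hypothesis mO : measurable Omega.
Implicit Types (u v w f g : 'rV[R]_n -> R).

Local Notation mu := (@lebesgue_rV R n).
Local Notation X := (sqint mu Omega).
Local Notation N := (rnorm mu Omega).
Local Notation dot := (rdot mu Omega).
Local Notation pos := (@pos_part _ 'rV[R]_n R).
Local Notation nonneg u := {ae mu, forall x, Omega x -> 0 <= u x}.

Let NX : seminorm X N. Proof. exact: sqint_seminorm. Qed.

Lemma rnorm_pos_part_lip u v : X u -> X v -> N (pos u) <= N (pos v) + N (u - v).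
Proof.
move=> Xu Xv; have Xpu := sqint_pos_part mO Xu; have Xpv := sqint_pos_part mO Xv.
rewrite (le_trans (sn_le NX Xpu Xpv))// addrC lerD2l.
have Xuv := sqintB mO Xu Xv; have Xp := sqintB mO Xpu Xpv.
apply: (rnorm_le mO Xp Xuv) => x _.
have -> : (pos u - pos v) x = Num.max (u x) 0 - Num.max (v x) 0 by [].
have -> : (u - v) x = u x - v x by [].
rewrite ler_norml; move: (u x) (v x) => p q.
have := ler_norm (p - q); have := ler_norm (q - p); rewrite (distrC q p).
by case: (leP p 0) => ux; case: (leP q 0) => uy; lra.
Qed.

Lemma rnorm_pos_part_le_self u : X u -> N (pos u) <= N u.
Proof.
move=> Xu; apply: (rnorm_le mO (sqint_pos_part mO Xu) Xu) => x _.
exact: pos_part_le_norm.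
Qed.

(** [descent] for the squared norm of the positive part, whose half gradient at u is u^+. *)
Lemma pos_part_descent (v a : R -> 'rV[R]_n -> R) (b K : R) : 0 <= b ->
  (forall t, 0 <= t <= b -> [/\ X (v t), X (a t), N (v t) <= K & N (a t) <= K]) ->
  (forall t, 0 <= t <= b -> dot (pos (v t)) (a t) <= 0) ->
  (forall e, 0 < e -> exists2 d, 0 < d & forall t h, 0 <= t <= b -> 0 < h < d ->
     N (v (t + h) - (v t + h *: a t)) <= e * h) ->
  N (pos (v b)) <= N (pos (v 0)).
Proof.
move=> b_ge0 va vB vexp.
rewrite -ler_sqr ?nnegrE ?sqrtr_ge0//.
apply: (@descent _ _ X N (fun u => N (pos u) ^+ 2) (fun u w => dot (pos u) w) v a b K) => //.
  by move=> u w z h Xu Xw Xz h_ge0; exact: (rdot_pos_part_expand mO).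
move=> e e_gt0; have [d d_gt0 Hd] := vexp e e_gt0; exists d => // t h t_ge0 hd tb.
apply: Hd => //; rewrite t_ge0 /=; have /andP[h_gt0 _] := hd; lra.
Qed.

Section positivity.
Context (D : set ('rV[R]_n -> R)).
Context (a : ('rV[R]_n -> R) -> ('rV[R]_n -> R) -> R) (T : L2_operators R n).
Hypothesis TA : form_semigroup Omega D a T.

(** The orbit stays in the domain and its velocity is minus the operator, so pairing the velocity
    with [w] gives minus a value of the form. *)
Lemma generates_form t g g' : 0 <= t -> X g -> X g' -> generates N T g g' ->
  D (T t g) /\ forall w, X w -> D w -> a (T t g) w = - dot w (T t g').
Proof.
move=> t_ge0 Xg Xg' gg'.
have TX := C0_semigroup_semigroup mO TA.1.
have XTg := sg_mem TX t_ge0 Xg; have XTg' := sg_mem TX t_ge0 Xg'.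
have := generates_orbit NX TX Xg Xg' t_ge0 gg'.
rewrite -[T t g']opprK => /(generated_by_generates mO TA XTg (sqintN mO XTg')).
move=> [DT _ aT]; split => // w Xw Dw; rewrite aT// opprK.
by rewrite -(rdotNr mO)// rdotC.
Qed.

End positivity.

(** Invariance of the cone is the goal, so the data [g] in the domain may change sign; their
    negative part at time 0 has norm at most N (g - f) because f >= 0. *)
Lemma form_semigroup_positivity (D : set ('rV[R]_n -> R))
    (a : ('rV[R]_n -> R) -> ('rV[R]_n -> R) -> R) (T : L2_operators R n) :
  form_semigroup Omega D a T -> (forall u, D u -> X u) ->
  (forall u, D u -> D (pos (- u)) /\ a u (pos (- u)) <= 0) ->
  positivity_preserving Omega T.
Proof.
move=> TA DX Da t f t_ge0 /(L2P mO) Xf; rewrite /ae_in => f_ge0.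
have TX := C0_semigroup_semigroup mO TA.1.
have XT r u : 0 <= r -> X u -> X (T r u) by exact: (sg_mem TX).
have [M M_ge1 TM] := sg_bounded NX TX t_ge0.
apply: (ae_nonneg_of_pos_part mO); first exact: XT.
apply/eqP; rewrite eq_le sqrtr_ge0 andbT; apply/ler_addgt0Pr => e e_gt0.
(* 1 is for the negative part of g at time 0, and M for replacing f by g at time t. *)
have M1_gt0 : 0 < M + 1 by lra.
have e1_gt0 : 0 < e / (M + 1) by rewrite divr_gt0.
have [g [g' [Xg Xg' _ gg' gf]]] : exists g g', [/\ X g, X g', True,
    generates N T g g' & N (g - f) <= e / (M + 1)].
  by apply: (generator_dense NX TX (K := setT)).
pose v r : 'rV[R]_n -> R := - T r g; pose w r : 'rV[R]_n -> R := - T r g'.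
have desc : N (pos (v t)) <= N (pos (v 0)).
  apply: (@pos_part_descent v w t (M * N g + M * N g')) => //.
  - move=> r rt; have /andP[r_ge0 _] := rt.
    have XTg := XT r g r_ge0 Xg; have XTg' := XT r g' r_ge0 Xg'.
    have l1 := TM _ _ rt Xg; have l2 := TM _ _ rt Xg'.
    have Mg u : 0 <= M * N u by rewrite mulr_ge0 ?sqrtr_ge0// (le_trans ler01).
    split; [exact: sqintN|exact: sqintN| |].
    - by rewrite (snN NX)// (le_trans l1)// lerDl.
    - by rewrite (snN NX)// (le_trans l2)// lerDr.
  - move=> r /andP[r_ge0 _].
    have XTg := XT r g r_ge0 Xg; have XTg' := XT r g' r_ge0 Xg'.
    have [D0 E] := generates_form TA r_ge0 Xg Xg' gg'.
    have [Dp ap] := Da _ D0; have Xp := DX _ Dp.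
    by rewrite /w (rdotNr mO)// -E.
  move=> e' e'_gt0.
  have [d d_gt0 Hd] := sg_expand NX TX t_ge0 Xg Xg' gg' e'_gt0.
  exists d => // r h rt hd.
  have /andP[r_ge0 _] := rt; have /andP[/ltW h_ge0 _] := hd.
  have := Hd r h rt hd; apply: le_trans.
  rewrite (_ : v (r + h) - (v r + h *: w r) = - (T (r + h) g - (T r g + h *: T r g'))).
    rewrite (snN NX)//; apply: sqintB => //; first by apply: XT => //; exact: addr_ge0.
    by apply: sqintD => //; [exact: XT|apply: sqintZ => //; exact: XT].
  by rewrite /v /w scalerN -(opprD (T r g)) opprK [RHS]opprB addrC.
have XNT u : X u -> X (- T t u) by move=> Xu; apply: sqintN => //; exact: XT.
have l1 := rnorm_pos_part_lip (XNT _ Xf) (XNT _ Xg).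
have X0g := XT 0 g (lexx 0) Xg.
have l2 : N (pos (v 0)) <= N (g - f).
  have := rnorm_pos_part_le mO (sqintN mO X0g) (sqintN mO Xf).
  have f0 : {ae mu, forall x, Omega x -> (- f) x <= 0}.
    by apply: filterS f_ge0 => x H Ox; rewrite -oppr_ge0 [- _ x]opprK; exact: H.
  move=> /(_ f0) /le_trans; apply.
  rewrite -opprD (snN NX); last by apply: sqintB.
  have := sn_tri NX X0g Xf Xg; rewrite (sg_0 TX Xg) add0r; exact.
have tt : 0 <= t <= t by rewrite t_ge0 lexx.
have l3 : N (- T t f - - T t g) <= M * N (g - f).
  rewrite -opprD (snN NX); last by apply: sqintB => //; exact: XT.
  rewrite (snBC NX); [|exact: XT|exact: XT].
  by rewrite -(sg_B_eq NX TX)//; apply: TM => //; exact: sqintB.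
have l4 : (M + 1) * N (g - f) <= e by rewrite mulrC -ler_pdivlMr.
rewrite add0r (le_trans l1)// (le_trans (lerD (le_trans desc l2) l3))//.
by rewrite (le_trans _ l4)// mulrDl mul1r addrC.
Qed.

Lemma positive_generator_dense (D : set ('rV[R]_n -> R))
    (a : ('rV[R]_n -> R) -> ('rV[R]_n -> R) -> R) (T : L2_operators R n) f e :
  form_semigroup Omega D a T -> positivity_preserving Omega T ->
  X f -> nonneg f -> 0 < e ->
  exists g g', [/\ X g, X g', nonneg g, generates N T g g' & N (g - f) <= e].
Proof.
move=> TA Tpos Xf f_ge0 e_gt0; have TX := C0_semigroup_semigroup mO TA.1.
apply: (generator_dense NX TX (K := [set u | nonneg u])) => //.
- by apply: aeW => x _; exact: lexx.
- move=> u v u0 v0; apply: filterS2 u0 v0 => x ux vx Ox.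
  by apply: addr_ge0; [exact: ux|exact: vx].
- move=> c u c_ge0 u0; apply: filterS u0 => x ux Ox.
  by apply: mulr_ge0 => //; exact: ux.
- by move=> u l Xu Xl ul; exact: (ae_nonneg_closed mO Xu Xl ul).
- by move=> t t_ge0; apply: Tpos => //; exact/L2P.
Qed.

(** * Comparison of two semigroups *)

Section two_semigroups.
Context (DS DT : set ('rV[R]_n -> R)).
Context (aS aT : ('rV[R]_n -> R) -> ('rV[R]_n -> R) -> R) (S T : L2_operators R n).
Hypotheses (SA : form_semigroup Omega DS aS S) (TA : form_semigroup Omega DT aT T).
Hypotheses (DSX : forall u, DS u -> X u) (DTX : forall u, DT u -> X u).
Hypotheses (Spos : positivity_preserving Omega S) (Tpos : positivity_preserving Omega T).
Hypothesis aST : forall u w, DS u -> DT w -> nonneg u -> nonneg w ->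
  [/\ DS (pos (u - w)), DT (pos (u - w)) &
      aT w (pos (u - w)) <= aS u (pos (u - w))].

Let SX : semigroup X N S. Proof. exact: C0_semigroup_semigroup SA.1. Qed.
Let TX : semigroup X N T. Proof. exact: C0_semigroup_semigroup TA.1. Qed.
Let XS r u : 0 <= r -> X u -> X (S r u). Proof. exact: (sg_mem SX). Qed.
Let XT r u : 0 <= r -> X u -> X (T r u). Proof. exact: (sg_mem TX). Qed.

(** Paired with phi = (S r g1 - T r g2)^+, the velocity gives aT (T r g2) phi - aS (S r g1) phi,
    which [aST] makes nonpositive: both orbits are nonnegative by positivity. *)
Let curve_descent t g1 g1' g2 g2' : 0 <= t ->
  X g1 -> X g1' -> nonneg g1 -> generates N S g1 g1' ->
  X g2 -> X g2' -> nonneg g2 -> generates N T g2 g2' ->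
  N (pos (S t g1 - T t g2)) <= N (pos (S 0 g1 - T 0 g2)).
Proof.
move=> t_ge0 Xg1 Xg1' g1_ge0 gen1 Xg2 Xg2' g2_ge0 gen2.
have [M1 M1_ge1 TM1] := sg_bounded NX SX t_ge0.
have [M2 M2_ge1 TM2] := sg_bounded NX TX t_ge0.
have M1_ge0 : 0 <= M1 by exact: le_trans M1_ge1.
have M2_ge0 : 0 <= M2 by exact: le_trans M2_ge1.
pose K1 := M1 * N g1 + M2 * N g2; pose K2 := M1 * N g1' + M2 * N g2'.
have K1_ge0 : 0 <= K1 by rewrite addr_ge0// mulr_ge0 ?sqrtr_ge0.
have K2_ge0 : 0 <= K2 by rewrite addr_ge0// mulr_ge0 ?sqrtr_ge0.
apply: (@pos_part_descent (fun r => S r g1 - T r g2) (fun r => S r g1' - T r g2') t (K1 + K2)) => //.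
- move=> r rt; have /andP[r_ge0 _] := rt.
  have X1 := XS r_ge0 Xg1; have X1' := XS r_ge0 Xg1'.
  have X2 := XT r_ge0 Xg2; have X2' := XT r_ge0 Xg2'.
  have l1 := lerD (TM1 _ _ rt Xg1) (TM2 _ _ rt Xg2).
  have l2 := lerD (TM1 _ _ rt Xg1') (TM2 _ _ rt Xg2').
  split; [exact: sqintB|exact: sqintB| |].
  + rewrite (le_trans (sn_triangle NX X1 (sqintN mO X2)))// (snN NX X2).
    by rewrite (le_trans l1)// lerDl.
  + rewrite (le_trans (sn_triangle NX X1' (sqintN mO X2')))// (snN NX X2').
    by rewrite (le_trans l2)// lerDr.
- move=> r /andP[r_ge0 _].
  have X1 := XS r_ge0 Xg1; have X1' := XS r_ge0 Xg1'.
  have X2 := XT r_ge0 Xg2; have X2' := XT r_ge0 Xg2'.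
  have [D1 E1] := generates_form SA r_ge0 Xg1 Xg1' gen1.
  have [D2 E2] := generates_form TA r_ge0 Xg2 Xg2' gen2.
  have S_ge0 : nonneg (S r g1) by apply: Spos => //; exact/L2P.
  have T_ge0 : nonneg (T r g2) by apply: Tpos => //; exact/L2P.
  have [DpS DpT] := aST D1 D2 S_ge0 T_ge0.
  have Xp := DSX DpS.
  rewrite (E1 _ Xp DpS) (E2 _ Xp DpT) => le1.
  have := rdotL mO 1 X1' (sqintN mO X2') Xp; rewrite scale1r mul1r => ->.
  by rewrite (rdotNr mO)// subr_le0 -lerN2.
move=> e e_gt0; have e2_gt0 : 0 < e / 2 by rewrite divr_gt0.
have [d1 d1_gt0 Hd1] := sg_expand NX SX t_ge0 Xg1 Xg1' gen1 e2_gt0.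
have [d2 d2_gt0 Hd2] := sg_expand NX TX t_ge0 Xg2 Xg2' gen2 e2_gt0.
exists (Num.min d1 d2); first by rewrite lt_min d1_gt0.
move=> r h rt /andP[h_gt0]; rewrite lt_min => /andP[hd1 hd2].
have /andP[r_ge0 _] := rt; have h_ge0 := ltW h_gt0.
have rh_ge0 : 0 <= r + h by exact: addr_ge0.
have h1 : 0 < h < d1 by rewrite h_gt0. have h2 : 0 < h < d2 by rewrite h_gt0.
have := lerD (Hd1 r h rt h1) (Hd2 r h rt h2).
have -> : e / 2 * h + e / 2 * h = e * h by rewrite -mulrDl -splitr.
apply: le_trans.
have Y1 : X (S (r + h) g1 - (S r g1 + h *: S r g1')).
  apply: sqintB => //; first exact: XS.
  by apply: sqintD => //; [exact: XS|apply: sqintZ => //; exact: XS].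
have Y2 : X (T (r + h) g2 - (T r g2 + h *: T r g2')).
  apply: sqintB => //; first exact: XT.
  by apply: sqintD => //; [exact: XT|apply: sqintZ => //; exact: XT].
rewrite -(snN NX Y2); apply: le_trans (sn_triangle NX Y1 (sqintN mO Y2)).
rewrite le_eqVlt; apply/orP; left; apply/eqP; congr N.
by rewrite scalerBr addrACA -opprD subrACA.
Qed.

Let le_of_nonneg t f : 0 <= t -> X f -> nonneg f ->
  {ae mu, forall x, Omega x -> S t f x <= T t f x}.
Proof.
move=> t_ge0 Xf f_ge0.
have XSf := XS t_ge0 Xf; have XTf := XT t_ge0 Xf.
suff H : nonneg (T t f - S t f).
  by apply: filterS H => x H Ox; rewrite -subr_ge0; exact: H.
apply: (ae_nonneg_of_pos_part mO); first exact: sqintB.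
rewrite opprB; apply/eqP; rewrite eq_le sqrtr_ge0 andbT; apply/ler_addgt0Pr => e e_gt0.
have [M1 M1_ge1 TM1] := sg_bounded NX SX t_ge0.
have [M2 M2_ge1 TM2] := sg_bounded NX TX t_ge0.
(* M1 + M2 pays for the approximation of f at time t, and 2 for the approximation at time 0. *)
have M_gt0 : 0 < M1 + M2 + 2 by lra.
have e1_gt0 : 0 < e / (M1 + M2 + 2) by rewrite divr_gt0.
have [g1 [g1' [Xg1 Xg1' g1_ge0 gen1 g1f]]] := positive_generator_dense SA Spos Xf f_ge0 e1_gt0.
have [g2 [g2' [Xg2 Xg2' g2_ge0 gen2 g2f]]] := positive_generator_dense TA Tpos Xf f_ge0 e1_gt0.
have desc := curve_descent t_ge0 Xg1 Xg1' g1_ge0 gen1 Xg2 Xg2' g2_ge0 gen2.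
have XSg := XS t_ge0 Xg1; have XTg := XT t_ge0 Xg2.
have XS0 := XS (lexx 0) Xg1; have XT0 := XT (lexx 0) Xg2.
have l1 := rnorm_pos_part_lip (sqintB mO XSf XTf) (sqintB mO XSg XTg).
have tt : 0 <= t <= t by rewrite t_ge0 lexx.
have l2 : N (S t f - T t f - (S t g1 - T t g2)) <= M1 * N (g1 - f) + M2 * N (g2 - f).
  have -> : S t f - T t f - (S t g1 - T t g2) = (S t f - S t g1) - (T t f - T t g2).
    by rewrite subrACA.
  have Y1 := sqintB mO XSf XSg; have Y2 := sqintB mO XTf XTg.
  rewrite (le_trans (sn_triangle NX Y1 (sqintN mO Y2)))// (snN NX Y2).
  apply: lerD.
    by rewrite (snBC NX XSf XSg) -(sg_B_eq NX SX)//; apply: TM1 => //; exact: sqintB.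
  by rewrite (snBC NX XTf XTg) -(sg_B_eq NX TX)//; apply: TM2 => //; exact: sqintB.
have l3 : N (pos (S 0 g1 - T 0 g2)) <= N (g1 - f) + N (g2 - f).
  have Y := sqintB mO XS0 XT0.
  rewrite (le_trans (rnorm_pos_part_le_self Y))//.
  have := sn_tri4 NX XS0 Xg1 Xg2 XT0.
  rewrite (sg_0 SX Xg1) add0r (snBC NX Xg2 XT0) (sg_0 TX Xg2) addr0 => /le_trans; apply.
  by rewrite (snBC NX Xg2 Xf); exact: (sn_tri NX Xg1 Xg2 Xf).
have l4 : (M1 + M2 + 2) * (e / (M1 + M2 + 2)) = e by rewrite mulrC divfK// gt_eqF.
have l5 : M1 * N (g1 - f) <= M1 * (e / (M1 + M2 + 2)) by rewrite ler_wpM2l//; lra.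
have l6 : M2 * N (g2 - f) <= M2 * (e / (M1 + M2 + 2)) by rewrite ler_wpM2l//; lra.
rewrite add0r (le_trans l1)// (le_trans (lerD (le_trans desc l3) l2))// -[leRHS]l4.
move: (e / _) g1f g2f l5 l6 => q g1f g2f l5 l6.
have -> : (M1 + M2 + 2) * q = q + q + (M1 * q + M2 * q) by ring.
by apply: lerD; exact: lerD.
Qed.

(** [S] applied to the nonnegative functions |f| + f and |f| - f gives |S f| <= S |f|, and S |f| <=
    T |f| by the comparison for nonnegative data. *)
Lemma form_semigroup_dominated : semigroup_dominated Omega S T.
Proof.
split => // t f t_ge0 /(L2P mO) Xf.
have Xa := sqint_abs mO Xf.
pose af : 'rV[R]_n -> R := fun x => `|f x|.
have af_ge0 : nonneg af by apply: aeW => x _; exact: normr_ge0.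
have ST := le_of_nonneg t_ge0 Xa af_ge0.
have Saf (c : R) : `|c| = 1 -> {ae mu, forall x, Omega x -> 0 <= c * S t f x + S t af x}.
  move=> c1.
  have Lf : L2 Omega f by exact/L2P.
  have La : L2 Omega af by exact/L2P.
  have [_ Slin _ _ _] := SA.1.
  have := Slin t c f af t_ge0 Lf La; rewrite /ae_in => E.
  have P : nonneg (S t (fun x => c * f x + af x)).
    apply: Spos => //; first by apply/L2P => //; exact: (sqintL mO c Xf Xa).
    apply: aeW => x _; rewrite -lerBlDl sub0r /af.
    by rewrite (le_trans (ler_norm _))// normrN normrM c1 mul1r.
  by apply: filterS2 E P => x E0 P0 Ox; rewrite -E0//; exact: P0.
rewrite /ae_in.
have S1 := Saf 1 (normr1 _); have S2 := Saf (-1) (normrN1 _).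
apply: filterS3 ST S1 S2 => x H1 H2 H3 Ox.
have := H1 Ox; have := H2 Ox; have := H3 Ox; rewrite mul1r mulN1r => A3 A2 A1.
rewrite (le_trans _ A1)// ler_norml; lra.
Qed.

End two_semigroups.

End domination.

(** * The Dirichlet, Robin and Neumann extensions *)

Lemma Cns_ge0 (R : realType) (n : nat) (s : R) : 0 <= s -> 0 <= Cns n s.
Proof.
move=> s_ge0.
have G_ge0 (z : R) : 0 <= Gamma z.
  by apply: Rintegral_ge0 => t _; rewrite mulr_ge0 ?powR_ge0 ?expR_ge0.
by rewrite /Cns divr_ge0// ?mulr_ge0 ?powR_ge0.
Qed.

(** The inverse is f times the real power -1 of f^2; both are 0 where f vanishes. *)
Lemma measurable_funV d (T : measurableType d) (R : realType) (D : set T) (f : T -> R) :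
  measurable_fun D f -> measurable_fun D (fun x => (f x)^-1).
Proof.
move=> mf.
rewrite (_ : (fun x => _) = fun x => f x * (f x ^+ 2) `^ (-1)).
  apply: measurable_funM => //.
  apply: (measurableT_comp (measurable_powR _)); exact: measurable_funX.
apply/funext => x; rewrite powRN powRr1 ?sqr_ge0// expr2 invfM mulrA.
have [->|fx] := eqVneq (f x) 0; first by rewrite invr0 mulr0.
by rewrite mulfV// mul1r.
Qed.

Section extensions.
Context (R : realType) (n : nat) (s : R) (Omega : set 'rV[R]_n).
Hypotheses (s_gt0 : 0 < s) (oO : open Omega) (bO : bounded_set Omega).
Implicit Types (u v beta : 'rV[R]_n -> R) (x y : 'rV[R]_n).

Local Notation mu := (@lebesgue_rV R n).
Local Notation C := (Cns n s).
Local Notation kroot_mass := (kroot_mass s Omega).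
Local Notation rho := (rho s Omega).
Local Notation adm := (admissible s Omega).
Local Notation dom := (form_domain s Omega).

Let mO : measurable Omega. Proof. exact: open_measurable_rV. Qed.
Let mOc : measurable (~` Omega). Proof. exact: measurableC. Qed.
Let C_ge0 : 0 <= C. Proof. by apply: Cns_ge0; exact: ltW. Qed.

Lemma kroot_mass_closure y : closure Omega y -> kroot_mass y = 0.
Proof.
move=> cl; rewrite /kroot_mass /rdot (@eq_Rintegral _ _ _ _ _ (cst 0)) ?Rintegral_cst ?mul0r//.
by move=> x _; rewrite /kroot mem_set// mul0r.
Qed.

Lemma kroot_massE y : ~ closure Omega y -> kroot_mass y = rho y.
Proof.
move=> ncl; apply: eq_Rintegral => x _; rewrite /kroot memNset//.
by rewrite -expr2 sqr_sqrtr// hkernel_ge0.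
Qed.

Lemma rho_ge0 y : 0 <= rho y.
Proof. by apply: Rintegral_ge0 => x _; exact: hkernel_ge0. Qed.

Lemma measurable_rho : measurable_fun (~` Omega) rho.
Proof.
apply: (measurable_Rintegral2 mu mO mOc (G := fun z => hkernel s z.2 z.1)).
under eq_fun do rewrite hkernelC.
by apply: measurable_funS (@measurable_hkernel R n s) => //; exact: measurableT.
Qed.

Definition coef_R beta y : R := C / (C * rho y + beta y).
Definition coef_N y : R := (rho y)^-1.

Let kmassE u y : ~ closure Omega y ->
  kmass s Omega u y = \int[mu]_(x in Omega) (u x * hkernel s y x).
Proof.
move=> ncl; apply: eq_Rintegral => x _; rewrite /kroot memNset// /weighted -mulrA.
by rewrite -expr2 sqr_sqrtr// hkernel_ge0.
Qed.

(** On the boundary both sides are 0: the left by definition, the right because [kmass] vanishes on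
    the closure. *)
Let ext_withE kap w u :
  (forall x, ~ closure Omega x -> w x = kap x * kmass s Omega u x) ->
  ext_with Omega w u = extend s Omega kap u.
Proof.
move=> wE; apply/funext => x; rewrite /ext_with /extend.
case: ifPn => // _; case: ifPn => [/set_mem cl|ncl]; first by rewrite kmass_closure// mulr0.
by rewrite wE// => cl; rewrite (mem_set cl) in ncl.
Qed.

Lemma ext_DE u : ext_D Omega u = extend s Omega (cst 0) u.
Proof. by apply/funext => x; rewrite /ext_D /patch /extend /= mul0r. Qed.

Lemma ext_NE u : ext_N s Omega u = extend s Omega coef_N u.
Proof. by apply: ext_withE => x ncl; rewrite kmassE. Qed.

Lemma ext_RE beta u : ext_R s Omega beta u = extend s Omega (coef_R beta) u.
Proof. by apply: ext_withE => x ncl; rewrite kmassE. Qed.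

Lemma admissible_D : adm 0 (cst 0) (cst 0).
Proof.
split => //.
by apply: aeW => y _; split => //= [|_]; rewrite !mul0r ?mulr0.
Qed.

(** Off the closure kap (1 - kap rho) vanishes both when kap rho = 1 and when rho = 0, where kap has
    the default value 0; hence c = 0 suffices. *)
Lemma admissible_N : adm 0 coef_N (cst 0).
Proof.
split => //; first exact: (measurable_funV measurable_rho).
apply: aeW => y _; split => //=.
- by rewrite invr_ge0 rho_ge0.
- have [cl|ncl] := pselect (closure Omega y); first by rewrite kroot_mass_closure// mulr0.
  rewrite kroot_massE// /coef_N; have [->|r0] := eqVneq (rho y) 0; first by rewrite mulr0.
  by rewrite mulVf.
- move=> ncl; rewrite kroot_massE// /coef_N !mul0r.
  have [->|r0] := eqVneq (rho y) 0; first by rewrite invr0 mul0r mulr0.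
  by rewrite mulVf// subrr !mulr0.
Qed.

Lemma admissible_R beta : measurable_fun (~` Omega) beta ->
  {ae mu, forall x, (~` Omega) x -> 0 <= beta x} -> adm C^-1 (coef_R beta) beta.
Proof.
move=> mb b_ge0; split => //.
- apply: measurable_funM => //; apply: measurable_funV.
  apply: measurable_funD => //; apply: measurable_funM => //.
  exact: measurable_rho.
- by rewrite invr_ge0.
apply: filterS b_ge0 => y Hb nOy; have {Hb}b_ge0 := Hb nOy.
have r_ge0 := rho_ge0 y.
have D_ge0 : 0 <= C * rho y + beta y by rewrite addr_ge0// mulr_ge0.
have k_ge0 : 0 <= coef_R beta y by exact: divr_ge0.
have ke : coef_R beta y * rho y <= 1.
  rewrite /coef_R mulrAC.
  have [->|D0] := eqVneq (C * rho y + beta y) 0; first by rewrite invr0 mulr0.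
  have D_gt0 : 0 < C * rho y + beta y by rewrite lt_neqAle eq_sym D0.
  by rewrite ler_pdivrMr// mul1r lerDl.
(* If C rho + beta is nonzero, then 1 - kap rho = beta / (C rho + beta); otherwise kap = 0 and both
   sides vanish. *)
have E : C * (coef_R beta y * (1 - coef_R beta y * rho y)) = beta y * coef_R beta y ^+ 2.
  rewrite /coef_R; move: C (rho y) (beta y) => c r b.
  have [->|D0] := eqVneq (c * r + b) 0; first by rewrite invr0 !mulr0 mul0r mulr0 expr0n /= mulr0.
  by field.
split => //.
  have [cl|ncl] := pselect (closure Omega y); first by rewrite kroot_mass_closure// mulr0.
  by rewrite kroot_massE.
move=> ncl; rewrite kroot_massE//; split => //; rewrite -E.
have [C0|C0] := eqVneq C 0; last by rewrite mulKf.
by rewrite /coef_R C0 !mul0r mulr0.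
Qed.

(** For rho > 0 this amounts to C rho <= C rho + beta. Where rho = 0 the default value 1 / 0 = 0 can
    break the order, whence the second alternative. *)
Lemma coef_R_le_coef_N beta y : 0 <= beta y -> coef_R beta y <= coef_N y \/ kroot_mass y = 0.
Proof.
move=> b_ge0.
have [cl|ncl] := pselect (closure Omega y); first by right; exact: kroot_mass_closure.
have [r0|r0] := eqVneq (rho y) 0; first by right; rewrite kroot_massE.
left; have r_gt0 : 0 < rho y by rewrite lt_neqAle eq_sym r0 rho_ge0.
rewrite /coef_R /coef_N.
have [->|D0] := eqVneq (C * rho y + beta y) 0; first by rewrite invr0 mulr0 invr_ge0 ltW.
have D_gt0 : 0 < C * rho y + beta y.
  by rewrite lt_neqAle eq_sym D0 addr_ge0// mulr_ge0// ltW.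
by rewrite ler_pdivrMr// mulrC ler_pdivlMr// lerDl.
Qed.

Let form_domainE c kap b (E : ('rV[R]_n -> R) -> 'rV[R]_n -> R) u : adm c kap b ->
  (forall u, E u = extend s Omega kap u) ->
  (L2 Omega u /\ Wspace s Omega b (E u)) <-> dom kap u.
Proof.
move=> ad EE; rewrite EE; split => [[/(L2P mO) Xu]|du].
  exact: (Wspace_ext_form_domain s_gt0 oO bO ad Xu).
split; last exact: (form_domain_Wspace_ext s_gt0 oO bO C_ge0 ad du).
by apply/(L2P mO); have [] := du.
Qed.

Let energyE u v kap (E : ('rV[R]_n -> R) -> 'rV[R]_n -> R) :
  (forall u, E u = extend s Omega kap u) ->
  energy s Omega (E u) (E v) = ext_form s Omega kap (cst 0) u v.
Proof.
move=> EE; rewrite /ext_form !EE.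
rewrite (_ : \int[mu]_(x in ~` Omega) _ = 0) ?addr0//.
rewrite (@eq_Rintegral _ _ _ _ _ (cst 0)) ?Rintegral_cst ?mul0r// => x _.
by rewrite !mul0r.
Qed.

Let set_eqP (A B : set ('rV[R]_n -> R)) : (forall u, A u <-> B u) -> A = B.
Proof. by move=> AB; apply/seteqP; split => u /AB. Qed.

Lemma dom_DE : dom_D s Omega = dom (cst 0).
Proof. by apply: set_eqP => u; exact: (form_domainE u admissible_D ext_DE). Qed.

Lemma dom_NE : dom_N s Omega = dom coef_N.
Proof. by apply: set_eqP => u; exact: (form_domainE u admissible_N ext_NE). Qed.

Lemma form_DE : form_D s Omega = ext_form s Omega (cst 0) (cst 0).
Proof. by apply/funext => u; apply/funext => v; exact: (energyE u v ext_DE). Qed.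

Lemma form_NE : form_N s Omega = ext_form s Omega coef_N (cst 0).
Proof. by apply/funext => u; apply/funext => v; exact: (energyE u v ext_NE). Qed.

Lemma dom_RE beta : measurable_fun (~` Omega) beta ->
  {ae mu, forall x, (~` Omega) x -> 0 <= beta x} ->
  dom_R s Omega beta = dom (coef_R beta).
Proof.
move=> mb b0; apply: set_eqP => u.
exact: (form_domainE u (admissible_R mb b0) (ext_RE beta)).
Qed.

Lemma form_RE beta : form_R s Omega beta = ext_form s Omega (coef_R beta) beta.
Proof. by apply/funext => u; apply/funext => v; rewrite /form_R !ext_RE. Qed.

Lemma ext_form_positivity c kap b T : adm c kap b ->
  form_semigroup Omega (dom kap) (ext_form s Omega kap b) T ->
  positivity_preserving Omega T.
Proof.
move=> ad TA; apply: (form_semigroup_positivity mO TA) => [u []//|u du].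
split; last exact: (ext_form_neg_part_le0 s_gt0 oO bO C_ge0 ad du).
exact: (form_domain_pos_part s_gt0 oO bO ad (form_domainN s_gt0 oO bO du)).
Qed.

Lemma ext_form_dominated cS cT kS kT bS bT S T :
  adm cS kS bS -> adm cT kT bT ->
  {ae mu, forall y, ~ Omega y -> kS y <= kT y \/ kroot_mass y = 0} ->
  form_semigroup Omega (dom kS) (ext_form s Omega kS bS) S ->
  form_semigroup Omega (dom kT) (ext_form s Omega kT bT) T ->
  semigroup_dominated Omega S T.
Proof.
move=> adS adT kST SA TA.
apply: (form_semigroup_dominated mO SA TA).
- by move=> u [].
- exact: ext_form_positivity adS SA.
- exact: ext_form_positivity adT TA.
move=> u w du dw u0 w0.
have [dS dT] := form_domain_comparison s_gt0 oO bO adT kST du dw u0 w0.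
by split => //; exact: (ext_form_comparison s_gt0 oO bO C_ge0 adS adT kST du dw u0 w0).
Qed.

End extensions.

Theorem theorem4p2 (R : realType) (n : nat) (s : R) (Omega : set 'rV[R]_n)
    (beta : 'rV[R]_n -> R) (TD TR TN : L2_operators R n) :
  (1 <= n)%N -> 0 < s < 1 ->
  open Omega -> bounded_set Omega -> lipschitz_boundary Omega ->
  (@lebesgue_rV R n).-integrable (~` Omega) (EFin \o beta) ->
  (\forall x \ae @lebesgue_rV R n, (~` Omega) x -> 0 <= beta x) ->
  form_semigroup Omega (dom_D s Omega) (form_D s Omega) TD ->
  form_semigroup Omega (dom_R s Omega beta) (form_R s Omega beta) TR ->
  form_semigroup Omega (dom_N s Omega) (form_N s Omega) TN ->
  [/\ positivity_preserving Omega TD,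
      semigroup_dominated Omega TD TR &
      semigroup_dominated Omega TR TN].
Proof.
move=> _ /andP[s_gt0 _] oO bO _ ib b_ge0.
have mb : measurable_fun (~` Omega) beta.
  by apply/measurable_EFinP; have /integrableP[] := ib.
rewrite (dom_DE s_gt0 oO bO) (form_DE s oO) (dom_RE s_gt0 oO bO mb b_ge0).
rewrite (form_RE s oO) (dom_NE s_gt0 oO bO) (form_NE s oO) => TDA TRA TNA.
have aR := admissible_R s_gt0 oO mb b_ge0.
split.
- exact: ext_form_positivity (admissible_D _ _) TDA.
- apply: (ext_form_dominated _ _ _ (admissible_D s Omega) aR _ TDA TRA) => //.
  (* The Dirichlet coefficient is 0, so only the sign of the Robin coefficient is at stake. *)
  apply: filterS b_ge0 => y b0 nOy; left.
  have C_ge0 := Cns_ge0 n (ltW s_gt0).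
  apply: divr_ge0 => //; apply: addr_ge0; last exact: b0.
  by apply: mulr_ge0 => //; exact: rho_ge0.
- apply: (ext_form_dominated _ _ _ aR (admissible_N s oO) _ TRA TNA) => //.
  by apply: filterS b_ge0 => y b0 nOy; apply: coef_R_le_coef_N => //; exact: b0.
Qed.
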